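(* Let $f:\mathbb{R}\to\mathbb{R}$ be of bounded variation on $[-\infty,\infty]$, and define $f(\infty)=\lim_{x\to\infty}f(x)$ and $f(-\infty)=\lim_{x\to-\infty}f(x)$. Let $$g(x)=f(x)-f(\infty)H(x)-f(-\infty)H(-x).$$ Then $g$ is of bounded variation on $[-\infty,\infty]$ and $\lim_{|x|\to\infty}g(x)=0$. As distributions on $\mathbb{R}$, the Fourier transforms of $f$ and $g$ satisfy $$\hat f(s)=\hat g(s)+f(\infty)\left[\pi\delta(s)+\frac{1}{is}\right]+f(-\infty)\left[\pi\delta(s)-\frac{1}{is}\right].$$ And, for each $x\in\mathbb{R}$, $$\frac{f(x-)+f(x+)}{2}=\frac{1}{2\pi}\lim_{\substack{T\to\infty\\ S\to0^+}}\int_{S<|s|<T}e^{ixs}\hat g(s)\,ds+f(\infty)H(x)+f(-\infty)H(-x),$$ where in this last formula $\hat g(s)=\int_{-\infty}^{\infty}e^{-ist}g(t)\,dt$ for $s\ne0$.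
   Context: $H$ is the Heaviside step function: $H(x)=1$ for $x>0$, $H(0)=1/2$, $H(x)=0$ for $x<0$. $f(x\pm)$ are the one-sided limits of $f$ at $x$. A function $f$ is of bounded variation on $[-\infty,\infty]$ if the sums $\sum_{n=1}^N|f(x_n)-f(x_{n-1})|$ are bounded over all partitions $-\infty=x_0<x_1<\dots<x_N=\infty$, where $f(\pm\infty)$ denotes $\lim_{t\to\pm\infty}f(t)$. The Fourier transform convention is $\hat\phi(s)=\int_{-\infty}^\infty e^{-ist}\phi(t)\,dt$, extended to tempered distributions by $\langle\hat u,\phi\rangle=\langle u,\hat\phi\rangle$. $\delta$ is the Dirac distribution at $0$, and $1/s$ is the distribution $\phi\mapsto\int_0^\infty\frac{\phi(x)-\phi(-x)}{x}\,dx$. In the inversion formula the integral $\int_{-\infty}^\infty e^{-ist}g(t)\,dt$ ($s\neq0$) is understood as the (possibly conditionally convergent) improper integral $\lim_{A\to-\infty,\,B\to\infty}\int_A^B e^{-ist}g(t)\,dt$, and the limits $T\to\infty$, $S\to0^+$ are taken independently. *)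

(* Defs.v *)
(* Stdlib reals with Coquelicot. *)
From Stdlib Require Import Reals.
From Coquelicot Require Import Coquelicot.

Open Scope R_scope.

Definition heaviside (x : R) : R :=
  if Rlt_dec 0 x then 1 else if Rlt_dec x 0 then 0 else / 2.

(* The extension of f to [-oo, oo] by f(+-oo) = lim f at +-oo.  [Lim] is
   total, so this is a real number even when the limit does not exist or is
   infinite.  This is harmless in [bounded_variation_Rbar]: bounded sums over all
   partitions bound the variation of f on R, and so force both limits to exist
   and to be finite. *)
Definition extend (f : R -> R) (x : Rbar) : R :=
  match x with
  | Finite r => f r
  | _ => real (Lim f x)
  end.

Definition partition (N : nat) (x : nat -> Rbar) : Prop :=
  x 0%nat = m_infty /\ x N = p_infty /\
  forall n : nat, (n < N)%nat -> Rbar_lt (x n) (x (S n)).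

Definition bounded_variation_Rbar (f : R -> R) : Prop :=
  exists M : R, forall (N : nat) (x : nat -> Rbar), partition N x ->
    sum_n_m (fun n => Rabs (extend f (x n) - extend f (x (n - 1)%nat))) 1 N <= M.

(* exp (i * theta) *)
Definition expi (theta : R) : C := (cos theta, sin theta).

(* Improper integrals over R; the two endpoints tend to -oo and +oo
   independently. *)
Definition is_integral (h : R -> C) (l : C) : Prop :=
  is_RInt_gen (V := C_R_NormedModule) h
    (Rbar_locally m_infty) (Rbar_locally p_infty) l.

Definition integral (h : R -> C) : C :=
  RInt_gen (V := C_R_CompleteNormedModule) h
    (Rbar_locally m_infty) (Rbar_locally p_infty).

Definition fourier_integrand (phi : R -> C) (s t : R) : C :=
  Cmult (expi (- (s * t))) (phi t).

(* Total; meaningful where the integral converges. *)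
Definition fourier (phi : R -> C) (s : R) : C :=
  integral (fourier_integrand phi s).

Definition CDerive_n (phi : R -> C) (n : nat) (x : R) : C :=
  (Derive_n (fun t => Re (phi t)) n x, Derive_n (fun t => Im (phi t)) n x).

Definition smooth (phi : R -> C) : Prop :=
  forall (n : nat) (x : R),
    ex_derive_n (fun t => Re (phi t)) n x /\
    ex_derive_n (fun t => Im (phi t)) n x.

Definition schwartz (phi : R -> C) : Prop :=
  smooth phi /\
  forall k n : nat, exists B : R, forall x : R,
    Rabs x ^ k * Cmod (CDerive_n phi n x) <= B.

(* Distributions are represented by functionals on all functions R -> C, but
   only their values on Schwartz functions carry meaning: these are the only
   ones that [tempered] and [distr_eq] look at. *)
Definition functional : Type := (R -> C) -> C.

Definition distr_eq (u v : functional) : Prop :=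
  forall phi : R -> C, schwartz phi -> u phi = v phi.

(* In the second clause B is any common bound of the seminorms of order at
   most N, hence the clause bounds u by a multiple of the largest of them. *)
Definition tempered (u : functional) : Prop :=
  (forall (a b : C) (phi psi : R -> C), schwartz phi -> schwartz psi ->
     u (fun x => Cplus (Cmult a (phi x)) (Cmult b (psi x))) =
     Cplus (Cmult a (u phi)) (Cmult b (u psi))) /\
  (exists (N : nat) (K : R), forall (phi : R -> C) (B : R), schwartz phi ->
     (forall (k n : nat) (x : R), (k <= N)%nat -> (n <= N)%nat ->
        Rabs x ^ k * Cmod (CDerive_n phi n x) <= B) ->
     Cmod (u phi) <= K * B).

Definition distr_of (f : R -> R) : functional :=
  fun phi => integral (fun t => Cmult (RtoC (f t)) (phi t)).

Definition fourier_distr (u : functional) : functional :=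
  fun phi => u (fourier phi).

Definition dirac : functional := fun phi => phi 0.

(* The distribution 1/s. *)
Definition inv_distr : functional :=
  fun phi =>
    RInt_gen (V := C_R_CompleteNormedModule)
      (fun x => Cdiv (Cminus (phi x) (phi (- x))) (RtoC x))
      (at_right 0) (Rbar_locally p_infty).

Definition ex_integral_on (h : R -> C) (a b : R) : Prop :=
  ex_RInt (V := C_R_NormedModule) h a b.

Definition integral_on (h : R -> C) (a b : R) : C :=
  RInt (V := C_R_CompleteNormedModule) h a b.

(* The integral of h over S < |s| < T. *)
Definition ex_annulus_integral (h : R -> C) (S T : R) : Prop :=
  ex_integral_on h (- T) (- S) /\ ex_integral_on h S T.

Definition annulus_integral (h : R -> C) (S T : R) : C :=
  Cplus (integral_on h (- T) (- S)) (integral_on h S T).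

(* Main.v *)
Require Import Defs.
From Stdlib Require Import Reals Lra Lia.
From Coquelicot Require Import Coquelicot.

(** The idea is to reduce everything to decreasing functions.  A function of
    bounded variation is a difference of two bounded decreasing functions
    ([bounded_variation_bdiff]), and so is g.  For a decreasing P >= 0 and an
    oscillating k, the integral of P k over [a, b] is at most P(a) times the
    largest integral of k over an initial piece [a, c] ([second_mean_value]); this
    estimate replaces absolute convergence throughout.

    Inversion at x.  For u > 0 the functions g(x + u) and g(x - u) are differences of
    decreasing functions that tend to 0 at infinity.  The estimate with
    k(u) = cos(su), sin(su) is Dirichlet's test: the transforms converge for s <> 0,
    uniformly for s away from 0.  Hence one may integrate over S < |s| < T under the
    integral sign.  The sine parts cancel, and what remains is twice the integral of
    g(x + u) + g(x - u) against (sin(Tu) - sin(Su))/u over u > 0.  By the same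
    estimate the T-part tends to PI/2 (g(x+) + g(x-)) and the S-part to 0
    ([dirichlet_kernel_limit]).  The constant comes from the sine integral, whose
    value is found by damping with exp(-au) ([Si_atan_bound]).  The average of the
    one-sided limits of f - g is exactly the Heaviside combination at x.

    The distributional identity.  By linearity in f - g it says that H and H(-x) have
    the transforms PI delta + 1/(is) and PI delta - 1/(is), that is, it computes the
    integrals of phi^ over the two half-lines.  Let a be the real or the imaginary
    part of phi.  The integral over s > 0 of its cosine transform is PI a(0): this is
    the inversion formula at 0 again, because a has bounded variation
    ([is_lim_RInt_cos_transform]).  Its sine transform is -W', where W is the cosine
    transform of w(t) = (a(t) - a(-t))/t over t > 0; since w also has bounded
    variation, W tends to 0, and the integral over s > 0 is W(0), which is 1/s tested
    against a ([is_lim_RInt_sin_transform]).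

    Two integrations by parts bound phi^(s) by a multiple of 1/(1 + s^2), with a
    constant controlled by Schwartz seminorms ([trig_transform_decay]).  As f and g are
    bounded, their pairings with phi^ converge and are tempered. *)

(** * Riemann integrals of decreasing functions *)

Lemma ex_RInt_cont (k : R -> R) (a b : R) :
  (forall x, continuous k x) -> ex_RInt k a b.
Proof. intros hk; apply (ex_RInt_continuous (V := R_CompleteNormedModule)); intros z _; apply hk. Qed.

Lemma RInt_correct_R (h : R -> R) a b : ex_RInt h a b -> is_RInt h a b (RInt h a b).
Proof. apply (RInt_correct (V := R_CompleteNormedModule)). Qed.

Lemma is_RInt_zero (a b : R) : is_RInt (fun _ => 0) a b 0.
Proof.
  assert (H := is_RInt_const (V := R_NormedModule) a b 0).
  unfold scal in H; simpl in H; unfold mult in H; simpl in H.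
  rewrite Rmult_0_r in H. exact H.
Qed.

(** Such a chi is the indicator of an initial segment [a, c] of [a, b], except
    possibly at c itself, which the integral does not see. *)
Lemma is_RInt_decreasing_indicator (chi k : R -> R) (a b : R) :
  a <= b -> (forall x, chi x = 0 \/ chi x = 1) -> decreasing chi ->
  (forall u v, ex_RInt k u v) ->
  exists c, a <= c <= b /\ is_RInt (fun x => chi x * k x) a b (RInt k a c).
Proof.
  intros hab h01 hdec hk.
  destruct (h01 a) as [ha | ha].
  - exists a. split; [lra|].
    rewrite RInt_point.
    apply (is_RInt_ext (fun _ => 0)).
    + intros x hx. rewrite Rmin_left, Rmax_right in hx by lra.
      assert (chi x <= chi a) by (apply hdec; lra).
      destruct (h01 x) as [e | e]; rewrite e; lra.
    + apply is_RInt_zero.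
  - destruct (completeness (fun x => a <= x <= b /\ chi x = 1)) as [c [hc1 hc2]].
    + exists b. intros x hx. lra.
    + exists a. lra.
    + assert (hac : a <= c) by (apply hc1; lra).
      assert (hcb : c <= b) by (apply hc2; intros x hx; lra).
      exists c. split; [lra|].
      replace (RInt k a c) with (plus (RInt k a c) 0)
        by (unfold plus; simpl; lra).
      apply (is_RInt_Chasles (V := R_NormedModule) _ a c b).
      * apply (is_RInt_ext k).
        -- intros x hx. rewrite Rmin_left, Rmax_right in hx by lra.
           destruct (h01 x) as [e | e]; [|rewrite e; lra].
           exfalso. assert (c <= x); [|lra].
           apply hc2. intros y [hy1 hy2].
           destruct (Rle_dec y x) as [|n]; [lra|].
           assert (chi y <= chi x) by (apply hdec; lra). lra.
        -- apply RInt_correct_R, hk.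
      * apply (is_RInt_ext (fun _ => 0)).
        -- intros x hx. rewrite Rmin_left, Rmax_right in hx by lra.
           destruct (h01 x) as [e | e]; [rewrite e; lra|].
           exfalso. assert (x <= c); [|lra]. apply hc1. lra.
        -- apply is_RInt_zero.
Qed.

Definition threshold (c y : R) : R := if Rle_dec c y then 1 else 0.

(** Layer-cake approximation of y from below by n layers of thickness eta.  Applied
    to the values of a decreasing function, each layer is an indicator as above. *)
Fixpoint layers (eta : R) (n : nat) (y : R) : R :=
  match n with
  | O => 0
  | S m => layers eta m y + eta * threshold (INR (S m) * eta) y
  end.

Lemma layers_close (eta : R) (n : nat) (y : R) :
  0 <= eta -> 0 <= y <= INR n * eta -> y - eta <= layers eta n y <= y.
Proof.
  intros he hy.
  assert (H : layers eta n y <= y /\ layers eta n y <= INR n * eta /\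
              (y - eta <= layers eta n y \/ INR n * eta <= layers eta n y)).
  { destruct hy as [hy _]. induction n as [|n IH].
    - simpl. lra.
    - cbn [layers]. unfold threshold. rewrite S_INR in *.
      destruct (Rle_dec ((INR n + 1) * eta) y) as [h | h]; nra. }
  nra.
Qed.

Lemma is_RInt_layers (P k : R -> R) (a b eta S : R) (n : nat) :
  a <= b -> 0 <= eta -> decreasing P -> (forall u v, ex_RInt k u v) ->
  exists I, is_RInt (fun x => layers eta n (P x) * k x) a b I /\
    ((forall c, a <= c <= b -> Rabs (RInt k a c) <= S) -> Rabs I <= INR n * eta * S).
Proof.
  intros hab he hP hk. induction n as [|n [I [hI hb]]].
  - exists 0. split.
    + apply (is_RInt_ext (fun _ => 0)).
      * intros x _. simpl. lra.
      * apply is_RInt_zero.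
    + intros _. simpl. rewrite Rabs_R0. lra.
  - destruct (is_RInt_decreasing_indicator
      (fun x => threshold (INR (Datatypes.S n) * eta) (P x)) k a b hab) as [c [hc hJ]].
    + intros x. unfold threshold. destruct Rle_dec; auto.
    + intros x y hxy. unfold threshold.
      assert (P y <= P x) by now apply hP.
      do 2 destruct Rle_dec; lra.
    + exact hk.
    + exists (I + eta * RInt k a c). split.
      * apply (is_RInt_ext (fun x => plus (layers eta n (P x) * k x)
          (scal eta (threshold (INR (Datatypes.S n) * eta) (P x) * k x)))).
        -- intros x _. cbn [layers]. unfold plus, scal; simpl; unfold mult; simpl. ring.
        -- apply (is_RInt_plus (V := R_NormedModule)); [exact hI|].
           now apply (is_RInt_scal (V := R_NormedModule)).
      * intros hS. rewrite S_INR.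
        eapply Rle_trans; [apply Rabs_triang|].
        rewrite Rabs_mult, (Rabs_pos_eq eta) by lra.
        specialize (hb hS). specialize (hS c hc). nra.
Qed.

Definition clamp (a b x : R) : R := Rmax a (Rmin b x).

Lemma clamp_bounds a b x : a <= b -> a <= clamp a b x <= b.
Proof.
  intros h. unfold clamp, Rmax, Rmin. repeat destruct Rle_dec; lra.
Qed.

Lemma clamp_id a b x : a <= x <= b -> clamp a b x = x.
Proof.
  intros h. unfold clamp, Rmax, Rmin. repeat destruct Rle_dec; lra.
Qed.

(** The estimate behind the second mean value theorem.  Both claims are clear
    for indicators of initial segments, pass to their nonnegative combinations
    (the heights of the layers add up to P a), and then to uniform limits. *)
Lemma second_mean_value (P k : R -> R) (a b : R) :
  a <= b -> decreasing P -> 0 <= P b -> (forall x, continuous k x) ->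
  ex_RInt (fun x => P x * k x) a b /\
  forall S, (forall c, a <= c <= b -> Rabs (RInt k a c) <= S) ->
    Rabs (RInt (fun x => P x * k x) a b) <= P a * S.
Proof.
  intros hab hP hPb hk.
  destruct (bounded_continuity k a b) as [K hK].
  { intros x _. apply hk. }
  assert (hK0 : 0 <= K).
  { eapply Rle_trans; [apply (norm_ge_0 (k a))|]. left. apply hK. lra. }
  assert (hPa : 0 <= P a) by (apply Rle_trans with (P b); [|apply hP]; lra).
  set (eta := fun n : nat => P a / INR (Datatypes.S n)).
  assert (heta : forall n, 0 <= eta n /\ INR (Datatypes.S n) * eta n = P a).
  { intros n. assert (0 < INR (Datatypes.S n)) by (apply lt_0_INR; lia).
    unfold eta. split; [|field; lra].
    apply Rmult_le_pos; [lra|]. left. now apply Rinv_0_lt_compat. }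
  (* Uniform convergence is needed on all of R, hence the composition with clamp,
     which changes nothing inside (a, b). *)
  set (F := fun n x => layers (eta n) (Datatypes.S n) (P (clamp a b x)) * k (clamp a b x)).
  set (G := fun x => P (clamp a b x) * k (clamp a b x)).
  assert (hF : forall n, is_RInt (F n) a b (RInt (F n) a b) /\
    forall S, (forall c, a <= c <= b -> Rabs (RInt k a c) <= S) ->
    Rabs (RInt (F n) a b) <= P a * S).
  { intros n. destruct (heta n) as [h1 h2].
    assert (H : forall S, exists I, is_RInt (F n) a b I /\
      ((forall c, a <= c <= b -> Rabs (RInt k a c) <= S) -> Rabs I <= P a * S)).
    { intros S.
      destruct (is_RInt_layers P k a b (eta n) S (Datatypes.S n) hab h1 hP) as [I [hI hb]].
      { intros u v. now apply ex_RInt_cont. }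
      exists I. rewrite <- h2. split; [|exact hb].
      apply (is_RInt_ext (fun x => layers (eta n) (Datatypes.S n) (P x) * k x)); [|exact hI].
      intros x hx. rewrite Rmin_left, Rmax_right in hx by lra.
      unfold F. rewrite clamp_id by lra. reflexivity. }
    split.
    - destruct (H 0) as [I [hI _]]. apply RInt_correct_R. now exists I.
    - intros S hS. destruct (H S) as [I [hI hb]].
      rewrite (is_RInt_unique _ _ _ _ hI). auto. }
  destruct (filterlim_RInt (V := R_CompleteNormedModule) F a b eventually _ G
    (fun n => RInt (F n) a b)) as [I [hI1 hI2]].
  - intros n. apply hF.
  - apply (filterlim_locally (U := fct_UniformSpace R R_UniformSpace)). intros eps.
    assert (hd : 0 < eps / (P a * K + 1)).
    { apply Rdiv_lt_0_compat; [apply eps|nra]. }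
    destruct (nfloor_ex (/ (eps / (P a * K + 1)))) as [N hN].
    { left. now apply Rinv_0_lt_compat. }
    exists N. intros n hn x.
    destruct (heta n) as [h1 h2].
    pose proof (clamp_bounds a b x hab) as hc.
    assert (hl : P (clamp a b x) - eta n <= layers (eta n) (Datatypes.S n) (P (clamp a b x))
                 <= P (clamp a b x)).
    { apply layers_close; [exact h1|]. rewrite h2. split.
      - apply Rle_trans with (P b); [lra|]. apply hP. lra.
      - apply hP. lra. }
    specialize (hK _ hc).
    change (Rabs (k (clamp a b x)) < K) in hK.
    change (Rabs (F n x - G x) < eps). unfold F, G.
    rewrite <- Rmult_minus_distr_r, Rabs_mult.
    assert (e1 : Rabs (layers (eta n) (Datatypes.S n) (P (clamp a b x)) - P (clamp a b x)) <= eta n).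
    { apply Rabs_le. lra. }
    assert (hN' : / (eps / (P a * K + 1)) < INR (Datatypes.S n)).
    { apply Rlt_le_trans with (INR N + 1); [lra|]. rewrite S_INR.
      apply le_INR in hn. lra. }
    assert (hS : 0 < INR (Datatypes.S n)) by (apply lt_0_INR; lia).
    assert (e2 : P a * K + 1 < eps * INR (Datatypes.S n)).
    { replace (P a * K + 1) with (/ (eps / (P a * K + 1)) * eps).
      - pose proof (cond_pos eps). nra.
      - field. split; [nra|]. pose proof (cond_pos eps). lra. }
    apply Rle_lt_trans with (eta n * K).
    + apply Rmult_le_compat; try apply Rabs_pos; lra.
    + apply Rmult_lt_reg_l with (INR (Datatypes.S n)); [exact hS|].
      rewrite <- Rmult_assoc, h2. lra.
  - assert (hI3 : is_RInt (fun x => P x * k x) a b I).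
    { apply (is_RInt_ext G); [|exact hI2].
      intros x hx. rewrite Rmin_left, Rmax_right in hx by lra.
      unfold G. rewrite clamp_id by lra. reflexivity. }
    split; [now exists I|].
    intros S hS. rewrite (is_RInt_unique _ _ _ _ hI3).
    assert (hl : is_lim_seq (fun n => Rabs (RInt (F n) a b)) (Rabs I)).
    { apply (is_lim_seq_abs (fun n => RInt (F n) a b) I). exact hI1. }
    apply (is_lim_seq_le (fun n => Rabs (RInt (F n) a b)) (fun _ => P a * S) (Rabs I) (P a * S)).
    + intros n. now apply hF.
    + exact hl.
    + apply is_lim_seq_const.
Qed.

Lemma ex_RInt_decreasing_mult (P k : R -> R) (a b : R) :
  decreasing P -> (forall x, continuous k x) -> ex_RInt (fun x => P x * k x) a b.
Proof.
  intros hP hk.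
  assert (H : forall a b, a <= b -> ex_RInt (fun x => P x * k x) a b).
  { clear a b. intros a b hab.
    apply (ex_RInt_ext (fun x => plus ((P x - P b) * k x) (scal (P b) (k x)))).
    - intros x _. unfold plus, scal; simpl; unfold mult; simpl. ring.
    - apply (ex_RInt_plus (V := R_NormedModule)).
      + apply (second_mean_value (fun x => P x - P b)); [exact hab| |lra|exact hk].
        intros x y h. apply hP in h. lra.
      + apply (ex_RInt_scal (V := R_NormedModule)). now apply ex_RInt_cont. }
  destruct (Rle_dec a b) as [h | h]; [now apply H|].
  apply ex_RInt_swap, H. lra.
Qed.

(** * Dirichlet's test *)

Lemma is_lim_p_infty_eps (f : R -> R) (l : R) :
  (forall eps : posreal, exists M, forall x, M < x -> Rabs (f x - l) < eps) ->
  is_lim f p_infty l.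
Proof. intros h. apply is_lim_spec. intros eps. apply h. Qed.

Lemma is_lim_p_infty_elim (f : R -> R) (l : R) (eps : R) :
  is_lim f p_infty l -> 0 < eps -> exists M, 0 < M /\ forall x, M <= x -> Rabs (f x - l) < eps.
Proof.
  intros h he. apply is_lim_spec in h. destruct (h (mkposreal eps he)) as [M hM].
  exists (Rmax M 0 + 1). pose proof (Rmax_l M 0). pose proof (Rmax_r M 0).
  split; [lra|]. intros x hx. apply hM. lra.
Qed.

Lemma continuous_eps (f : R -> R) (x : R) :
  (forall eps : posreal, exists d : posreal, forall y, Rabs (y - x) < d -> Rabs (f y - f x) < eps) ->
  continuous f x.
Proof.
  intros h. apply filterlim_locally. intros eps. destruct (h eps) as [d hd].
  exists d. intros y hy. apply hd, hy.
Qed.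

Lemma RInt_Chasles_R (h : R -> R) a b c :
  (forall u v, ex_RInt h u v) -> RInt h a b + RInt h b c = RInt h a c.
Proof.
  intros H. apply (RInt_Chasles (V := R_CompleteNormedModule)); apply H.
Qed.

Lemma RInt_Chasles_minus (h : R -> R) a b c :
  (forall u v, ex_RInt h u v) -> RInt h a c - RInt h a b = RInt h b c.
Proof.
  intros H. apply Rplus_eq_reg_l with (RInt h a b).
  rewrite RInt_Chasles_R by exact H. ring.
Qed.

Lemma ex_RInt_minus_R (f g : R -> R) a b :
  ex_RInt f a b -> ex_RInt g a b -> ex_RInt (fun x => f x - g x) a b.
Proof. apply (ex_RInt_minus (V := R_NormedModule)). Qed.

Lemma ex_RInt_scal_R (f : R -> R) c a b :
  ex_RInt f a b -> ex_RInt (fun x => c * f x) a b.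
Proof. apply (ex_RInt_scal (V := R_NormedModule)). Qed.

Lemma RInt_plus_R (f g : R -> R) a b :
  ex_RInt f a b -> ex_RInt g a b ->
  RInt (fun x => f x + g x) a b = RInt f a b + RInt g a b.
Proof. apply (RInt_plus (V := R_CompleteNormedModule)). Qed.

Lemma RInt_minus_R (f g : R -> R) a b :
  ex_RInt f a b -> ex_RInt g a b ->
  RInt (fun x => f x - g x) a b = RInt f a b - RInt g a b.
Proof. apply (RInt_minus (V := R_CompleteNormedModule)). Qed.

Lemma RInt_scal_R (f : R -> R) c a b :
  ex_RInt f a b -> RInt (fun x => c * f x) a b = c * RInt f a b.
Proof. intros h. apply (RInt_scal (V := R_CompleteNormedModule) f a b c h). Qed.

Definition vanishing (P : R -> R) : Prop := decreasing P /\ is_lim P p_infty 0.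

Lemma vanishing_nonneg P x : vanishing P -> 0 <= P x.
Proof.
  intros [hd hl]. destruct (Rle_dec 0 (P x)) as [|n]; [assumption|exfalso].
  destruct (is_lim_p_infty_elim P 0 (- P x) hl) as [M [_ hM]]; [lra|].
  specialize (hM (Rmax M x) (Rmax_l _ _)).
  assert (P (Rmax M x) <= P x) by (apply hd, Rmax_r).
  apply Rabs_def2 in hM. lra.
Qed.

(** By the second mean value estimate the integral of P k over [A, b] is at most
    P A times the integrals of k beyond A, and P A tends to 0.  The bound S' may
    depend on A: for the Dirichlet kernel it decays in A. *)
Lemma dirichlet_test (P k : R -> R) (S : R) :
  vanishing P -> (forall x, continuous k x) ->
  (forall a b, 0 <= a -> a <= b -> Rabs (RInt k a b) <= S) ->
  exists I, is_lim (fun A => RInt (fun u => P u * k u) 0 A) p_infty (Finite I) /\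
    forall A S', 0 <= A -> (forall b, A <= b -> Rabs (RInt k A b) <= S') ->
      Rabs (I - RInt (fun u => P u * k u) 0 A) <= P A * S'.
Proof.
  intros hP hk hS.
  assert (hint : forall a b, ex_RInt (fun u => P u * k u) a b)
    by (intros; apply ex_RInt_decreasing_mult; [apply hP|exact hk]).
  assert (hS0 : 0 <= S).
  { specialize (hS 0 0 ltac:(lra) ltac:(lra)).
    pose proof (Rabs_pos (RInt k 0 0)). lra. }
  assert (tail : forall a b S', a <= b -> (forall c, a <= c -> Rabs (RInt k a c) <= S') ->
     Rabs (RInt (fun u => P u * k u) 0 b - RInt (fun u => P u * k u) 0 a) <= P a * S').
  { intros a b S' hab hS'.
    rewrite (RInt_Chasles_minus _ 0 a b hint).
    apply second_mean_value; auto; [apply hP|now apply vanishing_nonneg|].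
    intros c hc. apply hS'. lra. }
  destruct (proj1 (filterlim_locally_cauchy (U := R_CompleteSpace) (F := Rbar_locally p_infty)
    (fun A => RInt (fun u => P u * k u) 0 A))) as [I hI].
  { intros eps.
    destruct (is_lim_p_infty_elim P 0 (eps / (S + 1)) (proj2 hP)) as [M [hM0 hM]].
    { apply Rdiv_lt_0_compat; [apply eps|lra]. }
    exists (fun x => M < x). split; [now exists M|].
    assert (H : forall u v, M < u -> u <= v ->
      Rabs (RInt (fun t => P t * k t) 0 v - RInt (fun t => P t * k t) 0 u) < eps).
    { intros u v hu huv.
      apply Rle_lt_trans with (P u * S).
      - apply tail; [lra|]. intros c hc. apply hS; lra.
      - specialize (hM u ltac:(lra)). rewrite Rminus_0_r in hM. apply Rabs_def2 in hM.
        assert (e : eps / (S + 1) * (S + 1) = eps) by (field; lra).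
        pose proof (cond_pos eps). pose proof (vanishing_nonneg P u hP). nra. }
    intros u v hu hv. change (Rabs (RInt (fun t => P t * k t) 0 v - RInt (fun t => P t * k t) 0 u) < eps).
    destruct (Rle_dec u v) as [h | h]; [now apply H|].
    rewrite Rabs_minus_sym. apply H; lra. }
  exists I. split; [exact hI|].
  intros A S' hA hS'.
  assert (hl : is_lim (fun B => Rabs (RInt (fun u => P u * k u) 0 B
       - RInt (fun u => P u * k u) 0 A)) p_infty
       (Finite (Rabs (I - RInt (fun u => P u * k u) 0 A)))).
  { apply (is_lim_Rabs _ p_infty (Finite (I - RInt (fun u => P u * k u) 0 A))).
    apply is_lim_minus'; [exact hI|apply is_lim_const]. }
  apply (is_lim_le_loc _ (fun _ => P A * S') p_infty _ (Finite (P A * S'))) in hl;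
    [exact hl| |apply is_lim_const].
  exists A. intros B hB. apply tail; [lra|exact hS'].
Qed.

(** * Trigonometric kernels *)

Definition trig (k : R -> R) : Prop := k = cos \/ k = sin.

Lemma continuous_trig k : trig k -> forall s u, continuous (fun u => k (s * u)) u.
Proof.
  intros [-> | ->] s u; apply (ex_derive_continuous (V := R_NormedModule)); auto_derive; auto.
Qed.

Lemma RInt_trig_bound k s a b :
  trig k -> s <> 0 -> Rabs (RInt (fun u => k (s * u)) a b) <= 2 / Rabs s.
Proof.
  intros hk hs.
  assert (H : exists K : R -> R, (forall x, Rabs (K x) <= 1) /\
     is_RInt (fun u => k (s * u)) a b (K (s * b) / s - K (s * a) / s)).
  { destruct hk as [-> | ->].
    - exists sin. split; [intros x; apply Rabs_le, SIN_bound|].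
      apply (is_RInt_derive (V := R_CompleteNormedModule) (fun u => sin (s * u) / s)).
      + intros x _. auto_derive; [auto|field; auto].
      + intros x _. apply (continuous_trig cos). now left.
    - exists (fun x => - cos x). split.
      { intros x. rewrite Rabs_Ropp. apply Rabs_le, COS_bound. }
      apply (is_RInt_derive (V := R_CompleteNormedModule) (fun u => - cos (s * u) / s)).
      + intros x _. auto_derive; [auto|field; auto].
      + intros x _. apply (continuous_trig sin). now right. }
  destruct H as [K [hK1 hK2]].
  rewrite (is_RInt_unique _ _ _ _ hK2).
  replace (K (s * b) / s - K (s * a) / s) with ((K (s * b) - K (s * a)) * / s) by (field; auto).
  rewrite Rabs_mult, Rabs_inv. unfold Rdiv.
  apply Rmult_le_compat_r.
  - left. apply Rinv_0_lt_compat. now apply Rabs_pos_lt.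
  - eapply Rle_trans; [apply Rabs_triang|]. rewrite Rabs_Ropp.
    pose proof (hK1 (s * b)). pose proof (hK1 (s * a)). lra.
Qed.

Lemma lipschitz_derive (F F' : R -> R) (M : R) :
  (forall x, is_derive F x (F' x)) -> (forall x, Rabs (F' x) <= M) ->
  forall x y, Rabs (F y - F x) <= M * Rabs (y - x).
Proof.
  intros hF hM x y.
  destruct (MVT_gen F x y F') as [c [_ hc]].
  - intros z _. apply hF.
  - intros z _. apply continuity_pt_filterlim, (ex_derive_continuous (V := R_NormedModule)).
    now exists (F' z).
  - rewrite hc, Rabs_mult. apply Rmult_le_compat_r; [apply Rabs_pos|apply hM].
Qed.

Lemma taylor_quadratic (F F' F'' : R -> R) (M : R) :
  (forall x, is_derive F x (F' x)) -> (forall x, is_derive F' x (F'' x)) ->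
  (forall x, Rabs (F'' x) <= M) ->
  forall x h, Rabs (F (x + h) - F x - h * F' x) <= M * h ^ 2.
Proof.
  intros hF hF' hM x h.
  destruct (MVT_gen F x (x + h) F') as [c [hc1 hc]].
  - intros z _. apply hF.
  - intros z _. apply continuity_pt_filterlim, (ex_derive_continuous (V := R_NormedModule)).
    now exists (F' z).
  - rewrite hc. replace (F' c * (x + h - x) - h * F' x) with (h * (F' c - F' x)) by ring.
    rewrite Rabs_mult.
    assert (h1 := lipschitz_derive F' F'' M hF' hM x c).
    assert (h2 : Rabs (c - x) <= Rabs h).
    { unfold Rmin, Rmax in hc1. destruct (Rle_dec x (x + h)); unfold Rabs; repeat destruct Rcase_abs; lra. }
    assert (0 <= M) by (pose proof (hM x); pose proof (Rabs_pos (F'' x)); lra).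
    rewrite <- (pow2_abs h). pose proof (Rabs_pos h).
    apply Rle_trans with (Rabs h * (M * Rabs h)); [|simpl; lra].
    apply Rmult_le_compat_l; [lra|]. eapply Rle_trans; [exact h1|].
    now apply Rmult_le_compat_l.
Qed.

Lemma trig_lipschitz k : trig k -> forall x y, Rabs (k y - k x) <= Rabs (y - x).
Proof.
  intros [-> | ->] x y; rewrite <- (Rmult_1_l (Rabs (y - x))).
  - apply (lipschitz_derive cos (fun x => - sin x)).
    + intros z. apply is_derive_cos.
    + intros z. rewrite Rabs_Ropp. apply Rabs_le, SIN_bound.
  - apply (lipschitz_derive sin cos).
    + intros z. apply is_derive_sin.
    + intros z. apply Rabs_le, COS_bound.
Qed.

Lemma trig_bound k : trig k -> forall x, Rabs (k x) <= 1.
Proof.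
  intros [-> | ->] x; apply Rabs_le; [apply COS_bound|apply SIN_bound].
Qed.

Lemma sin_taylor x h : Rabs (sin (x + h) - sin x - h * cos x) <= h ^ 2.
Proof.
  rewrite <- (Rmult_1_l (h ^ 2)).
  apply (taylor_quadratic sin cos (fun x => - sin x)).
  - intros z. apply is_derive_sin.
  - intros z. apply is_derive_cos.
  - intros z. rewrite Rabs_Ropp. apply Rabs_le, SIN_bound.
Qed.

Lemma cos_taylor x h : Rabs (cos (x + h) - cos x + h * sin x) <= h ^ 2.
Proof.
  rewrite <- (Rmult_1_l (h ^ 2)).
  replace (cos (x + h) - cos x + h * sin x) with (cos (x + h) - cos x - h * - sin x) by ring.
  apply (taylor_quadratic cos (fun x => - sin x) (fun x => - cos x)).
  - intros z. apply is_derive_cos.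
  - intros z. apply (is_derive_opp (V := R_NormedModule) sin z), is_derive_sin.
  - intros z. rewrite Rabs_Ropp. apply Rabs_le, COS_bound.
Qed.

Lemma exp_taylor y : Rabs (exp y - 1 - y) <= y ^ 2 * exp (Rabs y).
Proof.
  assert (h1 := exp_ineq1_le y). assert (h2 := exp_ineq1_le (- y)).
  assert (h3 := exp_pos y).
  assert (h4 : exp y * exp (- y) = 1) by (rewrite <- exp_plus, Rplus_opp_r; apply exp_0).
  assert (h5 : exp y - 1 <= y * exp y) by nra.
  rewrite Rabs_pos_eq by lra.
  destruct (Rle_dec 0 y) as [h | h].
  - rewrite Rabs_pos_eq by lra. nra.
  - rewrite Rabs_left by lra.
    assert (1 <= exp (- y)) by lra.
    apply Rle_trans with (y ^ 2); [nra|]. pose proof (pow2_ge_0 y). nra.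
Qed.

Lemma is_derive_atan_pow x : is_derive atan x (/ (1 + x ^ 2)).
Proof.
  apply is_derive_Reals, derivable_pt_lim_atan.
Qed.

Lemma is_derive_quadratic (F : R -> R) (s d M : R) :
  (forall h, Rabs h <= 1 -> Rabs (F (s + h) - F s - h * d) <= M * h ^ 2) ->
  is_derive F s d.
Proof.
  intros H. apply is_derive_Reals. intros eps he.
  assert (hM : 0 <= M).
  { specialize (H 1). rewrite Rabs_R1 in H. specialize (H ltac:(lra)).
    pose proof (Rabs_pos (F (s + 1) - F s - 1 * d)). lra. }
  assert (hd : 0 < Rmin 1 (eps / (M + 1))).
  { apply Rmin_pos; [lra|]. apply Rdiv_lt_0_compat; lra. }
  exists (mkposreal _ hd). intros h hn hh. simpl in hh.
  assert (h1 : Rabs h < 1) by (eapply Rlt_le_trans; [exact hh|apply Rmin_l]).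
  assert (h2 : Rabs h < eps / (M + 1)) by (eapply Rlt_le_trans; [exact hh|apply Rmin_r]).
  specialize (H h ltac:(lra)).
  replace ((F (s + h) - F s) / h - d) with ((F (s + h) - F s - h * d) * / h) by (field; auto).
  assert (hp : 0 < Rabs h) by now apply Rabs_pos_lt.
  rewrite Rabs_mult, Rabs_inv.
  apply Rle_lt_trans with (M * Rabs h).
  - apply Rmult_le_reg_r with (Rabs h); [exact hp|].
    rewrite Rmult_assoc, Rinv_l by lra. rewrite <- (pow2_abs h) in H. lra.
  - assert (e : eps / (M + 1) * (M + 1) = eps) by (field; lra). nra.
Qed.

(** Differentiation under the integral sign: a quadratic remainder that is uniform
    in the integration variable survives the integration. *)
Lemma is_derive_RInt_quadratic (K k : R -> R -> R) (a b s M : R) :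
  a <= b -> (forall s, ex_RInt (K s) a b) -> ex_RInt (k s) a b ->
  (forall h u, Rabs h <= 1 -> a <= u <= b ->
     Rabs (K (s + h) u - K s u - h * k s u) <= M * h ^ 2) ->
  is_derive (fun s => RInt (K s) a b) s (RInt (k s) a b).
Proof.
  intros hab hK hk H. apply (is_derive_quadratic _ s _ ((b - a) * M)).
  intros h hh. rewrite <- RInt_minus_R, <- RInt_scal_R, <- RInt_minus_R; auto.
  - rewrite Rmult_assoc. apply abs_RInt_le_const; [exact hab| |].
    + apply ex_RInt_minus_R; [now apply ex_RInt_minus_R|now apply ex_RInt_scal_R].
    + intros u hu. now apply H.
  - now apply ex_RInt_minus_R.
  - now apply ex_RInt_scal_R.
Qed.

(** * The sine integral *)

(** The function F(x)/x, with the value d at 0 that makes it continuous there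
    when F(0) = 0 and F'(0) = d. *)
Definition divx (F : R -> R) (d x : R) : R :=
  if Req_EM_T x 0 then d else F x / x.

Lemma divx_neq F d x : x <> 0 -> divx F d x = F x / x.
Proof. intros h. unfold divx. now destruct Req_EM_T. Qed.

Lemma divx_0 F d : divx F d 0 = d.
Proof. unfold divx. now destruct Req_EM_T. Qed.

Lemma continuous_divx F d :
  F 0 = 0 -> is_derive F 0 d -> (forall x, continuous F x) ->
  forall x, continuous (divx F d) x.
Proof.
  intros h0 hd hF x. destruct (Req_dec x 0) as [-> | hx].
  - apply continuous_eps. intros eps. apply is_derive_Reals in hd.
    destruct (hd eps (cond_pos eps)) as [del H]. exists del. intros y hy.
    rewrite Rminus_0_r in hy. rewrite divx_0.
    destruct (Req_dec y 0) as [-> | hn].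
    + rewrite divx_0, Rminus_eq_0, Rabs_R0. apply eps.
    + rewrite divx_neq by assumption. specialize (H y hn hy).
      rewrite h0, Rplus_0_l, Rminus_0_r in H. exact H.
  - apply (continuous_ext_loc _ (fun y => F y / y)).
    + exists (mkposreal (Rabs x) (Rabs_pos_lt x hx)). intros y hy.
      change (Rabs (y - x) < Rabs x) in hy.
      symmetry. apply divx_neq. intros ->. rewrite Rminus_0_l, Rabs_Ropp in hy. lra.
    + apply (continuous_mult (K := R_AbsRing)); [apply hF|].
      apply (ex_derive_continuous (V := R_NormedModule)). auto_derive. exact hx.
Qed.

Definition sinc : R -> R := divx sin 1.

Lemma continuous_sinc x : continuous sinc x.
Proof.
  apply continuous_divx.
  - apply sin_0.
  - rewrite <- cos_0. apply is_derive_sin.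
  - intros y. apply (ex_derive_continuous (V := R_NormedModule)). auto_derive. auto.
Qed.

Lemma sinc_mult x : sinc x * x = sin x.
Proof.
  unfold sinc. destruct (Req_dec x 0) as [-> | hx].
  - rewrite sin_0. ring.
  - rewrite divx_neq by exact hx. field. exact hx.
Qed.

Lemma sinc_bound x : Rabs (sinc x) <= 1.
Proof.
  unfold sinc. destruct (Req_dec x 0) as [-> | hx].
  - rewrite divx_0, Rabs_R1. lra.
  - rewrite divx_neq by exact hx. unfold Rdiv. rewrite Rabs_mult, Rabs_inv.
    assert (h := trig_lipschitz sin (or_intror eq_refl) 0 x).
    rewrite sin_0, !Rminus_0_r in h.
    assert (0 < Rabs x) by now apply Rabs_pos_lt.
    apply Rmult_le_reg_r with (Rabs x); [assumption|].
    rewrite Rmult_assoc, Rinv_l; lra.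
Qed.

Definition Si (B : R) : R := RInt sinc 0 B.

(** Damping by exp (- a u) turns the sine integral into a function J of a whose
    derivative is elementary: up to a term of size exp (- a B) it is - 1 / (1 + a^2).
    Integrating from 0 to A compares J 0 = Si B with atan A, as J A is at most 1 / A. *)
Lemma Si_atan_bound (A B : R) : 0 < A -> 0 < B -> Rabs (atan A - Si B) <= 2 / B + / A.
Proof.
  intros hA hB.
  (* k is the derivative of K in a; E is the error term of the derivative of J. *)
  set (K := fun a u => exp (- (a * u)) * sinc u).
  set (k := fun a u => - (exp (- (a * u)) * sin u)).
  set (J := fun a => RInt (K a) 0 B).
  set (E := fun a => exp (- (a * B)) * (cos B + a * sin B) / (1 + a ^ 2)).
  assert (cexp : forall a u, continuous (fun u => exp (- (a * u))) u).
  { intros a u. apply (ex_derive_continuous (V := R_NormedModule)). auto_derive. auto. }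
  assert (hKc : forall a u, continuous (K a) u).
  { intros a u. apply (continuous_mult (K := R_AbsRing)); [apply cexp|apply continuous_sinc]. }
  assert (hkc : forall a u, continuous (k a) u).
  { intros a u. apply (ex_derive_continuous (V := R_NormedModule)). unfold k. auto_derive. auto. }
  assert (hJ : forall a, 0 <= a -> is_derive J a (RInt (k a) 0 B)).
  { intros a ha. apply (is_derive_RInt_quadratic K k 0 B a (B ^ 2 * exp B)).
    - lra.
    - intros s. apply ex_RInt_cont, hKc.
    - apply ex_RInt_cont, hkc.
    - intros h u hh hu. unfold K, k.
      replace (- ((a + h) * u)) with (- (a * u) + - (h * u)) by ring.
      rewrite exp_plus, <- (sinc_mult u).
      match goal with |- Rabs ?x <= _ =>
        replace x with (exp (- (a * u)) * sinc u * (exp (- (h * u)) - 1 - - (h * u))) by ring end.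
      rewrite !Rabs_mult.
      assert (h1 := exp_taylor (- (h * u))).
      assert (h2 : exp (- (a * u)) <= 1).
      { rewrite <- exp_0. destruct (Req_dec (a * u) 0) as [e | e].
        - rewrite e, Ropp_0. lra.
        - left. apply exp_increasing. assert (0 <= a * u) by (apply Rmult_le_pos; lra). lra. }
      assert (h3 := sinc_bound u). assert (h4 := exp_pos (- (a * u))).
      rewrite (Rabs_pos_eq (exp (- (a * u)))) by lra.
      assert (h5 : exp (Rabs (- (h * u))) <= exp B).
      { assert (h6 : Rabs (- (h * u)) <= B).
        { rewrite Rabs_Ropp, Rabs_mult, (Rabs_pos_eq u) by lra.
          pose proof (Rabs_pos h). nra. }
        destruct h6 as [h6 | ->]; [left; now apply exp_increasing|lra]. }
      assert (h7 : (- (h * u)) ^ 2 <= B ^ 2 * h ^ 2).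
      { replace ((- (h * u)) ^ 2) with (u ^ 2 * h ^ 2) by ring.
        apply Rmult_le_compat_r; [apply pow2_ge_0|]. apply pow_incr. lra. }
      pose proof (Rabs_pos (sinc u)).
      assert (h8 : 0 <= exp (- (a * u)) * Rabs (sinc u) <= 1) by nra.
      pose proof (Rabs_pos (exp (- (h * u)) - 1 - - (h * u))).
      pose proof (exp_pos (Rabs (- (h * u)))). pose proof (exp_pos B).
      pose proof (pow2_ge_0 (- (h * u))).
      apply Rle_trans with (Rabs (exp (- (h * u)) - 1 - - (h * u))); [nra|].
      eapply Rle_trans; [exact h1|]. nra. }
  assert (hk : forall a, RInt (k a) 0 B = E a - / (1 + a ^ 2)).
  { intros a. assert (0 < 1 + a ^ 2) by (pose proof (pow2_ge_0 a); lra).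
    apply is_RInt_unique.
    replace (E a - / (1 + a ^ 2)) with
      (minus (exp (- (a * B)) * (cos B + a * sin B) / (1 + a ^ 2))
             (exp (- (a * 0)) * (cos 0 + a * sin 0) / (1 + a ^ 2))).
    - apply (is_RInt_derive (V := R_CompleteNormedModule)
        (fun u => exp (- (a * u)) * (cos u + a * sin u) / (1 + a ^ 2))).
      + intros u _. unfold k. auto_derive; [auto|field; simpl in *; lra].
      + intros u _. apply hkc.
    - unfold minus, plus, opp; simpl. unfold E. rewrite Rmult_0_r, Ropp_0, exp_0, cos_0, sin_0.
      simpl in *. field. lra. }
  assert (hE : is_RInt E 0 A (J A + atan A - (J 0 + atan 0))).
  { apply (is_RInt_derive (V := R_CompleteNormedModule) (fun a => J a + atan a)).
    - intros a ha. rewrite Rmin_left, Rmax_right in ha by lra.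
      assert (e : E a = RInt (k a) 0 B + / (1 + a ^ 2)) by (rewrite hk; ring).
      rewrite e. apply (is_derive_plus (V := R_NormedModule) J atan a
        (RInt (k a) 0 B) (/ (1 + a ^ 2))); [apply hJ; lra|].
      apply is_derive_atan_pow.
    - intros a _. apply (ex_derive_continuous (V := R_NormedModule)). unfold E. auto_derive.
      pose proof (pow2_ge_0 a). simpl in *. lra. }
  assert (hJ0 : J 0 = Si B).
  { unfold J, Si, K. apply RInt_ext. intros u _. rewrite Rmult_0_l, Ropp_0, exp_0. apply Rmult_1_l. }
  assert (hexp : forall c d, 0 < c -> 0 < d ->
     exists l, is_RInt (fun u => exp (- (u * c))) 0 d l /\ l <= / c).
  { intros c d hc hd. exists (minus (- exp (- (d * c)) / c) (- exp (- (0 * c)) / c)). split.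
    - apply (is_RInt_derive (V := R_CompleteNormedModule) (fun u => - exp (- (u * c)) / c)).
      + intros u _. auto_derive; [auto|field; lra].
      + intros u _. apply (ex_derive_continuous (V := R_NormedModule)). auto_derive. auto.
    - unfold minus, plus, opp; simpl. rewrite Rmult_0_l, Ropp_0, exp_0.
      pose proof (exp_pos (- (d * c))). pose proof (Rinv_0_lt_compat c hc).
      unfold Rdiv. nra. }
  assert (hJA : Rabs (J A) <= / A).
  { destruct (hexp A B hA hB) as [l [hl1 hl2]].
    apply Rle_trans with l; [|exact hl2].
    apply (norm_RInt_le (V := R_NormedModule) (K A) (fun u => exp (- (u * A))) 0 B); [lra| | |exact hl1].
    - intros u hu. change (Rabs (K A u) <= exp (- (u * A))). unfold K.
      rewrite Rabs_mult, (Rmult_comm A u). pose proof (exp_pos (- (u * A))).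
      rewrite (Rabs_pos_eq (exp _)) by lra. pose proof (sinc_bound u). nra.
    - apply RInt_correct_R, ex_RInt_cont, hKc. }
  assert (hEA : Rabs (J A + atan A - (J 0 + atan 0)) <= 2 / B).
  { destruct (hexp B A hB hA) as [l [hl1 hl2]].
    apply Rle_trans with (2 * l); [|unfold Rdiv; lra].
    apply (norm_RInt_le (V := R_NormedModule) E (fun u => scal 2 (exp (- (u * B)))) 0 A);
      [lra| |exact hE|].
    - intros a ha. change (Rabs (E a) <= 2 * exp (- (a * B))). unfold E.
      pose proof (exp_pos (- (a * B))). pose proof (pow2_ge_0 a).
      unfold Rdiv. rewrite !Rabs_mult, Rabs_inv.
      rewrite (Rabs_pos_eq (exp _)), (Rabs_pos_eq (1 + a ^ 2)) by lra.
      rewrite Rmult_assoc, (Rmult_comm 2). apply Rmult_le_compat_l; [lra|].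
      apply Rmult_le_reg_r with (1 + a ^ 2); [lra|].
      rewrite Rmult_assoc, Rinv_l, Rmult_1_r by lra.
      eapply Rle_trans; [apply Rabs_triang|]. rewrite Rabs_mult, (Rabs_pos_eq a) by lra.
      pose proof (trig_bound cos (or_introl eq_refl) B).
      pose proof (trig_bound sin (or_intror eq_refl) B). nra.
    - now apply (is_RInt_scal (V := R_NormedModule)). }
  rewrite hJ0, atan_0 in hEA.
  replace (atan A - Si B) with ((J A + atan A - (Si B + 0)) + - J A) by ring.
  eapply Rle_trans; [apply Rabs_triang|]. rewrite Rabs_Ropp. lra.
Qed.

(** Let A tend to infinity in the previous bound; atan A = PI/2 - atan (1/A). *)
Lemma Si_close (B : R) : 0 < B -> Rabs (Si B - PI / 2) <= 2 / B.
Proof.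
  intros hB. apply le_epsilon. intros eps he.
  assert (hA : 0 < 2 / eps) by (apply Rdiv_lt_0_compat; lra).
  assert (h1 := Si_atan_bound (2 / eps) B hA hB).
  assert (hi : / (2 / eps) = eps / 2) by (field; lra).
  assert (h2 := atan_inv (2 / eps) hA). rewrite hi in *.
  assert (h3 : Rabs (atan (eps / 2)) <= eps / 2).
  { rewrite <- (Rminus_0_r (atan (eps / 2))), <- atan_0.
    rewrite <- (Rabs_pos_eq (eps / 2)) at 2 by lra.
    replace (Rabs (eps / 2)) with (1 * Rabs (eps / 2 - 0)) by (rewrite Rminus_0_r; ring).
    apply (lipschitz_derive atan (fun x => / (1 + x ^ 2))).
    - apply is_derive_atan_pow.
    - intros x. pose proof (pow2_ge_0 x). rewrite Rabs_inv, Rabs_pos_eq by lra.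
      rewrite <- Rinv_1. apply Rinv_le_contravar; lra. }
  replace (Si B - PI / 2) with (- (atan (2 / eps) - Si B) - atan (eps / 2)) by lra.
  eapply Rle_trans; [apply Rabs_triang|]. rewrite !Rabs_Ropp. lra.
Qed.

Lemma Si_bound (B : R) : 0 <= B -> Rabs (Si B) <= 4.
Proof.
  intros hB. destruct (Rle_dec B 1) as [h | h].
  - apply Rle_trans with ((B - 0) * 1); [|lra].
    apply abs_RInt_le_const; [lra|apply ex_RInt_cont, continuous_sinc|].
    intros t _. apply sinc_bound.
  - assert (h1 := Si_close B ltac:(lra)).
    assert (h2 : 2 / B <= 2).
    { apply Rmult_le_reg_r with B; [lra|]. unfold Rdiv. rewrite Rmult_assoc, Rinv_l; lra. }
    pose proof PI_4. pose proof PI_RGT_0.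
    replace (Si B) with ((Si B - PI / 2) + PI / 2) by ring.
    eapply Rle_trans; [apply Rabs_triang|]. rewrite (Rabs_pos_eq (PI / 2)); lra.
Qed.

(** * Differences of vanishing decreasing functions *)

(** P and Q decrease on all of R rather than on u > 0, so that the class is
    invariant under shifts in both directions. *)
Definition vdiff (G : R -> R) : Prop :=
  exists P Q, vanishing P /\ vanishing Q /\ forall u, G u = P u - Q u.

Lemma ex_RInt_vdiff G k a b :
  vdiff G -> (forall u, continuous k u) -> ex_RInt (fun u => G u * k u) a b.
Proof.
  intros (P & Q & hP & hQ & hG) hk.
  apply (ex_RInt_ext (fun u => P u * k u - Q u * k u)).
  - intros u _. rewrite hG. symmetry. apply Rmult_minus_distr_r.
  - apply ex_RInt_minus_R; apply ex_RInt_decreasing_mult; auto; [apply hP|apply hQ].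
Qed.

Lemma RInt_minus_mult P Q G k a b :
  vanishing P -> vanishing Q -> (forall u, G u = P u - Q u) -> (forall u, continuous k u) ->
  RInt (fun u => G u * k u) a b = RInt (fun u => P u * k u) a b - RInt (fun u => Q u * k u) a b.
Proof.
  intros hP hQ hG hk. rewrite <- RInt_minus_R.
  - apply RInt_ext. intros u _. rewrite hG. apply Rmult_minus_distr_r.
  - apply ex_RInt_decreasing_mult; [apply hP|exact hk].
  - apply ex_RInt_decreasing_mult; [apply hQ|exact hk].
Qed.

Lemma filterlim_plus_R {T : Type} {F : (T -> Prop) -> Prop} {FF : Filter F} (f g : T -> R) a b :
  filterlim f F (locally a) -> filterlim g F (locally b) ->
  filterlim (fun x => f x + g x) F (locally (a + b)).
Proof.
  intros hf hg. apply (filterlim_comp_2 (G := locally a) (H := locally b) f g Rplus hf hg).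
  apply (filterlim_plus (V := R_NormedModule) a b).
Qed.

Lemma filterlim_scal_R {T : Type} {F : (T -> Prop) -> Prop} {FF : Filter F} (f : T -> R) c a :
  filterlim f F (locally a) -> filterlim (fun x => c * f x) F (locally (c * a)).
Proof.
  intros hf. apply (filterlim_comp _ _ _ f (Rmult c) F (locally a) _ hf).
  apply (filterlim_scal_r (V := R_NormedModule) c a).
Qed.

Lemma filterlim_minus_R {T : Type} {F : (T -> Prop) -> Prop} {FF : Filter F} (f g : T -> R) a b :
  filterlim f F (locally a) -> filterlim g F (locally b) ->
  filterlim (fun x => f x - g x) F (locally (a - b)).
Proof.
  intros hf hg. apply filterlim_plus_R; [exact hf|].
  replace (- b) with (-1 * b) by ring.
  apply (filterlim_ext (fun x => -1 * g x)); [intros; ring|]. now apply filterlim_scal_R.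
Qed.

Lemma is_lim_INR (f : R -> R) (l : R) :
  is_lim f p_infty l -> is_lim_seq (fun n => f (INR n)) l.
Proof.
  intros h. apply (is_lim_comp_seq f INR p_infty l h).
  - exists 0%nat. intros n _. discriminate.
  - apply is_lim_seq_INR.
Qed.

Definition half_transform (G k : R -> R) (s : R) : R :=
  real (Lim (fun A => RInt (fun u => G u * k (s * u)) 0 A) p_infty).

(** Dirichlet's test with the bound 2/|s| for the integrals of k(s u).  The error
    function e does not depend on s, which gives uniformity for s away from 0. *)
Lemma half_transform_spec G k :
  vdiff G -> trig k -> exists e : R -> R, is_lim e p_infty 0 /\
    forall s, s <> 0 ->
    is_lim (fun A => RInt (fun u => G u * k (s * u)) 0 A) p_infty (half_transform G k s) /\
    forall A, 0 <= A ->
      Rabs (half_transform G k s - RInt (fun u => G u * k (s * u)) 0 A) <= e A * (2 / Rabs s).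
Proof.
  intros (P & Q & hP & hQ & hG) hk. exists (fun A => P A + Q A). split.
  { replace (Finite 0) with (Finite (0 + 0)) by (f_equal; ring).
    apply is_lim_plus'; [apply hP|apply hQ]. }
  intros s hs. pose proof (continuous_trig k hk s) as hc.
  assert (hb : forall a b, Rabs (RInt (fun u => k (s * u)) a b) <= 2 / Rabs s)
    by (intros; now apply RInt_trig_bound).
  destruct (dirichlet_test P (fun u => k (s * u)) (2 / Rabs s) hP hc) as [I [hI1 hI2]]; auto.
  destruct (dirichlet_test Q (fun u => k (s * u)) (2 / Rabs s) hQ hc) as [J [hJ1 hJ2]]; auto.
  assert (hl : is_lim (fun A => RInt (fun u => G u * k (s * u)) 0 A) p_infty (I - J)).
  { apply (is_lim_ext (fun A => RInt (fun u => P u * k (s * u)) 0 A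
       - RInt (fun u => Q u * k (s * u)) 0 A)).
    - intros A. symmetry. now apply (RInt_minus_mult P Q G (fun u => k (s * u))).
    - now apply is_lim_minus'. }
  unfold half_transform. rewrite (is_lim_unique _ _ _ hl). split; [exact hl|].
  intros A hA. simpl real. rewrite (RInt_minus_mult P Q G (fun u => k (s * u))); auto.
  specialize (hI2 A (2 / Rabs s) hA ltac:(auto)). specialize (hJ2 A (2 / Rabs s) hA ltac:(auto)).
  match goal with |- Rabs (?a - ?b - (?c - ?d)) <= _ =>
    replace (a - b - (c - d)) with ((a - c) - (b - d)) by ring end.
  eapply Rle_trans; [apply Rabs_triang|]. rewrite Rabs_Ropp. lra.
Qed.

Lemma continuous_truncated_transform G k A s :
  vdiff G -> trig k -> 0 <= A ->
  continuous (fun s => RInt (fun u => G u * k (s * u)) 0 A) s.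
Proof.
  intros hG hk hA.
  assert (hi : forall s, ex_RInt (fun u => G u * k (s * u)) 0 A).
  { intros t. apply (ex_RInt_vdiff G (fun u => k (t * u))); auto. now apply continuous_trig. }
  destruct hG as (P & Q & hP & hQ & hG).
  assert (hM : exists M, 0 <= M /\ forall u, 0 <= u -> Rabs (G u) <= M).
  { exists (P 0 + Q 0). pose proof (vanishing_nonneg P 0 hP). pose proof (vanishing_nonneg Q 0 hQ).
    split; [lra|]. intros u hu. rewrite hG.
    pose proof (vanishing_nonneg P u hP). pose proof (vanishing_nonneg Q u hQ).
    assert (P u <= P 0) by now apply hP. assert (Q u <= Q 0) by now apply hQ.
    apply Rabs_le. lra. }
  destruct hM as [M [hM0 hM]].
  apply continuous_eps. intros eps.
  assert (hd : 0 < eps / (A * (M * A) + 1)).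
  { apply Rdiv_lt_0_compat; [apply eps|]. assert (0 <= A * (M * A)) by (repeat apply Rmult_le_pos; lra). lra. }
  exists (mkposreal _ hd). intros y hy. simpl in hy.
  rewrite <- RInt_minus_R by auto.
  apply Rle_lt_trans with ((A - 0) * (M * A * Rabs (y - s))).
  - apply abs_RInt_le_const; [exact hA|now apply ex_RInt_minus_R|].
    intros u hu. rewrite <- Rmult_minus_distr_l, Rabs_mult.
    assert (h1 := trig_lipschitz k hk (s * u) (y * u)).
    rewrite <- Rmult_minus_distr_r, Rabs_mult, (Rabs_pos_eq u) in h1 by lra.
    rewrite Rmult_assoc. apply Rmult_le_compat; try apply Rabs_pos.
    + apply hM. lra.
    + eapply Rle_trans; [exact h1|]. rewrite Rmult_comm.
      apply Rmult_le_compat_r; [apply Rabs_pos|lra].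
  - rewrite Rminus_0_r, <- Rmult_assoc.
    assert (0 <= A * (M * A)) by (repeat apply Rmult_le_pos; lra).
    assert (e : eps / (A * (M * A) + 1) * (A * (M * A) + 1) = eps) by (field; lra).
    pose proof (Rabs_pos (y - s)). nra.
Qed.

(** On [S, T] with 0 < S the truncated transforms converge uniformly, hence
    their integrals converge. *)
Lemma RInt_half_transform_lim G k S T :
  vdiff G -> trig k -> 0 < S -> S < T ->
  ex_RInt (half_transform G k) S T /\
  is_lim_seq (fun n => RInt (fun s => RInt (fun u => G u * k (s * u)) 0 (INR n)) S T)
    (RInt (half_transform G k) S T).
Proof.
  intros hG hk hS hST.
  destruct (half_transform_spec G k hG hk) as [e [he1 he2]].
  set (C := fun n s => RInt (fun u => G u * k (s * u)) 0 (INR n)).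
  assert (hC : forall n, is_RInt (C n) S T (RInt (C n) S T)).
  { intros n. apply RInt_correct_R, ex_RInt_cont. intros s.
    apply continuous_truncated_transform; auto. apply pos_INR. }
  destruct (filterlim_RInt (V := R_CompleteNormedModule)
    (fun n s => C n (clamp S T s)) S T eventually _
    (fun s => half_transform G k (clamp S T s)) (fun n => RInt (C n) S T)) as [I [hI1 hI2]].
  - intros n. apply (is_RInt_ext (C n)); [|apply hC].
    intros x hx. rewrite Rmin_left, Rmax_right in hx by lra. now rewrite clamp_id by lra.
  - apply (filterlim_locally (U := fct_UniformSpace R R_UniformSpace)). intros eps.
    apply is_lim_INR, is_lim_seq_spec in he1.
    assert (hd : 0 < eps / (2 / S)).
    { apply Rdiv_lt_0_compat; [apply eps|]. apply Rdiv_lt_0_compat; lra. }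
    destruct (he1 (mkposreal _ hd)) as [N hN]. exists N. intros n hn x.
    specialize (hN n hn). simpl in hN. rewrite Rminus_0_r in hN. apply Rabs_def2 in hN.
    pose proof (clamp_bounds S T x ltac:(lra)) as hx.
    destruct (he2 (clamp S T x) ltac:(lra)) as [_ h].
    specialize (h (INR n) (pos_INR n)).
    change (Rabs (C n (clamp S T x) - half_transform G k (clamp S T x)) < eps).
    rewrite Rabs_minus_sym. eapply Rle_lt_trans; [exact h|].
    rewrite Rabs_pos_eq by lra.
    assert (h0 : 0 <= e (INR n)).
    { destruct (he2 (clamp S T x) ltac:(lra)) as [_ h0]. specialize (h0 (INR n) (pos_INR n)).
      pose proof (Rle_trans _ _ _ (Rabs_pos _) h0) as h1.
      assert (0 < 2 / Rabs (clamp S T x)) by (apply Rdiv_lt_0_compat; [lra|apply Rabs_pos_lt; lra]).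
      nra. }
    apply Rle_lt_trans with (e (INR n) * (2 / S)).
    + apply Rmult_le_compat_l; [exact h0|]. unfold Rdiv.
      apply Rmult_le_compat_l; [lra|]. apply Rinv_le_contravar; lra.
    + assert (e0 : eps / (2 / S) * (2 / S) = eps) by (field; lra).
      assert (0 < 2 / S) by (apply Rdiv_lt_0_compat; lra). nra.
  - assert (hI3 : is_RInt (half_transform G k) S T I).
    { apply (is_RInt_ext (fun s => half_transform G k (clamp S T s))); [|exact hI2].
      intros x hx. rewrite Rmin_left, Rmax_right in hx by lra. now rewrite clamp_id by lra. }
    split; [now exists I|]. rewrite (is_RInt_unique _ _ _ _ hI3). exact hI1.
Qed.

(** * The Dirichlet kernel *)

(** This is sin (s u) / u, written so that it is continuous at u = 0; it is an
    antiderivative in s of cos (s u). *)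
Definition dker (s u : R) : R := s * sinc (s * u).

Lemma dker_mult s u : dker s u * u = sin (s * u).
Proof. unfold dker. rewrite <- (sinc_mult (s * u)). ring. Qed.

Lemma continuous_dker s u : continuous (dker s) u.
Proof.
  apply (continuous_mult (K := R_AbsRing)); [apply continuous_const|].
  apply (continuous_comp (fun u => s * u) sinc); [|apply continuous_sinc].
  apply (ex_derive_continuous (V := R_NormedModule)). auto_derive. auto.
Qed.

Lemma dker_bound s u : 0 <= s -> Rabs (dker s u) <= s.
Proof.
  intros hs. unfold dker. rewrite Rabs_mult, (Rabs_pos_eq s) by lra.
  pose proof (sinc_bound (s * u)). nra.
Qed.

Lemma RInt_dker s a b : RInt (dker s) a b = Si (s * b) - Si (s * a).
Proof.
  unfold Si. rewrite RInt_Chasles_minus by (intros; apply ex_RInt_cont, continuous_sinc).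
  assert (h := RInt_comp_lin (V := R_CompleteNormedModule) sinc s 0 a b
    ltac:(apply ex_RInt_cont, continuous_sinc)).
  rewrite !Rplus_0_r in h. rewrite <- h. apply RInt_ext. intros u _.
  rewrite Rplus_0_r. reflexivity.
Qed.

Lemma dker_taylor s h u : 0 <= u -> Rabs (dker (s + h) u - dker s u - h * cos (s * u)) <= u * h ^ 2.
Proof.
  intros [hu | <-].
  - apply Rmult_le_reg_r with u; [exact hu|].
    replace (Rabs (dker (s + h) u - dker s u - h * cos (s * u)) * u)
      with (Rabs (dker (s + h) u * u - dker s u * u - h * u * cos (s * u))).
    2:{ symmetry. transitivity (Rabs (dker (s + h) u - dker s u - h * cos (s * u)) * Rabs u).
        - now rewrite (Rabs_pos_eq u) by lra.
        - rewrite <- Rabs_mult. f_equal. ring. }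
    rewrite !dker_mult, Rmult_plus_distr_r.
    eapply Rle_trans; [apply sin_taylor|]. right. ring.
  - unfold dker. rewrite !Rmult_0_r. unfold sinc. rewrite divx_0, cos_0.
    match goal with |- Rabs ?x <= _ => replace x with 0 by ring end. rewrite Rabs_R0. lra.
Qed.

Lemma right_limit_decreasing P x :
  decreasing P -> exists p, filterlim P (at_right x) (locally p) /\ p <= P x /\
    forall u, x < u -> P u <= p.
Proof.
  intros hP.
  destruct (completeness (fun y => exists u, x < u /\ y = P u)) as [p [hp1 hp2]].
  - exists (P x). intros y [u [hu ->]]. apply hP. lra.
  - exists (P (x + 1)), (x + 1). split; [lra|reflexivity].
  - exists p. split; [|split].
    + apply filterlim_locally. intros eps.
      assert (h : exists u, x < u /\ p - eps < P u).
      { destruct (Classical_Prop.classic (exists u, x < u /\ p - eps < P u)) as [h | h]; [exact h|].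
        exfalso. assert (p <= p - eps); [|pose proof (cond_pos eps); lra].
        apply hp2. intros y [u [hu ->]].
        destruct (Rle_dec (P u) (p - eps)) as [|n]; [assumption|].
        exfalso. apply h. exists u. lra. }
      destruct h as [u [hu1 hu2]].
      exists (mkposreal (u - x) ltac:(lra)). intros y hy hxy.
      change (Rabs (y - x) < u - x) in hy. apply Rabs_def2 in hy.
      change (Rabs (P y - p) < eps).
      assert (P u <= P y) by (apply hP; lra).
      assert (P y <= p) by (apply hp1; exists y; auto).
      pose proof (cond_pos eps). apply Rabs_def1; lra.
    + apply hp2. intros y [u [hu ->]]. apply hP. lra.
    + intros u hu. apply hp1. now exists u.
Qed.

Lemma at_right_elim (f : R -> R) (x l eps : R) :
  filterlim f (at_right x) (locally l) -> 0 < eps ->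
  exists d, 0 < d /\ forall y, x < y -> y < x + d -> Rabs (f y - l) < eps.
Proof.
  intros h he.
  destruct (proj1 (filterlim_locally f l) h (mkposreal eps he)) as [d hd]. exists d. split; [apply d|]. intros y h1 h2.
  apply (hd y); [|exact h1]. change (Rabs (y - x) < d). apply Rabs_def1; pose proof (cond_pos d); lra.
Qed.

Lemma at_right_intro (f : R -> R) (x l : R) :
  (forall eps, 0 < eps -> exists d, 0 < d /\ forall y, x < y -> y < x + d -> Rabs (f y - l) < eps) ->
  filterlim f (at_right x) (locally l).
Proof.
  intros h. apply filterlim_locally. intros eps. destruct (h eps (cond_pos eps)) as [d [hd hf]].
  exists (mkposreal d hd). intros y hy hxy. change (Rabs (y - x) < d) in hy. apply Rabs_def2 in hy.
  apply hf; lra.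
Qed.

(** Dirichlet's localisation argument: as s grows, the mass PI/2 of the kernel
    concentrates at 0+.  Near 0 the kernel meets an almost constant monotone
    function, away from 0 its integrals are O(1/s); both contributions are
    controlled by the second mean value estimate. *)
Lemma dirichlet_kernel_limit P :
  vanishing P -> exists (D : R -> R) (p : R),
    filterlim P (at_right 0) (locally p) /\
    (forall s, 0 < s -> is_lim (fun A => RInt (fun u => P u * dker s u) 0 A) p_infty (D s)) /\
    is_lim D p_infty (PI / 2 * p) /\ filterlim D (at_right 0) (locally 0).
Proof.
  intros hP.
  assert (hb : forall s a b, 0 < s -> 0 <= a -> a <= b -> Rabs (RInt (dker s) a b) <= 8).
  { intros s a b hs ha hab. rewrite RInt_dker.
    pose proof (Si_bound (s * a) ltac:(apply Rmult_le_pos; lra)).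
    pose proof (Si_bound (s * b) ltac:(apply Rmult_le_pos; lra)).
    eapply Rle_trans; [apply Rabs_triang|]. rewrite Rabs_Ropp. lra. }
  set (D := fun s => real (Lim (fun A => RInt (fun u => P u * dker s u) 0 A) p_infty)).
  assert (hD : forall s, 0 < s ->
    is_lim (fun A => RInt (fun u => P u * dker s u) 0 A) p_infty (D s) /\
    forall A S', 0 <= A -> (forall b, A <= b -> Rabs (RInt (dker s) A b) <= S') ->
      Rabs (D s - RInt (fun u => P u * dker s u) 0 A) <= P A * S').
  { intros s hs. destruct (dirichlet_test P (dker s) 8 hP) as [I [hI1 hI2]].
    - apply continuous_dker.
    - intros; now apply hb.
    - unfold D. rewrite (is_lim_unique _ _ _ hI1). now split. }
  destruct (right_limit_decreasing P 0 (proj1 hP)) as [p [hp1 [hp2 hp3]]].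
  exists D, p. split; [exact hp1|]. split; [intros s hs; now apply hD|]. split.
  - assert (hp0 : 0 <= p).
    { apply Rle_trans with (P 1); [now apply vanishing_nonneg|apply hp3; lra]. }
    assert (key : forall d T, 0 < d -> 0 < T ->
      Rabs (D T - PI / 2 * p) <= 6 * (p - P d) + 6 * p / (T * d)).
    { intros d T hd hT.
      assert (hTd : 0 < T * d) by now apply Rmult_lt_0_compat.
      assert (hPd : 0 <= P d) by now apply vanishing_nonneg.
      assert (hPp : P d <= p) by now apply hp3.
      (* Beyond d the integrals of the kernel are at most 4 / (T d). *)
      assert (h1 : Rabs (D T - RInt (fun u => P u * dker T u) 0 d) <= P d * (4 / (T * d))).
      { apply hD; [exact hT|lra|]. intros b hb'. rewrite RInt_dker.
        assert (a1 := Si_close (T * d) hTd).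
        assert (hTb : T * d <= T * b) by (apply Rmult_le_compat_l; lra).
        assert (a2 := Si_close (T * b) ltac:(lra)).
        assert (a3 : 2 / (T * b) <= 2 / (T * d)).
        { unfold Rdiv. apply Rmult_le_compat_l; [lra|]. now apply Rinv_le_contravar. }
        replace (Si (T * b) - Si (T * d)) with ((Si (T * b) - PI / 2) - (Si (T * d) - PI / 2)) by ring.
        eapply Rle_trans; [apply Rabs_triang|]. rewrite Rabs_Ropp.
        replace (4 / (T * d)) with (2 / (T * d) + 2 / (T * d)) by (field; lra). lra. }
      (* On (0, d), P is within p - P d of the constant P d.  The value at 0 is
         replaced by p, as P itself may be larger there. *)
      set (P1 := fun u => (if Rle_dec u 0 then p else P u) - P d).
      assert (hP1 : decreasing P1).
      { intros x y hxy. unfold P1. assert (P y <= P x) by now apply hP.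
        do 2 destruct Rle_dec; try lra. assert (P y <= p) by (apply hp3; lra). lra. }
      destruct (second_mean_value P1 (dker T) 0 d) as [h2 h3]; [lra|exact hP1| |apply continuous_dker|].
      { unfold P1. destruct Rle_dec; lra. }
      specialize (h3 4). replace (P1 0) with (p - P d) in h3.
      2:{ unfold P1. destruct Rle_dec; lra. }
      assert (h4 : RInt (fun u => P u * dker T u) 0 d
         = RInt (fun u => P1 u * dker T u) 0 d + P d * Si (T * d)).
      { replace (Si (T * d)) with (RInt (dker T) 0 d).
        2:{ rewrite RInt_dker, Rmult_0_r. unfold Si at 2. rewrite RInt_point. apply Rminus_0_r. }
        rewrite <- RInt_scal_R by (apply ex_RInt_cont, continuous_dker).
        rewrite <- RInt_plus_R; [|exact h2|apply ex_RInt_scal_R, ex_RInt_cont, continuous_dker].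
        apply RInt_ext. intros u hu. rewrite Rmin_left in hu by lra.
        unfold P1. destruct Rle_dec; [lra|].
        change (P u * dker T u = (P u - P d) * dker T u + P d * dker T u). ring. }
      rewrite h4 in h1.
      assert (h5 : Rabs (RInt (fun u => P1 u * dker T u) 0 d) <= (p - P d) * 4).
      { apply h3. intros c hc. rewrite RInt_dker, Rmult_0_r.
        unfold Si at 2. rewrite RInt_point. change (Rabs (Si (T * c) - 0) <= 4).
        rewrite Rminus_0_r. apply Si_bound, Rmult_le_pos; lra. }
      assert (h6 := Si_close (T * d) hTd).
      pose proof PI_4. pose proof PI_RGT_0.
      set (X := RInt (fun u => P1 u * dker T u) 0 d) in *.
      set (Z := Si (T * d)) in *.
      replace (D T - PI / 2 * p) with
        ((D T - (X + P d * Z)) + X + P d * (Z - PI / 2) + - (PI / 2 * (p - P d))) by ring.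
      assert (h7 : 0 < / (T * d)) by now apply Rinv_0_lt_compat.
      assert (h8 : Rabs (P d * (Z - PI / 2)) <= P d * (2 / (T * d))).
      { rewrite Rabs_mult, Rabs_pos_eq by lra. now apply Rmult_le_compat_l. }
      assert (h9 : Rabs (- (PI / 2 * (p - P d))) <= 2 * (p - P d)).
      { rewrite Rabs_Ropp, Rabs_pos_eq by (apply Rmult_le_pos; lra).
        apply Rmult_le_compat_r; lra. }
      eapply Rle_trans; [apply Rabs_triang|].
      eapply Rle_trans; [apply Rplus_le_compat_r, Rabs_triang|].
      eapply Rle_trans; [apply Rplus_le_compat_r, Rplus_le_compat_r, Rabs_triang|].
      unfold Rdiv in *.
      assert (P d * / (T * d) <= p * / (T * d)) by (apply Rmult_le_compat_r; lra).
      lra. }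
    apply is_lim_p_infty_eps. intros eps.
    destruct (at_right_elim P 0 p (eps / 12) hp1) as [d0 [hd0 hd]]; [pose proof (cond_pos eps); lra|].
    set (d := d0 / 2). assert (hd' : 0 < d) by (unfold d; lra).
    specialize (hd d hd' ltac:(unfold d; lra)). apply Rabs_def2 in hd.
    exists (12 * p / (d * eps)). intros T hT.
    pose proof (cond_pos eps) as he.
    assert (hde : 0 < d * eps) by now apply Rmult_lt_0_compat.
    assert (hT0 : 0 < T).
    { eapply Rle_lt_trans; [|exact hT]. apply Rmult_le_pos; [lra|]. left. now apply Rinv_0_lt_compat. }
    eapply Rle_lt_trans; [now apply (key d)|].
    assert (h6 : 6 * p / (T * d) < eps / 2); [|lra].
    assert (hTd : 0 < T * d) by now apply Rmult_lt_0_compat.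
    apply Rmult_lt_reg_r with (T * d); [exact hTd|].
    replace (6 * p / (T * d) * (T * d)) with (6 * p) by (field; split; lra).
    apply Rmult_lt_compat_r with (r := d * eps) in hT; [|exact hde].
    replace (12 * p / (d * eps) * (d * eps)) with (12 * p) in hT by (field; split; lra). nra.
  - apply at_right_intro. intros eps he.
    assert (hP0 : 0 <= P 0) by now apply vanishing_nonneg.
    destruct (is_lim_p_infty_elim P 0 (eps / 16) (proj2 hP)) as [A [hA0 hA]]; [lra|].
    specialize (hA A ltac:(lra)). rewrite Rminus_0_r in hA. apply Rabs_def2 in hA.
    assert (hAP : 0 <= A * P 0) by (apply Rmult_le_pos; lra).
    exists (eps / (2 * (A * P 0 + 1))). split; [apply Rdiv_lt_0_compat; lra|].
    intros s hs1 hs2. rewrite Rplus_0_l in hs2. rewrite Rminus_0_r.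
    assert (h1 : Rabs (D s - RInt (fun u => P u * dker s u) 0 A) <= P A * 8).
    { apply hD; [exact hs1|lra|]. intros b hb'. apply hb; lra. }
    assert (h2 : Rabs (RInt (fun u => P u * dker s u) 0 A) <= (A - 0) * (P 0 * s)).
    { apply abs_RInt_le_const; [lra| |].
      - apply ex_RInt_decreasing_mult; [apply hP|apply continuous_dker].
      - intros u hu. rewrite Rabs_mult. pose proof (vanishing_nonneg P u hP).
        rewrite Rabs_pos_eq by lra. apply Rmult_le_compat; [lra|apply Rabs_pos| |].
        + apply hP. lra.
        + apply dker_bound. lra. }
    replace (D s) with ((D s - RInt (fun u => P u * dker s u) 0 A)
      + RInt (fun u => P u * dker s u) 0 A) by ring.
    eapply Rle_lt_trans; [apply Rabs_triang|].
    assert (h3 : s * (2 * (A * P 0 + 1)) < eps).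
    { apply Rmult_lt_compat_r with (r := 2 * (A * P 0 + 1)) in hs2; [|lra].
      replace (eps / (2 * (A * P 0 + 1)) * (2 * (A * P 0 + 1))) with eps in hs2 by (field; lra).
      exact hs2. }
    lra.
Qed.

(** For the truncated integrals this is differentiation under the integral sign,
    with dker as antiderivative of the kernel; both sides then pass to the limit. *)
Lemma RInt_half_transform_cos G l :
  vdiff G -> filterlim G (at_right 0) (locally l) ->
  exists D : R -> R,
    (forall S T, 0 < S -> S < T -> RInt (half_transform G cos) S T = D T - D S) /\
    is_lim D p_infty (PI / 2 * l) /\ filterlim D (at_right 0) (locally 0).
Proof.
  intros hG hl. pose proof hG as (P & Q & hP & hQ & hPQ).
  destruct (dirichlet_kernel_limit P hP) as (D1 & p & hp & hD1 & hD1i & hD10).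
  destruct (dirichlet_kernel_limit Q hQ) as (D2 & q & hq & hD2 & hD2i & hD20).
  assert (el : l = p - q).
  { apply (filterlim_locally_unique (F := at_right 0) G); [exact hl|].
    apply (filterlim_ext (fun u => P u - Q u)); [intros; now rewrite hPQ|].
    now apply filterlim_minus_R. }
  exists (fun s => D1 s - D2 s). split; [|split].
  - intros S T hS hST.
    destruct (RInt_half_transform_lim G cos S T hG (or_introl eq_refl) hS hST) as [_ hlim].
    assert (hk : forall s a b, ex_RInt (fun u => G u * dker s u) a b)
      by (intros; apply ex_RInt_vdiff; [exact hG|apply continuous_dker]).
    set (Dn := fun A s => RInt (fun u => G u * dker s u) 0 A).
    assert (hlim2 : forall s, 0 < s -> is_lim (fun A => Dn A s) p_infty (D1 s - D2 s)).
    { intros s hs. apply (is_lim_ext (fun A => RInt (fun u => P u * dker s u) 0 A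
         - RInt (fun u => Q u * dker s u) 0 A)).
      - intros A. symmetry. apply RInt_minus_mult; auto. apply continuous_dker.
      - apply is_lim_minus'; auto. }
    assert (hFTC : forall n, RInt (fun s => RInt (fun u => G u * cos (s * u)) 0 (INR n)) S T
       = Dn (INR n) T - Dn (INR n) S).
    { intros n. pose proof (pos_INR n) as hn. apply is_RInt_unique.
      apply (is_RInt_derive (V := R_CompleteNormedModule) (Dn (INR n))).
      - intros s _. apply (is_derive_RInt_quadratic (fun s u => G u * dker s u)
          (fun s u => G u * cos (s * u)) 0 (INR n) s ((P 0 + Q 0) * INR n)); auto.
        + apply (ex_RInt_vdiff G (fun u => cos (s * u))); [exact hG|].
          apply continuous_trig. now left.
        + intros h u hh hu.
          replace (G u * dker (s + h) u - G u * dker s u - h * (G u * cos (s * u)))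
            with (G u * (dker (s + h) u - dker s u - h * cos (s * u))) by ring.
          rewrite Rabs_mult, Rmult_assoc. apply Rmult_le_compat; try apply Rabs_pos.
          * rewrite hPQ. pose proof (vanishing_nonneg P u hP). pose proof (vanishing_nonneg Q u hQ).
            assert (P u <= P 0) by (apply hP; lra). assert (Q u <= Q 0) by (apply hQ; lra).
            apply Rabs_le. lra.
          * eapply Rle_trans; [apply dker_taylor; lra|].
            apply Rmult_le_compat_r; [apply pow2_ge_0|lra].
      - intros s _. apply continuous_truncated_transform; auto. now left. }
    assert (hlim3 : is_lim_seq (fun n => Dn (INR n) T - Dn (INR n) S)
       (Finite (D1 T - D2 T - (D1 S - D2 S)))).
    { apply is_lim_seq_minus'; apply (is_lim_INR (fun A => Dn A _)), hlim2; lra. }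
    apply (is_lim_seq_ext _ _ _ hFTC) in hlim.
    apply is_lim_seq_unique in hlim. apply is_lim_seq_unique in hlim3.
    rewrite hlim in hlim3. now injection hlim3.
  - rewrite el, Rmult_minus_distr_l. now apply is_lim_minus'.
  - assert (h := filterlim_minus_R (F := at_right 0) D1 D2 0 0 hD10 hD20).
    rewrite (Rminus_0_r 0) in h. exact h.
Qed.

(** * Jordan decomposition *)

(** By [bounded_variation_bdiff] and [bdiff_bounded_variation] these are exactly the
    functions of bounded variation on [-oo, oo]. *)
Definition bdiff (f : R -> R) : Prop :=
  exists P Q M, decreasing P /\ decreasing Q /\
    (forall x, Rabs (P x) <= M /\ Rabs (Q x) <= M) /\ forall x, f x = P x - Q x.

(** Variation sums over finite increasing sequences with a given first point,
    presented so that adding an earlier point is a constructor. *)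
Inductive chain (f : R -> R) : R -> R -> Prop :=
| chain_nil x : chain f x 0
| chain_cons x y v : x < y -> chain f y v -> chain f x (Rabs (f y - f x) + v).

Definition prepend (r : Rbar) (p : nat -> Rbar) (i : nat) : Rbar :=
  match i with O => r | S j => p j end.

Definition variation_sum (f : R -> R) (p : nat -> Rbar) (N : nat) : R :=
  sum_n_m (fun n => Rabs (extend f (p n) - extend f (p (n - 1)%nat))) 1 N.

Lemma variation_sum_prepend f r p N :
  variation_sum f (prepend r p) (S N)
  = Rabs (extend f (p 0%nat) - extend f r) + variation_sum f p N.
Proof.
  unfold variation_sum. rewrite sum_Sn_m by lia.
  change plus with Rplus. f_equal.
  rewrite <- sum_n_m_S. apply sum_n_m_ext_loc. intros k hk.
  destruct k as [|k]; [lia|]. simpl. now rewrite Nat.sub_0_r.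
Qed.

Lemma chain_partition f x v : chain f x v ->
  exists N p, p 0%nat = Finite x /\ p N = p_infty /\
    (forall n, (n < N)%nat -> Rbar_lt (p n) (p (S n))) /\ v <= variation_sum f p N.
Proof.
  induction 1 as [x|x y v hxy _ (N & p & h0 & hN & hlt & hv)].
  - exists 1%nat, (prepend x (fun _ => p_infty)). repeat split.
    + intros n hn. replace n with 0%nat by lia. exact I.
    + unfold variation_sum. rewrite sum_n_n. apply Rabs_pos.
  - exists (S N), (prepend x p). repeat split.
    + exact hN.
    + intros [|n] hn; simpl.
      * rewrite h0. exact hxy.
      * apply hlt. lia.
    + rewrite variation_sum_prepend, h0. apply Rplus_le_compat_l, hv.
Qed.

(** Let V x be the total variation on [x, +oo).  It drops by at least |f y - f x|
    between x and y, so that V and V - f both decrease.  A chain that starts at x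
    becomes a partition by adding -oo and +oo. *)
Lemma bounded_variation_bdiff f : bounded_variation_Rbar f -> bdiff f.
Proof.
  intros [M hM].
  assert (hchain : forall x v, chain f x v -> v <= M).
  { intros x v h. destruct (chain_partition f x v h) as (N & p & h0 & hN & hlt & hv).
    apply Rle_trans with (variation_sum f (prepend m_infty p) (S N)).
    - rewrite variation_sum_prepend.
      pose proof (Rabs_pos (extend f (p 0%nat) - extend f m_infty)). lra.
    - apply hM. repeat split; [exact hN|].
      intros [|n] hn; simpl; [rewrite h0; exact I|apply hlt; lia]. }
  assert (hV : forall x, {V | is_lub (chain f x) V}).
  { intros x. apply completeness.
    - exists M. intros v hv. now apply (hchain x).
    - exists 0. constructor. }
  set (V := fun x => proj1_sig (hV x)).
  assert (hub : forall x v, chain f x v -> v <= V x).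
  { intros x v h. now apply (proj2_sig (hV x)). }
  assert (hVM : forall x, 0 <= V x <= M).
  { intros x. split; [apply hub; constructor|].
    apply (proj2_sig (hV x)). intros v hv. now apply (hchain x). }
  assert (hstep : forall x y, x < y -> V y <= V x - Rabs (f y - f x)).
  { intros x y hxy. apply (proj2_sig (hV y)). intros v hv.
    assert (h := hub x _ (chain_cons f x y v hxy hv)). lra. }
  assert (hf : forall x y, x < y -> Rabs (f y - f x) <= M).
  { intros x y hxy. specialize (hstep x y hxy). pose proof (hVM x). pose proof (hVM y). lra. }
  assert (hf0 : forall x, Rabs (f x - f 0) <= M).
  { intros x. destruct (Rtotal_order x 0) as [h | [-> | h]].
    - rewrite Rabs_minus_sym. now apply hf.
    - rewrite Rminus_eq_0, Rabs_R0. pose proof (hVM 0). lra.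
    - now apply hf. }
  exists V, (fun x => V x - f x), (2 * M + Rabs (f 0)).
  split; [|split; [|split]].
  - intros x y [h | ->]; [|lra]. specialize (hstep x y h). pose proof (Rabs_pos (f y - f x)). lra.
  - intros x y [h | ->]; [|lra]. specialize (hstep x y h). pose proof (Rle_abs (- (f y - f x))).
    rewrite Rabs_Ropp in *. lra.
  - intros x. pose proof (hVM x). pose proof (Rabs_pos (f 0)). rewrite Rabs_pos_eq by lra.
    split; [lra|].
    replace (V x - f x) with (V x + - (f x - f 0) + - f 0) by ring.
    eapply Rle_trans; [apply Rabs_triang|]. rewrite Rabs_Ropp.
    eapply Rle_trans; [apply Rplus_le_compat_r, Rabs_triang|].
    rewrite Rabs_Ropp, (Rabs_pos_eq (V x)) by lra. specialize (hf0 x). lra.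
  - intros x. ring.
Qed.

(** * Limits of monotone functions *)

Lemma is_lim_m_infty_opp (f : R -> R) (l : R) :
  is_lim (fun x => f (- x)) p_infty l -> is_lim f m_infty l.
Proof.
  intros h. apply is_lim_spec. intros eps. apply is_lim_spec in h.
  destruct (h eps) as [M hM]. exists (- M). intros x hx.
  rewrite <- (Ropp_involutive x). apply hM. lra.
Qed.

Lemma is_lim_p_infty_opp (f : R -> R) (l : R) :
  is_lim f m_infty l -> is_lim (fun x => f (- x)) p_infty l.
Proof.
  intros h. apply is_lim_spec. intros eps. apply is_lim_spec in h.
  destruct (h eps) as [M hM]. exists (- M). intros x hx. apply hM. lra.
Qed.

Lemma filterlim_at_left_opp (f : R -> R) (x l : R) :
  filterlim (fun u => f (- u)) (at_right (- x)) (locally l) -> filterlim f (at_left x) (locally l).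
Proof.
  intros h. apply filterlim_locally. intros eps.
  destruct (at_right_elim _ _ _ eps h (cond_pos eps)) as [d [hd H]].
  exists (mkposreal d hd). intros y hy hxy. change (Rabs (y - x) < d) in hy. apply Rabs_def2 in hy.
  specialize (H (- y) ltac:(lra) ltac:(lra)). rewrite Ropp_involutive in H. exact H.
Qed.

Lemma filterlim_at_right_opp (f : R -> R) (x l : R) :
  filterlim f (at_left x) (locally l) -> filterlim (fun u => f (- u)) (at_right (- x)) (locally l).
Proof.
  intros h. apply at_right_intro. intros eps he.
  destruct (proj1 (filterlim_locally f l) h (mkposreal eps he)) as [d hd].
  exists d. split; [apply d|]. intros y h1 h2. apply (hd (- y)); [|lra].
  change (Rabs (- y - x) < d). apply Rabs_def1; lra.
Qed.

Lemma is_lim_decreasing P m :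
  decreasing P -> (forall x, m <= P x) -> exists l : R, is_lim P p_infty l /\ forall x, l <= P x.
Proof.
  intros hP hm.
  destruct (completeness (fun y => exists u, y = - P u)) as [l [hl1 hl2]].
  - exists (- m). intros y [u ->]. specialize (hm u). lra.
  - exists (- P 0), 0. reflexivity.
  - assert (hb : forall x, - l <= P x).
    { intros x. assert (- P x <= l) by (apply hl1; now exists x). lra. }
    exists (- l). split; [|exact hb].
    apply is_lim_p_infty_eps. intros eps.
    assert (h : exists u, P u < - l + eps).
    { destruct (Classical_Prop.classic (exists u, P u < - l + eps)) as [h | h]; [exact h|].
      exfalso. assert (l <= l - eps); [|pose proof (cond_pos eps); lra].
      apply hl2. intros y [u ->].
      destruct (Rlt_dec (P u) (- l + eps)) as [n|]; [|lra].
      exfalso. apply h. now exists u. }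
    destruct h as [u hu]. exists u. intros x hx.
    assert (P x <= P u) by (apply hP; lra). specialize (hb x). pose proof (cond_pos eps).
    apply Rabs_def1; lra.
Qed.

Lemma decreasing_opp P : decreasing P -> decreasing (fun x => - P (- x)).
Proof. intros hP x y h. apply Ropp_le_contravar, hP. lra. Qed.

Lemma bdiff_opp f : bdiff f -> bdiff (fun x => f (- x)).
Proof.
  intros (P & Q & M & hP & hQ & hM & hf).
  exists (fun x => - Q (- x)), (fun x => - P (- x)), M.
  repeat split; try (now apply decreasing_opp); try (rewrite Rabs_Ropp; apply hM).
  intros x. rewrite hf. ring.
Qed.

Lemma bdiff_lim f : bdiff f -> exists l : R, is_lim f p_infty l.
Proof.
  intros (P & Q & M & hP & hQ & hM & hf).
  destruct (is_lim_decreasing P (- M) hP) as [p [hp _]].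
  { intros x. destruct (hM x) as [h _]. apply Rabs_le_between in h. lra. }
  destruct (is_lim_decreasing Q (- M) hQ) as [q [hq _]].
  { intros x. destruct (hM x) as [_ h]. apply Rabs_le_between in h. lra. }
  exists (p - q). apply (is_lim_ext (fun x => P x - Q x)); [intros; now rewrite hf|].
  now apply is_lim_minus'.
Qed.

Lemma bdiff_right_limit f x : bdiff f -> exists l : R, filterlim f (at_right x) (locally l).
Proof.
  intros (P & Q & M & hP & hQ & hM & hf).
  destruct (right_limit_decreasing P x hP) as [p [hp _]].
  destruct (right_limit_decreasing Q x hQ) as [q [hq _]].
  exists (p - q). apply (filterlim_ext (fun x => P x - Q x)); [intros; now rewrite hf|].
  now apply filterlim_minus_R.
Qed.

Lemma bdiff_left_limit f x : bdiff f -> exists l : R, filterlim f (at_left x) (locally l).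
Proof.
  intros hf. destruct (bdiff_right_limit _ (- x) (bdiff_opp f hf)) as [l hl].
  exists l. now apply filterlim_at_left_opp.
Qed.

Lemma is_lim_extend_p_infty f : bdiff f -> is_lim f p_infty (Finite (extend f p_infty)).
Proof.
  intros hf. destruct (bdiff_lim f hf) as [l hl].
  simpl. rewrite (is_lim_unique _ _ _ hl). exact hl.
Qed.

Lemma is_lim_extend_m_infty f : bdiff f -> is_lim f m_infty (Finite (extend f m_infty)).
Proof.
  intros hf. destruct (bdiff_lim _ (bdiff_opp f hf)) as [l hl].
  apply is_lim_m_infty_opp in hl.
  simpl. rewrite (is_lim_unique _ _ _ hl). exact hl.
Qed.

Lemma extend_decreasing P M :
  decreasing P -> (forall x, Rabs (P x) <= M) ->
  forall x y, Rbar_lt x y -> extend P y <= extend P x.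
Proof.
  intros hP hM.
  destruct (is_lim_decreasing P (- M) hP) as [p [hp hp']].
  { intros x. specialize (hM x). apply Rabs_le_between in hM. lra. }
  destruct (is_lim_decreasing _ (- M) (decreasing_opp P hP)) as [q [hq hq']].
  { intros x. specialize (hM (- x)). apply Rabs_le_between in hM. lra. }
  assert (ep : extend P p_infty = p) by (simpl; now rewrite (is_lim_unique _ _ _ hp)).
  assert (eq : extend P m_infty = - q).
  { assert (h : is_lim P m_infty (- q)).
    { apply is_lim_m_infty_opp.
      apply (is_lim_ext (fun x => - (- P (- x)))); [intros; ring|].
      now apply (is_lim_opp _ p_infty q). }
    simpl. now rewrite (is_lim_unique _ _ _ h). }
  assert (hpq : forall x, p <= P x <= - q).
  { intros x. specialize (hp' x). specialize (hq' (- x)). rewrite Ropp_involutive in hq'. lra. }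
  intros [x| |] [y| |] h; simpl in h; try easy; rewrite ?ep, ?eq.
  - simpl. apply hP. lra.
  - apply hpq.
  - apply hpq.
  - specialize (hpq 0). lra.
Qed.

Lemma extend_minus f P Q :
  bdiff P -> bdiff Q -> (forall x, f x = P x - Q x) ->
  forall x, extend f x = extend P x - extend Q x.
Proof.
  intros hP hQ hf [x| |]; [apply hf| |].
  - assert (h : is_lim f p_infty (Finite (extend P p_infty - extend Q p_infty))).
    { apply (is_lim_ext (fun x => P x - Q x)); [intros; now rewrite hf|].
      apply is_lim_minus'; now apply is_lim_extend_p_infty. }
    unfold extend at 1. now rewrite (is_lim_unique _ _ _ h).
  - assert (h : is_lim f m_infty (Finite (extend P m_infty - extend Q m_infty))).
    { apply (is_lim_ext (fun x => P x - Q x)); [intros; now rewrite hf|].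
      apply is_lim_minus'; now apply is_lim_extend_m_infty. }
    unfold extend at 1. now rewrite (is_lim_unique _ _ _ h).
Qed.

Lemma bdiff_decreasing P M : decreasing P -> (forall x, Rabs (P x) <= M) -> bdiff P.
Proof.
  intros hP hM. exists P, (fun _ => 0), M. repeat split; auto.
  - intros x y _. lra.
  - rewrite Rabs_R0. pose proof (hM x). pose proof (Rabs_pos (P x)). lra.
  - intros x. ring.
Qed.

(** For decreasing functions the variation sums telescope. *)
Lemma bdiff_bounded_variation f : bdiff f -> bounded_variation_Rbar f.
Proof.
  intros (P & Q & M & hP & hQ & hM & hf).
  assert (hMP : forall x, Rabs (P x) <= M) by apply hM.
  assert (hMQ : forall x, Rabs (Q x) <= M) by apply hM.
  assert (hext := extend_minus f P Q (bdiff_decreasing P M hP hMP) (bdiff_decreasing Q M hQ hMQ) hf).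
  exists (extend P m_infty - extend P p_infty + (extend Q m_infty - extend Q p_infty)).
  intros N x (h0 & hN & hlt).
  assert (H : forall n, (n <= N)%nat -> variation_sum f x n <=
    extend P (x 0%nat) - extend P (x n) + (extend Q (x 0%nat) - extend Q (x n))).
  { induction n as [|n IH]; intros hn.
    - unfold variation_sum. rewrite sum_n_m_zero by lia. change zero with 0. lra.
    - unfold variation_sum. rewrite sum_n_Sm by lia. change plus with Rplus.
      specialize (IH ltac:(lia)). unfold variation_sum in IH.
      replace (S n - 1)%nat with n by lia. rewrite !hext.
      assert (h1 := extend_decreasing P M hP hMP _ _ (hlt n ltac:(lia))).
      assert (h2 := extend_decreasing Q M hQ hMQ _ _ (hlt n ltac:(lia))).
      assert (h3 : Rabs (extend P (x (S n)) - extend Q (x (S n)) -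
        (extend P (x n) - extend Q (x n))) <=
        extend P (x n) - extend P (x (S n)) + (extend Q (x n) - extend Q (x (S n))))
        by (apply Rabs_le; lra).
      lra. }
  specialize (H N (le_n N)). rewrite h0, hN in H. exact H.
Qed.

Lemma bdiff_minus f h : bdiff f -> bdiff h -> bdiff (fun x => f x - h x).
Proof.
  intros (P & Q & M & hP & hQ & hM & hf) (P' & Q' & M' & hP' & hQ' & hM' & hh).
  exists (fun x => P x + Q' x), (fun x => Q x + P' x), (M + M').
  split; [|split; [|split]].
  - intros x y hxy. specialize (hP x y hxy). specialize (hQ' x y hxy). lra.
  - intros x y hxy. specialize (hQ x y hxy). specialize (hP' x y hxy). lra.
  - intros x. destruct (hM x), (hM' x). split; (eapply Rle_trans; [apply Rabs_triang|]); lra.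
  - intros x. rewrite hf, hh. ring.
Qed.

Lemma bdiff_scal c f : bdiff f -> bdiff (fun x => c * f x).
Proof.
  intros (P & Q & M & hP & hQ & hM & hf).
  assert (hd : forall c F, 0 <= c -> decreasing F -> decreasing (fun x => c * F x)).
  { intros d F hd hF x y h. apply Rmult_le_compat_l; [exact hd|now apply hF]. }
  assert (hb : forall d, Rabs d = Rabs c -> forall x, Rabs (d * P x) <= Rabs c * M /\ Rabs (d * Q x) <= Rabs c * M).
  { intros d e x. rewrite !Rabs_mult, e. pose proof (Rabs_pos c). destruct (hM x).
    split; now apply Rmult_le_compat_l. }
  destruct (Rle_dec 0 c) as [h | h].
  - exists (fun x => c * P x), (fun x => c * Q x), (Rabs c * M).
    repeat split; auto; try (apply hb; reflexivity). intros x. rewrite hf. ring.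
  - exists (fun x => - c * Q x), (fun x => - c * P x), (Rabs c * M).
    assert (0 <= - c) by lra.
    repeat split; auto; try (apply hb; apply Rabs_Ropp). intros x. rewrite hf. ring.
Qed.

Lemma heaviside_opp x : heaviside (- x) = 1 - heaviside x.
Proof. unfold heaviside. repeat destruct Rlt_dec; lra. Qed.

Lemma bdiff_heaviside : bdiff (fun x => heaviside (- x)).
Proof.
  apply (bdiff_decreasing _ 1).
  - intros x y h. unfold heaviside. repeat destruct Rlt_dec; lra.
  - intros x. unfold heaviside. apply Rabs_le. repeat destruct Rlt_dec; lra.
Qed.

Lemma bdiff_const c : bdiff (fun _ => c).
Proof. apply (bdiff_decreasing _ (Rabs c)); [intros x y _; lra|intros; lra]. Qed.

Lemma bdiff_ext f h : (forall x, f x = h x) -> bdiff f -> bdiff h.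
Proof.
  intros e (P & Q & M & hP & hQ & hM & hf). exists P, Q, M. repeat split; auto; try apply hM.
  intros x. now rewrite <- e.
Qed.

(** The two decreasing functions have the same limit, which can be subtracted from both. *)
Lemma bdiff_vdiff G : bdiff G -> is_lim G p_infty 0 -> vdiff G.
Proof.
  intros (P & Q & M & hP & hQ & hM & hG) hl.
  destruct (is_lim_decreasing P (- M) hP) as [p [hp _]].
  { intros x. destruct (hM x) as [h _]. apply Rabs_le_between in h. lra. }
  destruct (is_lim_decreasing Q (- M) hQ) as [q [hq _]].
  { intros x. destruct (hM x) as [_ h]. apply Rabs_le_between in h. lra. }
  assert (e : p - q = 0).
  { assert (h : is_lim G p_infty (p - q)).
    { apply (is_lim_ext (fun x => P x - Q x)); [intros; now rewrite hG|]. now apply is_lim_minus'. }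
    apply is_lim_unique in h. apply is_lim_unique in hl. rewrite hl in h. now injection h. }
  assert (H : forall F l, decreasing F -> is_lim F p_infty (Finite l) -> vanishing (fun u => F u - l)).
  { intros F l hF hl'. split.
    - intros x y h. specialize (hF x y h). lra.
    - replace (Finite 0) with (Finite (l - l)) by (f_equal; ring).
      apply is_lim_minus'; [exact hl'|apply is_lim_const]. }
  exists (fun u => P u - p), (fun u => Q u - q). split; [now apply H|]. split; [now apply H|].
  intros u. rewrite hG. lra.
Qed.

Lemma vdiff_shift G x : vdiff G -> vdiff (fun u => G (x + u)).
Proof.
  assert (H : forall P, vanishing P -> vanishing (fun u => P (x + u))).
  { intros P [hP hl]. split.
    - intros u v h. apply hP. lra.
    - apply is_lim_p_infty_eps. intros eps.
      destruct (is_lim_p_infty_elim P 0 eps hl (cond_pos eps)) as [M [_ hM]].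
      exists (M - x). intros u hu. apply hM. lra. }
  intros (P & Q & hP & hQ & hG). exists (fun u => P (x + u)), (fun u => Q (x + u)).
  split; [now apply H|]. split; [now apply H|]. intros u. apply hG.
Qed.

(** * Improper integrals *)

Lemma is_RInt_gen_intro (h : R -> R) (Fa Fb : (R -> Prop) -> Prop) {FFa : Filter Fa} {FFb : Filter Fb} l :
  (forall a b, ex_RInt h a b) ->
  (forall eps : posreal, filter_prod Fa Fb (fun ab => Rabs (RInt h (fst ab) (snd ab) - l) < eps)) ->
  is_RInt_gen h Fa Fb l.
Proof.
  intros hi H P [eps hP]. unfold filtermapi.
  apply (filter_imp (Filter := filter_prod_filter _ _ Fa Fb _ _) (fun ab => Rabs (RInt h (fst ab) (snd ab) - l) < eps)).
  - intros [a b] hab. exists (RInt h a b). split; [now apply RInt_correct_R|]. apply hP, hab.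
  - apply H.
Qed.

Lemma RInt_shift (h : R -> R) x A : (forall a b, ex_RInt h a b) ->
  RInt (fun u => h (x + u)) 0 A = RInt h x (x + A).
Proof.
  intros hi. assert (e := RInt_comp_lin (V := R_CompleteNormedModule) h 1 x 0 A ltac:(apply hi)).
  replace (1 * 0 + x) with x in e by ring. replace (1 * A + x) with (x + A) in e by ring.
  rewrite <- e. apply RInt_ext. intros u _. unfold scal; simpl; unfold mult; simpl.
  rewrite Rmult_1_l. f_equal. ring.
Qed.

Lemma is_RInt_reflect (h : R -> R) x a b I :
  is_RInt h (x - b) (x - a) I -> is_RInt (fun u => h (x - u)) a b I.
Proof.
  intros H. apply is_RInt_swap in H.
  assert (e : is_RInt (fun u => -1 * h (-1 * u + x)) a b (- I)).
  { apply (is_RInt_comp_lin (V := R_NormedModule) h (-1) x a b).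
    replace (-1 * a + x) with (x - a) by ring. replace (-1 * b + x) with (x - b) by ring. exact H. }
  apply (is_RInt_scal (V := R_NormedModule) _ _ _ (-1)) in e.
  replace I with (scal (-1) (- I)) by (unfold scal; simpl; unfold mult; simpl; lra).
  apply (is_RInt_ext (fun u => scal (-1) (-1 * h (-1 * u + x)))); [|exact e].
  intros u _. replace (-1 * u + x) with (x - u) by ring.
  unfold scal; simpl; unfold mult; simpl. lra.
Qed.

Lemma RInt_reflect (h : R -> R) x A : (forall a b, ex_RInt h a b) ->
  RInt (fun u => h (x - u)) 0 A = RInt h (x - A) x.
Proof.
  intros hi. apply is_RInt_unique, is_RInt_reflect. rewrite Rminus_0_r. apply RInt_correct_R, hi.
Qed.

Lemma is_RInt_gen_split (h : R -> R) x l1 l2 :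
  (forall a b, ex_RInt h a b) ->
  is_lim (fun A => RInt (fun u => h (x + u)) 0 A) p_infty (Finite l1) ->
  is_lim (fun A => RInt (fun u => h (x - u)) 0 A) p_infty (Finite l2) ->
  is_RInt_gen h (Rbar_locally m_infty) (Rbar_locally p_infty) (l1 + l2).
Proof.
  intros hi h1 h2. apply (is_RInt_gen_intro h (Rbar_locally m_infty) (Rbar_locally p_infty)); [exact hi|].
  intros eps. pose proof (cond_pos eps) as he.
  destruct (is_lim_p_infty_elim _ _ (eps / 2) h1 ltac:(lra)) as [M1 [_ hM1]].
  destruct (is_lim_p_infty_elim _ _ (eps / 2) h2 ltac:(lra)) as [M2 [_ hM2]].
  exists (fun a => a < x - M2) (fun b => x + M1 < b); [now exists (x - M2)|now exists (x + M1)|].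
  intros a b ha hb. simpl.
  specialize (hM1 (b - x) ltac:(lra)). rewrite RInt_shift in hM1 by exact hi.
  specialize (hM2 (x - a) ltac:(lra)). rewrite RInt_reflect in hM2 by exact hi.
  replace (x + (b - x)) with b in hM1 by ring. replace (x - (x - a)) with a in hM2 by ring.
  rewrite <- (RInt_Chasles_R h a x b hi).
  replace (RInt h a x + RInt h x b - (l1 + l2)) with ((RInt h x b - l1) + (RInt h a x - l2)) by ring.
  eapply Rle_lt_trans; [apply Rabs_triang|]. lra.
Qed.

Lemma is_RInt_gen_ext_R {V : NormedModule R_AbsRing} (Fa Fb : (R -> Prop) -> Prop)
  {FFa : Filter Fa} {FFb : Filter Fb} (f h : R -> V) l :
  (forall x, f x = h x) -> is_RInt_gen f Fa Fb l -> is_RInt_gen h Fa Fb l.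
Proof.
  intros e. apply is_RInt_gen_ext. exists (fun _ => True) (fun _ => True); try apply filter_true.
  intros a b _ _ x _. apply e.
Qed.

Section ComplexIntegrals.
Variables Fa Fb : (R -> Prop) -> Prop.
Context {FFa : Filter Fa} {FFb : Filter Fb}.

Lemma is_RInt_gen_pair (h : R -> C) (lr li : R) :
  is_RInt_gen (fun t => Re (h t)) Fa Fb lr -> is_RInt_gen (fun t => Im (h t)) Fa Fb li ->
  is_RInt_gen (V := C_R_NormedModule) h Fa Fb (lr, li).
Proof.
  intros hr hi P [eps hP]. unfold filtermapi.
  assert (h1 := hr (ball lr eps) (locally_ball _ _)).
  assert (h2 := hi (ball li eps) (locally_ball _ _)).
  unfold filtermapi in h1, h2.
  apply (filter_imp (Filter := filter_prod_filter _ _ Fa Fb _ _) (fun ab : R * R =>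
     (exists y, is_RInt (fun t => Re (h t)) (fst ab) (snd ab) y /\ ball lr eps y) /\
     (exists y, is_RInt (fun t => Im (h t)) (fst ab) (snd ab) y /\ ball li eps y))).
  - intros [a b] [[y1 [hy1 hb1]] [y2 [hy2 hb2]]]. exists (y1, y2). split.
    + now apply (is_RInt_fct_extend_pair (U := R_NormedModule) (V := R_NormedModule)).
    + apply hP. split; assumption.
  - now apply (filter_and (Filter := filter_prod_filter _ _ Fa Fb _ _)).
Qed.

Lemma is_RInt_gen_Re (h : R -> C) (l : C) :
  is_RInt_gen (V := C_R_NormedModule) h Fa Fb l -> is_RInt_gen (fun t => Re (h t)) Fa Fb (Re l).
Proof.
  intros H P [eps hP]. unfold filtermapi.
  assert (h1 := H (ball (M := C_R_NormedModule) l eps) (locally_ball _ _)).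
  unfold filtermapi in h1. revert h1.
  apply (filter_imp (Filter := filter_prod_filter _ _ Fa Fb _ _)). intros [a b] [y [hy hb]].
  exists (Re y). split.
  - now apply (is_RInt_fct_extend_fst (U := R_NormedModule) (V := R_NormedModule)).
  - apply hP, hb.
Qed.

Lemma is_RInt_gen_Im (h : R -> C) (l : C) :
  is_RInt_gen (V := C_R_NormedModule) h Fa Fb l -> is_RInt_gen (fun t => Im (h t)) Fa Fb (Im l).
Proof.
  intros H P [eps hP]. unfold filtermapi.
  assert (h1 := H (ball (M := C_R_NormedModule) l eps) (locally_ball _ _)).
  unfold filtermapi in h1. revert h1.
  apply (filter_imp (Filter := filter_prod_filter _ _ Fa Fb _ _)). intros [a b] [y [hy hb]].
  exists (Im y). split.
  - now apply (is_RInt_fct_extend_snd (U := R_NormedModule) (V := R_NormedModule)).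
  - apply hP, hb.
Qed.

Lemma is_RInt_gen_Cmult (c : C) (h : R -> C) (l : C) :
  is_RInt_gen (V := C_R_NormedModule) h Fa Fb l ->
  is_RInt_gen (V := C_R_NormedModule) (fun t => Cmult c (h t)) Fa Fb (Cmult c l).
Proof.
  intros H. assert (hr := is_RInt_gen_Re _ _ H). assert (hi := is_RInt_gen_Im _ _ H).
  apply is_RInt_gen_pair.
  - apply (is_RInt_gen_minus (fun t => fst c * Re (h t)) (fun t => snd c * Im (h t))).
    + now apply (is_RInt_gen_scal (V := R_NormedModule)).
    + now apply (is_RInt_gen_scal (V := R_NormedModule)).
  - apply (is_RInt_gen_plus (fun t => fst c * Im (h t)) (fun t => snd c * Re (h t))).
    + now apply (is_RInt_gen_scal (V := R_NormedModule)).
    + now apply (is_RInt_gen_scal (V := R_NormedModule)).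
Qed.

Lemma is_RInt_gen_Cplus (h1 h2 : R -> C) (l1 l2 : C) :
  is_RInt_gen (V := C_R_NormedModule) h1 Fa Fb l1 ->
  is_RInt_gen (V := C_R_NormedModule) h2 Fa Fb l2 ->
  is_RInt_gen (V := C_R_NormedModule) (fun t => Cplus (h1 t) (h2 t)) Fa Fb (Cplus l1 l2).
Proof. apply (is_RInt_gen_plus (V := C_R_NormedModule)). Qed.

End ComplexIntegrals.

Lemma is_integral_unique (h : R -> C) l : is_integral h l -> integral h = l.
Proof.
  intros H. exact (is_RInt_gen_unique (V := C_R_CompleteNormedModule)
    (Fa := Rbar_locally m_infty) (Fb := Rbar_locally p_infty) h l H).
Qed.

Lemma is_integral_pair (h : R -> C) (lr li : R) :
  is_RInt_gen (fun t => Re (h t)) (Rbar_locally m_infty) (Rbar_locally p_infty) lr ->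
  is_RInt_gen (fun t => Im (h t)) (Rbar_locally m_infty) (Rbar_locally p_infty) li ->
  is_integral h (lr, li).
Proof.
  exact (is_RInt_gen_pair (Rbar_locally m_infty) (Rbar_locally p_infty) h lr li).
Qed.

Lemma is_integral_Cmult (c : C) (h : R -> C) (l : C) :
  is_integral h l -> is_integral (fun t => Cmult c (h t)) (Cmult c l).
Proof.
  exact (is_RInt_gen_Cmult (Rbar_locally m_infty) (Rbar_locally p_infty) c h l).
Qed.

Lemma is_integral_Cplus (h1 h2 : R -> C) (l1 l2 : C) :
  is_integral h1 l1 -> is_integral h2 l2 ->
  is_integral (fun t => Cplus (h1 t) (h2 t)) (Cplus l1 l2).
Proof.
  exact (is_RInt_gen_Cplus (Rbar_locally m_infty) (Rbar_locally p_infty) h1 h2 l1 l2).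
Qed.

Lemma is_integral_ext (f h : R -> C) l : (forall x, f x = h x) -> is_integral f l -> is_integral h l.
Proof.
  exact (is_RInt_gen_ext_R (V := C_R_NormedModule) (Rbar_locally m_infty) (Rbar_locally p_infty) f h l).
Qed.

Lemma ex_RInt_bdiff (f k : R -> R) a b :
  bdiff f -> (forall x, continuous k x) -> ex_RInt (fun x => f x * k x) a b.
Proof.
  intros (P & Q & M & hP & hQ & _ & hf) hk.
  apply (ex_RInt_ext (fun u => P u * k u - Q u * k u)).
  - intros u _. rewrite hf. symmetry. apply Rmult_minus_distr_r.
  - apply ex_RInt_minus_R; now apply ex_RInt_decreasing_mult.
Qed.

(** * Fourier inversion *)

Definition right_part (g : R -> R) (x u : R) : R := g (x + u).
Definition left_part (g : R -> R) (x u : R) : R := g (x - u).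

Section Inversion.
Variable g : R -> R.
Hypothesis hg : bdiff g.
Hypothesis hgp : is_lim g p_infty 0.
Hypothesis hgm : is_lim g m_infty 0.

Lemma vdiff_right_part x : vdiff (right_part g x).
Proof. apply vdiff_shift, bdiff_vdiff; assumption. Qed.

Lemma vdiff_left_part x : vdiff (left_part g x).
Proof.
  assert (h : vdiff (fun u => g (- u))).
  { apply bdiff_vdiff; [now apply bdiff_opp|now apply is_lim_p_infty_opp]. }
  apply (vdiff_shift _ (- x)) in h. destruct h as (P & Q & hP & hQ & h).
  exists P, Q. split; [exact hP|]. split; [exact hQ|].
  intros u. rewrite <- h. unfold left_part. f_equal. ring.
Qed.

(** The integral is split at x.  The sign sg is 1 for cos and -1 for sin, and
    enters because t = x - u turns k (s (t - x)) into k (- s u). *)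
Lemma is_RInt_gen_fourier_trig k sg s x :
  trig k -> (forall y, k (- y) = sg * k y) -> s <> 0 ->
  is_RInt_gen (fun t => g t * k (s * (t - x))) (Rbar_locally m_infty) (Rbar_locally p_infty)
    (half_transform (right_part g x) k s + sg * half_transform (left_part g x) k s).
Proof.
  intros hk hsg hs.
  destruct (half_transform_spec _ k (vdiff_right_part x) hk) as [e1 [_ h1]].
  destruct (half_transform_spec _ k (vdiff_left_part x) hk) as [e2 [_ h2]].
  destruct (h1 s hs) as [h1' _]. destruct (h2 s hs) as [h2' _].
  apply is_RInt_gen_split with x.
  - intros a b. apply (ex_RInt_bdiff g (fun t => k (s * (t - x)))); [exact hg|].
    intros t. apply (continuous_comp (fun t => t - x) (fun u => k (s * u))).
    + apply (ex_derive_continuous (V := R_NormedModule)). auto_derive. auto.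
    + now apply continuous_trig.
  - apply (is_lim_ext (fun A => RInt (fun u => right_part g x u * k (s * u)) 0 A)); [|exact h1'].
    intros A. apply RInt_ext. intros u _. unfold right_part.
    now replace (x + u - x) with u by ring.
  - apply (is_lim_ext (fun A => sg * RInt (fun u => left_part g x u * k (s * u)) 0 A)).
    + intros A. rewrite <- RInt_scal_R.
      2:{ apply (ex_RInt_vdiff _ (fun u => k (s * u))); [apply vdiff_left_part|now apply continuous_trig]. }
      apply RInt_ext. intros u _. unfold left_part.
      replace (s * (x - u - x)) with (- (s * u)) by ring. rewrite hsg.
      change (sg * (g (x - u) * k (s * u)) = g (x - u) * (sg * k (s * u))). ring.
    + now apply (is_lim_scal_l _ sg p_infty (half_transform (left_part g x) k s)).
Qed.

(** Real and imaginary parts of exp (i x s) times the transform of g at s. *)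
Definition re_part (x s : R) : R :=
  half_transform (right_part g x) cos s + half_transform (left_part g x) cos s.

Definition im_part (x s : R) : R :=
  - (half_transform (right_part g x) sin s - half_transform (left_part g x) sin s).

Lemma is_integral_translated x s : s <> 0 ->
  is_integral (fun t => Cmult (expi (x * s)) (fourier_integrand (fun t => RtoC (g t)) s t))
    (re_part x s, im_part x s).
Proof.
  intros hs. apply is_integral_pair.
  - apply (is_RInt_gen_ext_R _ _ (fun t => g t * cos (s * (t - x)))).
    + intros t. unfold fourier_integrand, expi. simpl.
      replace (s * (t - x)) with (- (x * s + - (s * t))) by ring. rewrite cos_neg, cos_plus. ring.
    + unfold re_part. rewrite <- (Rmult_1_l (half_transform (left_part g x) cos s)).
      apply is_RInt_gen_fourier_trig; [now left| |exact hs]. intros y. rewrite cos_neg. ring.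
  - apply (is_RInt_gen_ext_R _ _ (fun t => -1 * (g t * sin (s * (t - x))))).
    + intros t. unfold fourier_integrand, expi. simpl.
      replace (s * (t - x)) with (- (x * s + - (s * t))) by ring. rewrite sin_neg, sin_plus. ring.
    + replace (im_part x s) with (-1 * (half_transform (right_part g x) sin s +
         -1 * half_transform (left_part g x) sin s)) by (unfold im_part; ring).
      apply (is_RInt_gen_scal (V := R_NormedModule)).
      apply is_RInt_gen_fourier_trig; [now right| |exact hs]. intros y. rewrite sin_neg. ring.
Qed.

Lemma is_integral_fourier s : s <> 0 ->
  is_integral (fourier_integrand (fun t => RtoC (g t)) s) (fourier (fun t => RtoC (g t)) s).
Proof.
  intros hs.
  assert (h : is_integral (fourier_integrand (fun t => RtoC (g t)) s) (re_part 0 s, im_part 0 s)).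
  { apply is_integral_ext with (2 := is_integral_translated 0 s hs). intros t.
    rewrite Rmult_0_l. unfold expi. rewrite cos_0, sin_0. apply Cmult_1_l. }
  unfold fourier. now rewrite (is_integral_unique _ _ h).
Qed.

Lemma fourier_translated x s : s <> 0 ->
  Cmult (expi (x * s)) (fourier (fun t => RtoC (g t)) s) = (re_part x s, im_part x s).
Proof.
  intros hs. rewrite <- (is_integral_unique _ _ (is_integral_translated x s hs)).
  symmetry. apply is_integral_unique, is_integral_Cmult. now apply is_integral_fourier.
Qed.

Lemma half_transform_cos_opp G s : half_transform G cos (- s) = half_transform G cos s.
Proof.
  unfold half_transform. f_equal. apply Lim_ext. intros A. apply RInt_ext. intros u _.
  now rewrite Ropp_mult_distr_l_reverse, cos_neg.
Qed.

Lemma half_transform_sin_opp G s : vdiff G -> half_transform G sin (- s) = - half_transform G sin s.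
Proof.
  intros hG. unfold half_transform.
  transitivity (real (Lim (fun A => - RInt (fun u => G u * sin (s * u)) 0 A) p_infty)).
  - f_equal. apply Lim_ext. intros A. symmetry.
    transitivity (-1 * RInt (fun u => G u * sin (s * u)) 0 A); [|ring].
    rewrite <- RInt_scal_R.
    + apply RInt_ext. intros u _. rewrite Ropp_mult_distr_l_reverse, sin_neg.
      change (G u * - sin (s * u) = -1 * (G u * sin (s * u))). ring.
    + apply (ex_RInt_vdiff G (fun u => sin (s * u))); [exact hG|apply continuous_trig; now right].
  - rewrite (Lim_opp (fun A => RInt (fun u => G u * sin (s * u)) 0 A) p_infty).
    destruct Lim; simpl; ring.
Qed.

Lemma re_part_opp x s : re_part x (- s) = re_part x s.
Proof. unfold re_part. now rewrite !half_transform_cos_opp. Qed.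

Lemma im_part_opp x s : im_part x (- s) = - im_part x s.
Proof.
  unfold im_part. rewrite !half_transform_sin_opp; [ring| |].
  - apply vdiff_left_part.
  - apply vdiff_right_part.
Qed.

(** On the negative side the integral is the complex conjugate, because the real
    part is even in s and the imaginary part odd. *)
Lemma is_RInt_annulus x S T : 0 < S -> S < T ->
  let h := fun s : R => Cmult (expi (x * s)) (fourier (fun t => RtoC (g t)) s) in
  exists I J : R, I = RInt (half_transform (right_part g x) cos) S T
                    + RInt (half_transform (left_part g x) cos) S T /\
    is_RInt (V := C_R_NormedModule) h S T (I, J) /\
    is_RInt (V := C_R_NormedModule) h (- T) (- S) (I, - J).
Proof.
  intros hS hST h.
  assert (hi : forall k, trig k -> ex_RInt (half_transform (right_part g x) k) S T /\
     ex_RInt (half_transform (left_part g x) k) S T).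
  { intros k hk. split; apply RInt_half_transform_lim; auto.
    - apply vdiff_right_part.
    - apply vdiff_left_part. }
  destruct (hi cos (or_introl eq_refl)) as [c1 c2]. destruct (hi sin (or_intror eq_refl)) as [s1 s2].
  set (I := RInt (half_transform (right_part g x) cos) S T
          + RInt (half_transform (left_part g x) cos) S T).
  assert (hI : is_RInt (re_part x) S T I).
  { apply (is_RInt_plus (V := R_NormedModule)); now apply RInt_correct_R. }
  set (J := - (RInt (half_transform (right_part g x) sin) S T
          - RInt (half_transform (left_part g x) sin) S T)).
  assert (hJ : is_RInt (im_part x) S T J).
  { apply (is_RInt_opp (V := R_NormedModule)), (is_RInt_minus (V := R_NormedModule));
      now apply RInt_correct_R. }
  exists I, J. split; [reflexivity|]. split.
  - apply (is_RInt_ext (V := C_R_NormedModule) (fun s => (re_part x s, im_part x s))).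
    + intros s hs. rewrite Rmin_left in hs by lra. symmetry. apply fourier_translated. lra.
    + now apply (is_RInt_fct_extend_pair (U := R_NormedModule) (V := R_NormedModule)).
  - apply (is_RInt_ext (V := C_R_NormedModule) (fun s => (re_part x (0 - s), - im_part x (0 - s)))).
    + intros s hs. rewrite Rmax_right in hs by lra. symmetry.
      unfold h. rewrite fourier_translated by lra.
      replace (0 - s) with (- s) by ring. rewrite re_part_opp, im_part_opp, Ropp_involutive. reflexivity.
    + apply (is_RInt_fct_extend_pair (U := R_NormedModule) (V := R_NormedModule)); simpl.
      * apply is_RInt_reflect. now replace (0 - - S) with S by ring; replace (0 - - T) with T by ring.
      * apply (is_RInt_opp (V := R_NormedModule)). apply (is_RInt_reflect (im_part x)).
        now replace (0 - - S) with S by ring; replace (0 - - T) with T by ring.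
Qed.

Lemma annulus_integral_lim x gl gr :
  filterlim g (at_left x) (locally gl) -> filterlim g (at_right x) (locally gr) ->
  let h := fun s : R => Cmult (expi (x * s)) (fourier (fun t => RtoC (g t)) s) in
  filterlim (fun TS : R * R => annulus_integral h (snd TS) (fst TS))
    (filter_prod (Rbar_locally p_infty) (at_right 0)) (locally (RtoC (PI * (gl + gr)))).
Proof.
  intros hl hr h.
  assert (hr' : filterlim (right_part g x) (at_right 0) (locally gr)).
  { apply at_right_intro. intros eps he. destruct (at_right_elim g x gr eps hr he) as [d [hd H]].
    exists d. split; [exact hd|]. intros y h1 h2. apply H; lra. }
  assert (hl' : filterlim (left_part g x) (at_right 0) (locally gl)).
  { apply filterlim_at_right_opp in hl. apply at_right_intro. intros eps he.
    destruct (at_right_elim _ _ gl eps hl he) as [d [hd H]].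
    exists d. split; [exact hd|]. intros y h1 h2. unfold left_part.
    replace (x - y) with (- (- x + y)) by ring. apply H; lra. }
  destruct (RInt_half_transform_cos _ _ (vdiff_right_part x) hr') as (D1 & e1 & i1 & z1).
  destruct (RInt_half_transform_cos _ _ (vdiff_left_part x) hl') as (D2 & e2 & i2 & z2).
  assert (hD : forall D l, is_lim D p_infty (Finite l) -> filterlim D (at_right 0) (locally 0) ->
    filterlim (fun TS : R * R => D (fst TS) - D (snd TS))
      (filter_prod (Rbar_locally p_infty) (at_right 0)) (locally (l - 0))).
  { intros D l h1 h2. apply filterlim_minus_R.
    - apply (filterlim_comp _ _ _ fst D _ (Rbar_locally p_infty)); [apply filterlim_fst|exact h1].
    - apply (filterlim_comp _ _ _ snd D _ (at_right 0)); [apply filterlim_snd|exact h2]. }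
  assert (hlim := filterlim_plus_R _ _ _ _ (hD D1 _ i1 z1) (hD D2 _ i2 z2)).
  apply (filterlim_scal_R _ 2) in hlim.
  replace (2 * (PI / 2 * gr - 0 + (PI / 2 * gl - 0))) with (PI * (gl + gr)) in hlim by field.
  apply (filterlim_ext_loc (fun TS : R * R => RtoC (2 * (D1 (fst TS) - D1 (snd TS) + (D2 (fst TS) - D2 (snd TS)))))).
  - exists (fun T => 1 < T) (fun S => 0 < S < 1).
    + now exists 1.
    + exists (mkposreal 1 Rlt_0_1). intros y hy hy0. change (Rabs (y - 0) < 1) in hy.
      apply Rabs_def2 in hy. lra.
    + intros T S hT hS. simpl.
      destruct (is_RInt_annulus x S T ltac:(lra) ltac:(lra)) as (I & J & eI & h1 & h2).
      unfold annulus_integral, integral_on.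
      rewrite (is_RInt_unique (V := C_R_CompleteNormedModule) h _ _ _ h1).
      rewrite (is_RInt_unique (V := C_R_CompleteNormedModule) h _ _ _ h2).
      rewrite e1, e2 in eI by lra. rewrite eI.
      unfold RtoC, Cplus. simpl. f_equal; ring.
  - apply (filterlim_comp _ _ _ _ RtoC _ (locally (PI * (gl + gr)))); [exact hlim|].
    apply filterlim_locally. intros eps. exists eps. intros y hy. split; [exact hy|].
    apply (ball_center (M := R_UniformSpace)).
Qed.

End Inversion.

(** The value 1/2 at 0 makes H equal to the average of its one-sided limits. *)
Lemma heaviside_limits x : exists hl hr : R,
  filterlim heaviside (at_left x) (locally hl) /\ filterlim heaviside (at_right x) (locally hr) /\
  (hl + hr) / 2 = heaviside x.
Proof.
  assert (H : forall x, filterlim heaviside (at_right x) (locally (if Rle_dec 0 x then 1 else 0))).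
  { clear x. intros x. apply at_right_intro. intros eps he.
    exists (if Rle_dec 0 x then 1 else - x). split; [destruct Rle_dec; lra|].
    intros y h1 h2. unfold heaviside.
    destruct Rle_dec; repeat destruct Rlt_dec; try lra; rewrite Rminus_eq_0, Rabs_R0; exact he. }
  exists (1 - if Rle_dec 0 (- x) then 1 else 0), (if Rle_dec 0 x then 1 else 0).
  split; [|split].
  - apply filterlim_at_left_opp. apply (filterlim_ext (fun u => 1 - heaviside u)).
    + intros u. now rewrite heaviside_opp.
    + apply filterlim_minus_R; [apply filterlim_const|apply H].
  - apply H.
  - unfold heaviside. repeat destruct Rle_dec; repeat destruct Rlt_dec; lra.
Qed.

(** * Quadratically decaying functions *)

Definition quad_decay (B : R) (h : R -> R) : Prop := forall t, (1 + t ^ 2) * Rabs (h t) <= B.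

Lemma quad_decay_bound B h t : quad_decay B h -> Rabs (h t) <= B.
Proof.
  intros H. specialize (H t). pose proof (pow2_ge_0 t). pose proof (Rabs_pos (h t)). nra.
Qed.

Lemma quad_decay_nonneg B h : quad_decay B h -> 0 <= B.
Proof. intros H. apply Rle_trans with (Rabs (h 0)); [apply Rabs_pos|now apply quad_decay_bound]. Qed.

Lemma quad_decay_small B eps : 0 < eps ->
  exists M, 0 < M /\ forall h t, quad_decay B h -> M < Rabs t -> Rabs (h t) < eps.
Proof.
  intros he. exists (1 + Rabs B / eps).
  assert (hq : 0 <= Rabs B / eps).
  { apply Rmult_le_pos; [apply Rabs_pos|]. left. now apply Rinv_0_lt_compat. }
  split; [lra|]. intros h t H ht. specialize (H t).
  assert (h1 : Rabs t <= t ^ 2) by (rewrite <- pow2_abs; nra).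
  apply Rmult_lt_reg_l with (1 + t ^ 2); [lra|].
  eapply Rle_lt_trans; [exact H|]. pose proof (Rle_abs B).
  assert (e : Rabs B / eps * eps = Rabs B) by (field; lra). nra.
Qed.

Lemma RInt_quad_decay h B a b : a <= b -> ex_RInt h a b -> quad_decay B h ->
  Rabs (RInt h a b) <= B * (atan b - atan a).
Proof.
  intros hab hi H.
  apply (norm_RInt_le (V := R_NormedModule) h (fun t => scal B (/ (1 + t ^ 2))) a b
    (RInt h a b) (scal B (minus (atan b) (atan a)))); [exact hab| |now apply RInt_correct_R|].
  - intros t _. change (Rabs (h t) <= B * / (1 + t ^ 2)). specialize (H t).
    pose proof (pow2_ge_0 t).
    apply Rmult_le_reg_l with (1 + t ^ 2); [lra|].
    replace ((1 + t ^ 2) * (B * / (1 + t ^ 2))) with B by (field; lra). exact H.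
  - apply (is_RInt_scal (V := R_NormedModule)).
    apply (is_RInt_derive (V := R_CompleteNormedModule)).
    + intros t _. apply is_derive_atan_pow.
    + intros t _. apply (ex_derive_continuous (V := R_NormedModule)). auto_derive.
      pose proof (pow2_ge_0 t). simpl in *. lra.
Qed.

(** Subtracting B atan A makes the integral over [0, A] monotone in A, hence
    convergent, as B atan A converges too. *)
Lemma is_lim_quad_decay h B : (forall a b, ex_RInt h a b) -> quad_decay B h ->
  exists l : R, is_lim (fun A => RInt h 0 A) p_infty l /\ Rabs l <= B * (PI / 2).
Proof.
  intros hi H. assert (hB := quad_decay_nonneg _ _ H).
  assert (hat : forall A, 0 <= A -> 0 <= atan A <= PI / 2).
  { intros A hA. split; [|left; apply atan_bound].
    destruct hA as [hA | <-]; [|rewrite atan_0; lra].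
    rewrite <- atan_0. left. now apply atan_increasing. }
  assert (hmono : forall x y, x <= y -> atan x <= atan y).
  { intros x y [h1 | ->]; [left; now apply atan_increasing|lra]. }
  assert (hb : forall A, 0 <= A -> Rabs (RInt h 0 A) <= B * (PI / 2)).
  { intros A hA. eapply Rle_trans; [apply (RInt_quad_decay h B 0 A); auto|].
    rewrite atan_0. destruct (hat A hA). apply Rmult_le_compat_l; lra. }
  (* Composition with r turns monotonicity on A >= 0 into monotonicity on R. *)
  set (r := fun A : R => Rmax 0 A).
  assert (hr : forall A, 0 <= r A) by (intros; apply Rmax_l).
  assert (hrm : forall x y, x <= y -> r x <= r y) by (intros; apply Rle_max_compat_l; assumption).
  destruct (is_lim_decreasing (fun A => - (B * atan (r A))) (- (B * (PI / 2)))) as [l1 [h1 _]].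
  { intros x y hxy. apply Ropp_le_contravar, Rmult_le_compat_l; [exact hB|]. apply hmono. now apply hrm. }
  { intros A. apply Ropp_le_contravar, Rmult_le_compat_l; [exact hB|]. apply hat, hr. }
  destruct (is_lim_decreasing (fun A => RInt h 0 (r A) - B * atan (r A)) (- (B * PI))) as [l2 [h2 _]].
  { intros x y hxy. specialize (hrm x y hxy).
    assert (h3 := RInt_quad_decay h B (r x) (r y) hrm (hi _ _) H).
    rewrite <- (RInt_Chasles_minus h 0 (r x) (r y) hi) in h3.
    apply Rabs_le_between in h3. lra. }
  { intros A. specialize (hb (r A) (hr A)). apply Rabs_le_between in hb.
    destruct (hat (r A) (hr A)) as [_ h3].
    assert (B * atan (r A) <= B * (PI / 2)) by now apply Rmult_le_compat_l. lra. }
  assert (h3 : is_lim (fun A => RInt h 0 A) p_infty (l2 - l1)).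
  { apply (is_lim_ext_loc (fun A => RInt h 0 (r A) - B * atan (r A) - - (B * atan (r A)))).
    - exists 0. intros A hA. unfold r. rewrite Rmax_right by lra. ring.
    - now apply is_lim_minus'. }
  exists (l2 - l1). split; [exact h3|].
  assert (h4 := is_lim_Rabs _ _ _ h3).
  apply (is_lim_le_loc _ (fun _ => B * (PI / 2)) p_infty _ (Finite (B * (PI / 2)))) in h4;
    [exact h4| |apply is_lim_const].
  exists 0. intros A hA. apply hb. lra.
Qed.

Definition Rline_integral (h : R -> R) (l : R) : Prop :=
  is_RInt_gen h (Rbar_locally m_infty) (Rbar_locally p_infty) l.

Lemma Rline_integral_unique h l1 l2 : Rline_integral h l1 -> Rline_integral h l2 -> l1 = l2.
Proof.
  intros h1 h2.
  rewrite <- (is_RInt_gen_unique (V := R_CompleteNormedModule)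
    (Fa := Rbar_locally m_infty) (Fb := Rbar_locally p_infty) h l1 h1).
  exact (is_RInt_gen_unique (V := R_CompleteNormedModule)
    (Fa := Rbar_locally m_infty) (Fb := Rbar_locally p_infty) h l2 h2).
Qed.

Lemma Rline_integral_ext h k l : (forall t, h t = k t) -> Rline_integral h l -> Rline_integral k l.
Proof. exact (is_RInt_gen_ext_R (Rbar_locally m_infty) (Rbar_locally p_infty) h k l). Qed.

Lemma Rline_integral_plus h k l1 l2 : Rline_integral h l1 -> Rline_integral k l2 ->
  Rline_integral (fun t => h t + k t) (l1 + l2).
Proof. exact (is_RInt_gen_plus (V := R_NormedModule) h k l1 l2). Qed.

Lemma Rline_integral_minus h k l1 l2 : Rline_integral h l1 -> Rline_integral k l2 ->
  Rline_integral (fun t => h t - k t) (l1 - l2).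
Proof. exact (is_RInt_gen_minus (V := R_NormedModule) h k l1 l2). Qed.

Lemma Rline_integral_scal c h l : Rline_integral h l ->
  Rline_integral (fun t => c * h t) (c * l).
Proof. exact (is_RInt_gen_scal (V := R_NormedModule) h c l). Qed.

Lemma Rline_integral_quad_decay h B : (forall a b, ex_RInt h a b) -> quad_decay B h ->
  exists l : R, Rline_integral h l /\ Rabs l <= B * PI.
Proof.
  intros hi H.
  destruct (is_lim_quad_decay h B hi H) as [l1 [h1 b1]].
  assert (hi' : forall a b, ex_RInt (fun u => h (0 - u)) a b).
  { intros a b. eexists. apply is_RInt_reflect, RInt_correct_R, hi. }
  destruct (is_lim_quad_decay (fun u => h (0 - u)) B hi') as [l2 [h2 b2]].
  { intros t. replace (t ^ 2) with ((0 - t) ^ 2) by ring. apply H. }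
  exists (l1 + l2). split.
  - apply (is_RInt_gen_split h 0); [exact hi| |exact h2].
    apply is_lim_ext with (2 := h1). intros A. apply RInt_ext. intros u _. now rewrite Rplus_0_l.
  - eapply Rle_trans; [apply Rabs_triang|]. lra.
Qed.

Lemma Rline_integral_bound h B l : (forall a b, ex_RInt h a b) -> quad_decay B h ->
  Rline_integral h l -> Rabs l <= B * PI.
Proof.
  intros hi H hl. destruct (Rline_integral_quad_decay h B hi H) as [l' [h1 h2]].
  now rewrite (Rline_integral_unique _ _ _ hl h1).
Qed.

(** * Fourier integrals of rapidly decaying functions *)

Definition trig_transform (a k : R -> R) (s : R) : R :=
  RInt_gen (fun t => a t * k (s * t)) (Rbar_locally m_infty) (Rbar_locally p_infty).

Lemma trig_transform_unique a k s l :
  Rline_integral (fun t => a t * k (s * t)) l -> trig_transform a k s = l.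
Proof.
  exact (is_RInt_gen_unique (V := R_CompleteNormedModule)
    (Fa := Rbar_locally m_infty) (Fb := Rbar_locally p_infty) _ l).
Qed.

Lemma ex_RInt_trig a k s u v : (forall t, continuous a t) -> trig k -> ex_RInt (fun t => a t * k (s * t)) u v.
Proof.
  intros ha hk. apply ex_RInt_cont. intros t. apply (continuous_mult (K := R_AbsRing)); [apply ha|].
  now apply continuous_trig.
Qed.

Lemma quad_decay_mult a k B M : (forall t, Rabs (k t) <= M) -> quad_decay B a ->
  quad_decay (B * M) (fun t => a t * k t).
Proof.
  intros hk ha t. rewrite Rabs_mult, <- Rmult_assoc. specialize (hk t). specialize (ha t).
  pose proof (pow2_ge_0 t).
  apply Rmult_le_compat; auto; [|apply Rabs_pos].
  apply Rmult_le_pos; [lra|apply Rabs_pos].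
Qed.

Lemma trig_transform_spec a k s B :
  (forall t, continuous a t) -> quad_decay B a -> trig k ->
  Rline_integral (fun t => a t * k (s * t)) (trig_transform a k s) /\
  Rabs (trig_transform a k s) <= B * PI.
Proof.
  intros hc ha hk.
  destruct (Rline_integral_quad_decay (fun t => a t * k (s * t)) B) as [l [h1 h2]].
  - intros u v. now apply ex_RInt_trig.
  - rewrite <- (Rmult_1_r B). apply (quad_decay_mult a (fun t => k (s * t))); [|exact ha].
    intros t. now apply trig_bound.
  - rewrite (trig_transform_unique _ _ _ _ h1). now split.
Qed.

(** The part of the Schwartz condition on a real function that matters here.  All
    bounds are linear in the single constant B, so that B can be taken from the
    seminorms when the transform is shown to be tempered. *)
Record rapid (B : R) (a a1 a2 : R -> R) : Prop := {
  rapid_d1 : forall t, is_derive a t (a1 t);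
  rapid_d2 : forall t, is_derive a1 t (a2 t);
  rapid_c2 : forall t, continuous a2 t;
  rapid_b0 : quad_decay B a;
  rapid_bm : quad_decay B (fun t => t * a t);
  rapid_b1 : quad_decay B a1;
  rapid_b2 : quad_decay B a2
}.

Lemma continuous_is_derive (a a1 : R -> R) : (forall t, is_derive a t (a1 t)) -> forall t, continuous a t.
Proof.
  intros h t. apply (ex_derive_continuous (V := R_NormedModule)). now exists (a1 t).
Qed.

Lemma trig_transform_lipschitz B a k s s' :
  (forall t, continuous a t) -> quad_decay B a -> quad_decay B (fun t => t * a t) -> trig k ->
  Rabs (trig_transform a k s' - trig_transform a k s) <= B * PI * Rabs (s' - s).
Proof.
  intros hc h0 hm hk.
  destruct (trig_transform_spec a k s B hc h0 hk) as [h1 _].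
  destruct (trig_transform_spec a k s' B hc h0 hk) as [h2 _].
  assert (h3 := Rline_integral_minus _ _ _ _ h2 h1).
  replace (B * PI * Rabs (s' - s)) with (B * Rabs (s' - s) * PI) by ring.
  apply Rline_integral_bound with (3 := h3).
  - intros u v. apply ex_RInt_minus_R; now apply ex_RInt_trig.
  - intros t. rewrite <- Rmult_minus_distr_l, Rabs_mult.
    assert (h4 := trig_lipschitz k hk (s * t) (s' * t)).
    rewrite <- Rmult_minus_distr_r, Rabs_mult in h4.
    specialize (hm t). simpl in hm. rewrite Rabs_mult in hm.
    pose proof (pow2_ge_0 t). pose proof (Rabs_pos (a t)). pose proof (Rabs_pos (s' - s)).
    apply Rle_trans with ((1 + t ^ 2) * (Rabs t * Rabs (a t)) * Rabs (s' - s)).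
    + apply Rle_trans with ((1 + t ^ 2) * (Rabs (a t) * (Rabs (s' - s) * Rabs t))); [|right; ring].
      apply Rmult_le_compat_l; [lra|]. now apply Rmult_le_compat_l.
    + now apply Rmult_le_compat_r.
Qed.

Lemma continuous_lipschitz f M : (forall x y, Rabs (f y - f x) <= M * Rabs (y - x)) ->
  forall x, continuous f x.
Proof.
  intros h x. apply continuous_eps. intros eps.
  assert (hM : 0 <= M).
  { specialize (h 0 1). rewrite Rminus_0_r, Rabs_R1 in h. pose proof (Rabs_pos (f 1 - f 0)). lra. }
  assert (hd : 0 < eps / (M + 1)) by (apply Rdiv_lt_0_compat; [apply eps|lra]).
  exists (mkposreal _ hd). intros y hy. simpl in hy. eapply Rle_lt_trans; [apply h|].
  assert (e : eps / (M + 1) * (M + 1) = eps) by (field; lra).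
  pose proof (Rabs_pos (y - x)). nra.
Qed.

Lemma continuous_trig_transform B a a1 a2 k s : rapid B a a1 a2 -> trig k ->
  continuous (trig_transform a k) s.
Proof.
  intros [h1 _ _ h0 hm _ _] hk. apply (continuous_lipschitz _ (B * PI)).
  intros x y. apply trig_transform_lipschitz; auto. now apply continuous_is_derive with a1.
Qed.

(** Two integrations by parts: a2 + s^2 a integrates to 0 against k (s t), because
    F below is an antiderivative of the product that vanishes at infinity.  So s^2
    times the transform of a is minus the transform of a2, which is bounded. *)
Lemma trig_transform_decay B a a1 a2 k : rapid B a a1 a2 -> trig k ->
  quad_decay (2 * B * PI) (trig_transform a k).
Proof.
  intros [h1 h2 hc2 b0 _ b1 b2] hk s.
  assert (hc := continuous_is_derive _ _ h1).
  destruct (trig_transform_spec a k s B hc b0 hk) as [i0 e0].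
  destruct (trig_transform_spec a2 k s B hc2 b2 hk) as [i2 e2].
  assert (hdk : exists dk : R -> R, (forall x, is_derive k x (dk x)) /\
    (forall x, is_derive dk x (- k x)) /\ forall x, Rabs (dk x) <= 1).
  { destruct hk as [-> | ->].
    - exists (fun x => - sin x). split; [apply is_derive_cos|]. split.
      + intros x. apply (is_derive_opp (V := R_NormedModule) sin), is_derive_sin.
      + intros x. rewrite Rabs_Ropp. apply trig_bound. now right.
    - exists cos. split; [apply is_derive_sin|]. split; [apply is_derive_cos|].
      apply trig_bound. now left. }
  destruct hdk as (dk & hd1 & hd2 & hdb).
  set (F := fun t => a1 t * k (s * t) - s * a t * dk (s * t)).
  set (h := fun t => a2 t * k (s * t) + s ^ 2 * (a t * k (s * t))).
  assert (hF : forall t, is_derive F t (h t)).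
  { intros t. unfold F, h.
    assert (p1 : is_derive (fun t => k (s * t)) t (s * dk (s * t))).
    { apply (is_derive_comp k (fun t => s * t)); [apply hd1|]. auto_derive; [auto|ring]. }
    assert (p2 : is_derive (fun t => dk (s * t)) t (s * - k (s * t))).
    { apply (is_derive_comp dk (fun t => s * t)); [apply hd2|]. auto_derive; [auto|ring]. }
    assert (p3 : is_derive (fun t => a1 t * k (s * t)) t (a2 t * k (s * t) + a1 t * (s * dk (s * t)))).
    { apply (is_derive_mult (K := R_AbsRing) a1 (fun t => k (s * t)) t); [apply h2|exact p1|].
      intros x y. apply Rmult_comm. }
    assert (p4 : is_derive (fun t => a t * dk (s * t)) t (a1 t * dk (s * t) + a t * (s * - k (s * t)))).
    { apply (is_derive_mult (K := R_AbsRing) a (fun t => dk (s * t)) t); [apply h1|exact p2|].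
      intros x y. apply Rmult_comm. }
    apply (is_derive_scal _ _ s) in p4.
    assert (p5 := is_derive_minus (V := R_NormedModule) _ _ _ _ _ p3 p4).
    apply is_derive_ext with (f := fun t => minus (a1 t * k (s * t)) (s * (a t * dk (s * t)))).
    - intros u. change (a1 u * k (s * u) - s * (a u * dk (s * u)) = a1 u * k (s * u) - s * a u * dk (s * u)). ring.
    - match goal with |- is_derive _ _ ?x => match type of p5 with is_derive _ _ ?y => replace x with y end end;
        [exact p5|]. unfold minus, plus, opp, scal; simpl. unfold mult; simpl. ring. }
  assert (hhc : forall t, continuous h t).
  { intros t. apply (continuous_plus (V := R_NormedModule)).
    - apply (continuous_mult (K := R_AbsRing)); [apply hc2|now apply continuous_trig].
    - apply (continuous_scal_r (K := R_AbsRing) (V := R_NormedModule)).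
      apply (continuous_mult (K := R_AbsRing)); [apply hc|now apply continuous_trig]. }
  assert (hFd : quad_decay (B + Rabs s * B) F).
  { intros t. unfold F. assert (q1 := b1 t). assert (q0 := b0 t). pose proof (pow2_ge_0 t).
    apply Rle_trans with ((1 + t ^ 2) * Rabs (a1 t) + Rabs s * ((1 + t ^ 2) * Rabs (a t))).
    - replace ((1 + t ^ 2) * Rabs (a1 t) + Rabs s * ((1 + t ^ 2) * Rabs (a t)))
        with ((1 + t ^ 2) * (Rabs (a1 t) + Rabs s * Rabs (a t))) by ring.
      apply Rmult_le_compat_l; [lra|]. eapply Rle_trans; [apply Rabs_triang|].
      rewrite Rabs_Ropp, !Rabs_mult. apply Rplus_le_compat.
      + pose proof (trig_bound k hk (s * t)). pose proof (Rabs_pos (a1 t)). nra.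
      + pose proof (hdb (s * t)). pose proof (Rabs_pos (a t)). pose proof (Rabs_pos s).
        pose proof (Rmult_le_pos _ _ (Rabs_pos s) (Rabs_pos (a t))). nra.
    - apply Rplus_le_compat; [exact q1|]. apply Rmult_le_compat_l; [apply Rabs_pos|exact q0]. }
  assert (hz : Rline_integral h 0).
  { apply (is_RInt_gen_intro h (Rbar_locally m_infty) (Rbar_locally p_infty)).
    - intros u v. now apply ex_RInt_cont.
    - intros eps. pose proof (cond_pos eps).
      destruct (quad_decay_small (B + Rabs s * B) (eps / 2)) as [M [hM0 hM]]; [lra|].
      exists (fun u => u < - M) (fun v => M < v); [now exists (- M)|now exists M|].
      intros u v hu hv. simpl.
      assert (e : RInt h u v = F v - F u).
      { apply is_RInt_unique. apply (is_RInt_derive (V := R_CompleteNormedModule) F h); auto. }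
      rewrite e, Rminus_0_r.
      assert (m1 := hM F u hFd ltac:(rewrite Rabs_left; lra)).
      assert (m2 := hM F v hFd ltac:(rewrite Rabs_pos_eq; lra)).
      eapply Rle_lt_trans; [apply Rabs_triang|]. rewrite Rabs_Ropp. lra. }
  assert (hs : trig_transform a2 k s + s ^ 2 * trig_transform a k s = 0).
  { apply (Rline_integral_unique h); [|exact hz].
    apply Rline_integral_plus; [exact i2|]. now apply Rline_integral_scal. }
  pose proof (pow2_ge_0 s).
  replace ((1 + s ^ 2) * Rabs (trig_transform a k s))
    with (Rabs (trig_transform a k s) + Rabs (s ^ 2 * trig_transform a k s)).
  - replace (s ^ 2 * trig_transform a k s) with (- trig_transform a2 k s) by lra.
    rewrite Rabs_Ropp. lra.
  - rewrite Rabs_mult, (Rabs_pos_eq (s ^ 2)) by lra. ring.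
Qed.

Lemma trig_transform_opp B a k sg s : (forall t, continuous a t) -> quad_decay B a -> trig k ->
  (forall y, k (- y) = sg * k y) -> trig_transform a k (- s) = sg * trig_transform a k s.
Proof.
  intros hc h0 hk hsg. apply trig_transform_unique.
  destruct (trig_transform_spec a k s B hc h0 hk) as [h _].
  apply (Rline_integral_scal sg) in h. apply Rline_integral_ext with (2 := h). intros t.
  rewrite Ropp_mult_distr_l_reverse, hsg. ring.
Qed.

(** * Inversion at 0 for rapidly decaying functions *)

(** The point 0 is excepted because the odd quotient below is only known to be
    continuous there. *)
Lemma decreasing_derive (F F' : R -> R) :
  (forall t, continuous F t) -> (forall t, t <> 0 -> is_derive F t (F' t)) ->
  (forall t, t <> 0 -> F' t <= 0) -> decreasing F.
Proof.
  intros hc hd hn.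
  assert (H : forall x y, x <= y -> (0 <= x \/ y <= 0) -> F y <= F x).
  { intros x y hxy h0. destruct (MVT_gen F x y (fun t => Rmin 0 (F' t))) as [c [_ hcc]].
    - intros t ht. rewrite Rmin_left, Rmax_right in ht by lra.
      assert (ht0 : t <> 0) by lra.
      rewrite Rmin_right by now apply hn. now apply hd.
    - intros t _. apply continuity_pt_filterlim, hc.
    - pose proof (Rmin_l 0 (F' c)). nra. }
  intros x y hxy. destruct (Rle_dec 0 x) as [h | h]; [apply H; lra|].
  destruct (Rle_dec y 0) as [h' | h']; [apply H; lra|].
  apply Rle_trans with (F 0); apply H; lra.
Qed.

(** - B atan decreases at least as fast as F can, so that - B atan - F decreases
    too: its derivative is - B / (1 + t^2) - F' <= 0. *)
Lemma bdiff_quad_decay_derive (F F' : R -> R) B M :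
  (forall t, continuous F t) -> (forall t, t <> 0 -> is_derive F t (F' t)) ->
  (forall t, t <> 0 -> (1 + t ^ 2) * Rabs (F' t) <= B) -> (forall t, Rabs (F t) <= M) -> bdiff F.
Proof.
  intros hc hd hB hM.
  assert (hB0 : 0 <= B).
  { specialize (hB 1 ltac:(lra)). pose proof (Rabs_pos (F' 1)).
    replace (1 + 1 ^ 2) with 2 in hB by ring. lra. }
  assert (hM0 : 0 <= M) by (eapply Rle_trans; [apply Rabs_pos|apply (hM 0)]).
  assert (hP : decreasing (fun t => - (B * atan t))).
  { intros x y [h | ->]; [|lra]. apply Ropp_le_contravar, Rmult_le_compat_l; [exact hB0|].
    left. now apply atan_increasing. }
  assert (hda : forall t, is_derive (fun t => - (B * atan t)) t (- (B * / (1 + t ^ 2)))).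
  { intros t. apply (is_derive_opp (V := R_NormedModule) (fun t => B * atan t)).
    apply is_derive_scal, is_derive_atan_pow. }
  assert (hab : forall t, Rabs (- (B * atan t)) <= B * (PI / 2)).
  { intros t. rewrite Rabs_Ropp, Rabs_mult, (Rabs_pos_eq B) by lra.
    apply Rmult_le_compat_l; [lra|]. apply Rabs_le. pose proof (atan_bound t). lra. }
  exists (fun t => - (B * atan t)), (fun t => - (B * atan t) - F t), (B * (PI / 2) + M).
  split; [exact hP|]. split; [|split].
  - apply (decreasing_derive _ (fun t => - (B * / (1 + t ^ 2)) - F' t)).
    + intros t. apply (continuous_minus (V := R_NormedModule)); [|apply hc].
      apply (ex_derive_continuous (V := R_NormedModule)). eexists. apply hda.
    + intros t ht. apply (is_derive_minus (V := R_NormedModule)); [apply hda|now apply hd].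
    + intros t ht. specialize (hB t ht). pose proof (pow2_ge_0 t).
      assert (h1 : Rabs (F' t) <= B * / (1 + t ^ 2)).
      { apply Rmult_le_reg_l with (1 + t ^ 2); [lra|].
        replace ((1 + t ^ 2) * (B * / (1 + t ^ 2))) with B by (field; lra). exact hB. }
      pose proof (Rle_abs (- F' t)). rewrite Rabs_Ropp in *. lra.
  - intros t. specialize (hab t). split; [lra|].
    eapply Rle_trans; [apply Rabs_triang|]. rewrite (Rabs_Ropp (F t)). specialize (hM t). lra.
  - intros t. ring.
Qed.

Lemma is_lim_quad_decay_0 F B : quad_decay B F ->
  is_lim F p_infty 0 /\ is_lim F m_infty 0.
Proof.
  intros H. split; apply is_lim_spec; intros eps;
    destruct (quad_decay_small B eps (cond_pos eps)) as [M [hM0 hM]].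
  - exists M. intros t ht. rewrite Rminus_0_r. apply hM; [exact H|]. rewrite Rabs_pos_eq; lra.
  - exists (- M). intros t ht. rewrite Rminus_0_r. apply hM; [exact H|]. rewrite Rabs_left; lra.
Qed.

Lemma bdiff_rapid B a a1 a2 : rapid B a a1 a2 -> bdiff a.
Proof.
  intros [h1 _ _ b0 _ b1 _].
  apply (bdiff_quad_decay_derive a a1 B B).
  - now apply continuous_is_derive with a1.
  - intros; apply h1.
  - intros; apply b1.
  - intros. now apply quad_decay_bound.
Qed.

(** This is Fourier inversion for a at the point 0: the integral over [S, T] tends to
    PI/2 (a(0+) + a(0-)).  The lower bound S can be replaced by 0, because the
    transform of a is bounded. *)
Lemma is_lim_RInt_cos_transform B a a1 a2 : rapid B a a1 a2 ->
  is_lim (fun T => RInt (trig_transform a cos) 0 T) p_infty (PI * a 0).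
Proof.
  intros hr. assert (hb := bdiff_rapid _ _ _ _ hr). pose proof hr as [h1 _ _ b0 bm _ _].
  assert (hc := continuous_is_derive _ _ h1).
  destruct (is_lim_quad_decay_0 a B b0) as [lp lm].
  assert (hcos : trig cos) by now left.
  assert (hcF : forall s, continuous (trig_transform a cos) s)
    by (intros; now apply continuous_trig_transform with B a1 a2).
  assert (hR : filterlim (right_part a 0) (at_right 0) (locally (a 0))).
  { apply (filterlim_ext a); [intros u; unfold right_part; now rewrite Rplus_0_l|].
    apply (filterlim_filter_le_1 (F := locally 0)); [apply filter_le_within|apply hc]. }
  assert (hL : filterlim (left_part a 0) (at_right 0) (locally (a 0))).
  { apply (filterlim_filter_le_1 (F := locally 0)); [apply filter_le_within|].
    replace (a 0) with (left_part a 0 0) by (unfold left_part; f_equal; ring).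
    apply (continuous_comp (fun u => 0 - u) a); [|apply hc].
    apply (ex_derive_continuous (V := R_NormedModule)). auto_derive. auto. }
  destruct (RInt_half_transform_cos _ _ (vdiff_right_part a hb lp 0) hR) as (D1 & e1 & i1 & z1).
  destruct (RInt_half_transform_cos _ _ (vdiff_left_part a hb lm 0) hL) as (D2 & e2 & i2 & z2).
  assert (hF : forall s, s <> 0 -> trig_transform a cos s
    = half_transform (right_part a 0) cos s + half_transform (left_part a 0) cos s).
  { intros s hs. apply trig_transform_unique.
    rewrite <- (Rmult_1_l (half_transform (left_part a 0) cos s)).
    apply Rline_integral_ext with (fun t => a t * cos (s * (t - 0))).
    - intros t. now rewrite Rminus_0_r.
    - refine (is_RInt_gen_fourier_trig a hb lp lm cos 1 s 0 hcos _ hs).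
      intros y. rewrite cos_neg. ring. }
  assert (hi := fun S T h1 h2 => proj1 (RInt_half_transform_lim _ cos S T (vdiff_right_part a hb lp 0) hcos h1 h2)).
  assert (hi' := fun S T h1 h2 => proj1 (RInt_half_transform_lim _ cos S T (vdiff_left_part a hb lm 0) hcos h1 h2)).
  assert (hST : forall S T, 0 < S -> S < T ->
     RInt (trig_transform a cos) S T = (D1 T + D2 T) - (D1 S + D2 S)).
  { intros S T hS hT.
    replace (D1 T + D2 T - (D1 S + D2 S)) with ((D1 T - D1 S) + (D2 T - D2 S)) by ring.
    rewrite <- e1, <- e2 by lra. rewrite <- RInt_plus_R by auto.
    apply RInt_ext. intros s hs. rewrite Rmin_left in hs by lra. apply hF. lra. }
  assert (h0T : forall T, 0 < T -> RInt (trig_transform a cos) 0 T = D1 T + D2 T).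
  { intros T hT. apply Rminus_diag_uniq.
    assert (hl : filterlim (fun S => RInt (trig_transform a cos) 0 S - (D1 S + D2 S)) (at_right 0)
      (locally (0 - (0 + 0)))).
    { apply filterlim_minus_R; [|now apply filterlim_plus_R].
      apply at_right_intro. intros eps he.
      assert (hB := quad_decay_nonneg _ _ b0). pose proof PI_RGT_0.
      assert (hBP : 0 <= B * PI) by (apply Rmult_le_pos; lra).
      exists (eps / (B * PI + 1)). split; [apply Rdiv_lt_0_compat; lra|].
      intros S hS1 hS2. rewrite Rminus_0_r.
      eapply Rle_lt_trans.
      - apply (abs_RInt_le_const _ 0 S (B * PI)); [lra|now apply ex_RInt_cont|].
        intros t _. now apply trig_transform_spec.
      - assert (e : eps / (B * PI + 1) * (B * PI + 1) = eps) by (field; lra). nra. }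
    apply (filterlim_locally_unique (F := at_right 0)
      (fun S => RInt (trig_transform a cos) 0 S - (D1 S + D2 S))).
    - apply (filterlim_ext_loc (fun _ => RInt (trig_transform a cos) 0 T - (D1 T + D2 T)));
        [|apply filterlim_const].
      exists (mkposreal T hT). intros S hS hS0. change (Rabs (S - 0) < T) in hS.
      rewrite Rminus_0_r in hS. apply Rabs_def2 in hS.
      assert (e := hST S T hS0 ltac:(lra)).
      rewrite <- (RInt_Chasles_minus (trig_transform a cos) 0) in e by (intros; now apply ex_RInt_cont).
      change (RInt (trig_transform a cos) 0 T - (D1 T + D2 T)
        = RInt (trig_transform a cos) 0 S - (D1 S + D2 S)). lra.
    - now replace (0 - (0 + 0)) with 0 in hl by ring. }
  apply (is_lim_ext_loc (fun T => D1 T + D2 T)).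
  - exists 0. intros T hT. symmetry. now apply h0T.
  - replace (PI * a 0) with (PI / 2 * a 0 + PI / 2 * a 0) by field. now apply is_lim_plus'.
Qed.

Lemma half_transform_quad_decay a k s B : (forall t, continuous a t) -> quad_decay B a -> trig k ->
  is_lim (fun A => RInt (fun u => a u * k (s * u)) 0 A) p_infty (half_transform a k s).
Proof.
  intros hc hB hk.
  destruct (is_lim_quad_decay (fun u => a u * k (s * u)) B) as [l [hl _]].
  - intros u v. now apply ex_RInt_trig.
  - rewrite <- (Rmult_1_r B). apply (quad_decay_mult a (fun t => k (s * t))); [|exact hB].
    intros t. now apply trig_bound.
  - unfold half_transform. now rewrite (is_lim_unique _ _ _ hl).
Qed.

(** * The sine transform and the distribution 1/s *)

Section SineTransform.
Variables (B : R) (a a1 a2 : R -> R).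
Hypothesis ha : rapid B a a1 a2.

Let odd t := a t - a (- t).
Let odd1 t := a1 t + a1 (- t).
Let odd2 t := a2 t - a2 (- t).

Definition odd_quotient : R -> R := divx odd (2 * a1 0).
Let w := odd_quotient.

Lemma rapid_nonneg : 0 <= B.
Proof. apply quad_decay_nonneg with a, ha. Qed.

Lemma is_derive_odd t : is_derive odd t (odd1 t).
Proof.
  assert (h : is_derive (fun t => a (- t)) t (-1 * a1 (- t))).
  { apply (is_derive_comp a (fun t => - t)); [apply ha|]. auto_derive; [auto|ring]. }
  assert (h' := is_derive_minus (V := R_NormedModule) _ _ _ _ _ (rapid_d1 _ _ _ _ ha t) h).
  replace (odd1 t) with (minus (a1 t) (-1 * a1 (- t)))
    by (unfold minus, plus, opp, odd1; simpl; ring).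
  exact h'.
Qed.

Lemma is_derive_odd1 t : is_derive odd1 t (odd2 t).
Proof.
  assert (h : is_derive (fun t => a1 (- t)) t (-1 * a2 (- t))).
  { apply (is_derive_comp a1 (fun t => - t)); [apply ha|]. auto_derive; [auto|ring]. }
  assert (h' := is_derive_plus (V := R_NormedModule) _ _ _ _ _ (rapid_d2 _ _ _ _ ha t) h).
  replace (odd2 t) with (plus (a2 t) (-1 * a2 (- t)))
    by (unfold plus, odd2; simpl; ring).
  exact h'.
Qed.

Lemma quad_decay_opp b C : quad_decay C b -> forall t, (1 + t ^ 2) * Rabs (b (- t)) <= C.
Proof. intros h t. replace (t ^ 2) with ((- t) ^ 2) by ring. apply h. Qed.

Lemma quad_decay_odd : quad_decay (2 * B) odd.
Proof.
  intros t. assert (h1 := rapid_b0 _ _ _ _ ha t). assert (h2 := quad_decay_opp a B (rapid_b0 _ _ _ _ ha) t).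
  assert (h3 := Rabs_triang (a t) (- a (- t))). rewrite Rabs_Ropp in h3.
  change (odd t) with (a t + - a (- t)). pose proof (pow2_ge_0 t). nra.
Qed.

Lemma quad_decay_odd1 : quad_decay (2 * B) odd1.
Proof.
  intros t. assert (h1 := rapid_b1 _ _ _ _ ha t). assert (h2 := quad_decay_opp a1 B (rapid_b1 _ _ _ _ ha) t).
  assert (h3 := Rabs_triang (a1 t) (a1 (- t))).
  change (odd1 t) with (a1 t + a1 (- t)). pose proof (pow2_ge_0 t). nra.
Qed.

Lemma odd2_bound t : Rabs (odd2 t) <= 2 * B.
Proof.
  assert (h1 := quad_decay_bound _ _ t (rapid_b2 _ _ _ _ ha)).
  assert (h2 := quad_decay_bound _ _ (- t) (rapid_b2 _ _ _ _ ha)).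
  unfold odd2. eapply Rle_trans; [apply Rabs_triang|]. rewrite Rabs_Ropp. lra.
Qed.

Lemma quad_decay_mult_odd : quad_decay (2 * B) (fun t => t * odd t).
Proof.
  intros t. assert (h1 := rapid_bm _ _ _ _ ha t).
  assert (h2 := quad_decay_opp (fun t => t * a t) B (rapid_bm _ _ _ _ ha) t). cbv beta in h1, h2.
  assert (h3 := Rabs_triang (t * a t) (- t * a (- t))).
  replace (t * odd t) with (t * a t + - t * a (- t)) by (unfold odd; ring).
  pose proof (pow2_ge_0 t). nra.
Qed.

Lemma odd_0 : odd 0 = 0.
Proof. unfold odd. rewrite Ropp_0. ring. Qed.

Lemma odd_quotient_mult t : w t * t = odd t.
Proof.
  unfold w, odd_quotient. destruct (Req_dec t 0) as [-> | h].
  - rewrite odd_0. ring.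
  - rewrite divx_neq by exact h. field. exact h.
Qed.

Lemma continuous_odd_quotient t : continuous w t.
Proof.
  apply continuous_divx.
  - apply odd_0.
  - assert (h := is_derive_odd 0). unfold odd1 in h. rewrite Ropp_0 in h.
    replace (2 * a1 0) with (a1 0 + a1 0) by ring. exact h.
  - apply continuous_is_derive with odd1, is_derive_odd.
Qed.

Lemma quad_decay_odd_quotient : quad_decay (4 * B) w.
Proof.
  intros t. assert (hB := rapid_nonneg).
  assert (hw : Rabs (w t) * Rabs t = Rabs (odd t)) by now rewrite <- Rabs_mult, odd_quotient_mult.
  assert (h0 := quad_decay_odd t).
  pose proof (Rabs_pos (w t)). pose proof (pow2_ge_0 t).
  destruct (Rle_dec 1 (Rabs t)) as [h | h].
  - rewrite <- hw in h0.
    assert (Rabs (w t) <= Rabs (w t) * Rabs t) by nra. nra.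
  - assert (h1 : Rabs (w t) <= 2 * B).
    { destruct (Req_dec t 0) as [-> | ht].
      - unfold w, odd_quotient. rewrite divx_0, Rabs_mult, (Rabs_pos_eq 2) by lra.
        assert (h1 := quad_decay_bound _ _ 0 (rapid_b1 _ _ _ _ ha)). lra.
      - assert (hp : 0 < Rabs t) by now apply Rabs_pos_lt.
        apply Rmult_le_reg_r with (Rabs t); [exact hp|]. rewrite hw.
        assert (h1 := lipschitz_derive odd odd1 (2 * B) is_derive_odd
          (fun x => quad_decay_bound _ _ x quad_decay_odd1) 0 t).
        rewrite odd_0, !Rminus_0_r in h1. exact h1. }
    assert (h2 : t ^ 2 <= 1).
    { rewrite <- pow2_abs. pose proof (Rabs_pos t). nra. }
    nra.
Qed.

(** The numerator of the derivative of odd t / t vanishes to second order at 0,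
    because its own derivative is t * odd2 t. *)
Lemma odd_numerator_bound t : Rabs (t * odd1 t - odd t) <= 2 * B * t ^ 2.
Proof.
  destruct (MVT_gen (fun t => t * odd1 t - odd t) 0 t (fun t => t * odd2 t)) as [c [hc1 hc2]].
  - intros x _.
    assert (h1 : is_derive (fun t => t * odd1 t) x (1 * odd1 x + x * odd2 x)).
    { apply (is_derive_mult (K := R_AbsRing) (fun t => t) odd1 x).
      - apply (is_derive_id (K := R_AbsRing)).
      - apply is_derive_odd1.
      - intros u v. apply Rmult_comm. }
    assert (h2 := is_derive_minus (V := R_NormedModule) _ _ _ _ _ h1 (is_derive_odd x)).
    replace (x * odd2 x) with (minus (1 * odd1 x + x * odd2 x) (odd1 x))
      by (unfold minus, plus, opp; simpl; ring).
    exact h2.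
  - intros x _. apply continuity_pt_filterlim.
    apply (continuous_minus (V := R_NormedModule) (fun t => t * odd1 t) odd x).
    + apply (continuous_mult (K := R_AbsRing) (fun t => t) odd1 x); [apply continuous_id|].
      apply continuous_is_derive with odd2, is_derive_odd1.
    + apply continuous_is_derive with odd1, is_derive_odd.
  - cbv beta in hc2. rewrite odd_0, Rmult_0_l, !Rminus_0_r in hc2. rewrite hc2, !Rabs_mult.
    assert (h1 := odd2_bound c).
    assert (h2 : Rabs c <= Rabs t).
    { unfold Rmin, Rmax in hc1. destruct (Rle_dec 0 t); unfold Rabs; repeat destruct Rcase_abs; lra. }
    rewrite <- (pow2_abs t). pose proof (Rabs_pos t). pose proof (Rabs_pos c).
    pose proof (Rabs_pos (odd2 c)). assert (hB := rapid_nonneg).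
    apply Rle_trans with (Rabs t * (2 * B) * Rabs t); [|right; ring].
    apply Rmult_le_compat_r; [lra|]. apply Rmult_le_compat; lra.
Qed.

Lemma is_derive_odd_quotient t : t <> 0 -> is_derive w t ((t * odd1 t - odd t) / t ^ 2).
Proof.
  intros ht. apply (is_derive_ext_loc (fun t => odd t / t)).
  - exists (mkposreal (Rabs t) (Rabs_pos_lt t ht)). intros y hy. change (Rabs (y - t) < Rabs t) in hy.
    symmetry. apply divx_neq. intros ->. rewrite Rminus_0_l, Rabs_Ropp in hy. lra.
  - assert (h := is_derive_div odd (fun t => t) t (odd1 t) 1 (is_derive_odd t)
      (is_derive_id (K := R_AbsRing) t) ht).
    replace ((t * odd1 t - odd t) / t ^ 2) with ((odd1 t * t - odd t * 1) / t ^ 2) by (field; exact ht).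
    exact h.
Qed.

(** The derivative of w is O(1/(1 + t^2)): for |t| <= 1 by the second-order bound on
    its numerator, for |t| >= 1 by the decay of odd and odd1. *)
Lemma vdiff_odd_quotient : vdiff w.
Proof.
  apply bdiff_vdiff; [|now apply (is_lim_quad_decay_0 w (4 * B)), quad_decay_odd_quotient].
  apply (bdiff_quad_decay_derive w (fun t => (t * odd1 t - odd t) / t ^ 2) (4 * B) (4 * B)).
  - apply continuous_odd_quotient.
  - apply is_derive_odd_quotient.
  - intros t ht. assert (hB := rapid_nonneg).
    assert (hp : 0 < t ^ 2) by (rewrite <- pow2_abs; apply pow_lt, Rabs_pos_lt, ht).
    unfold Rdiv. rewrite Rabs_mult, Rabs_inv, (Rabs_pos_eq (t ^ 2)) by lra.
    apply Rmult_le_reg_r with (t ^ 2); [exact hp|].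
    replace ((1 + t ^ 2) * (Rabs (t * odd1 t - odd t) * / t ^ 2) * t ^ 2)
      with ((1 + t ^ 2) * Rabs (t * odd1 t - odd t)) by (field; exact ht).
    destruct (Rle_dec (t ^ 2) 1) as [h | h].
    + assert (h1 := odd_numerator_bound t).
      pose proof (Rabs_pos (t * odd1 t - odd t)). nra.
    + assert (h1 := quad_decay_odd1 t). assert (h2 := quad_decay_odd t).
      assert (h3 := Rabs_triang (t * odd1 t) (- odd t)). rewrite Rabs_Ropp, Rabs_mult in h3.
      assert (h4 : Rabs t <= t ^ 2) by (rewrite <- pow2_abs in *; pose proof (Rabs_pos t); nra).
      change (t * odd1 t - odd t) with (t * odd1 t + - odd t).
      pose proof (Rabs_pos (odd1 t)). pose proof (Rabs_pos t).
      apply Rle_trans with (Rabs t * ((1 + t ^ 2) * Rabs (odd1 t)) + (1 + t ^ 2) * Rabs (odd t)).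
      * replace (Rabs t * ((1 + t ^ 2) * Rabs (odd1 t)) + (1 + t ^ 2) * Rabs (odd t))
          with ((1 + t ^ 2) * (Rabs t * Rabs (odd1 t) + Rabs (odd t))) by ring.
        apply Rmult_le_compat_l; lra.
      * apply Rle_trans with (Rabs t * (2 * B) + 2 * B); [|nra].
        apply Rplus_le_compat; [|exact h2]. apply Rmult_le_compat_l; [lra|exact h1].
  - intros t. apply quad_decay_bound, quad_decay_odd_quotient.
Qed.

Lemma sin_transform_half s :
  is_lim (fun A => RInt (fun u => odd u * sin (s * u)) 0 A) p_infty (trig_transform a sin s).
Proof.
  assert (hsin : trig sin) by now right.
  assert (hc := continuous_is_derive _ _ (rapid_d1 _ _ _ _ ha)).
  set (h := fun u => a u * sin (s * u)).
  assert (hd : quad_decay B h).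
  { unfold h. rewrite <- (Rmult_1_r B). apply (quad_decay_mult a (fun t => sin (s * t))); [|apply ha].
    intros t. now apply trig_bound. }
  assert (hi : forall u v, ex_RInt h u v) by (intros; now apply ex_RInt_trig).
  assert (hi' : forall u v, ex_RInt (fun t => h (0 - t)) u v).
  { intros u v. eexists. apply is_RInt_reflect, RInt_correct_R, hi. }
  destruct (is_lim_quad_decay h B hi hd) as [l1 [h1 _]].
  destruct (is_lim_quad_decay (fun t => h (0 - t)) B hi') as [l2 [h2 _]].
  { intros t. replace (t ^ 2) with ((0 - t) ^ 2) by ring. apply hd. }
  rewrite (trig_transform_unique a sin s (l1 + l2)).
  - apply (is_lim_ext (fun A => RInt h 0 A + RInt (fun t => h (0 - t)) 0 A)); [|now apply is_lim_plus'].
    intros A. rewrite <- RInt_plus_R by auto. apply RInt_ext. intros u _. unfold h, odd.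
    rewrite Rminus_0_l, <- Ropp_mult_distr_r, sin_neg.
    change (a u * sin (s * u) + a (- u) * - sin (s * u) = (a u - a (- u)) * sin (s * u)). ring.
  - apply (is_RInt_gen_split h 0); [exact hi| |exact h2].
    apply is_lim_ext with (2 := h1). intros A. apply RInt_ext. intros u _. now rewrite Rplus_0_l.
Qed.

(** Differentiating cos (s t) in s produces the factor t, and w t * t = odd t. *)
Lemma is_derive_cos_transform s :
  is_derive (half_transform w cos) s (- trig_transform a sin s).
Proof.
  apply (is_derive_quadratic _ s _ (2 * B * (PI / 2))). intros h _.
  assert (hcos : trig cos) by now left. assert (hsin : trig sin) by now right.
  assert (hl := fun s => half_transform_quad_decay w cos s (4 * B)
    continuous_odd_quotient quad_decay_odd_quotient hcos).
  assert (hco := continuous_is_derive _ _ is_derive_odd).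
  assert (iw : forall s A, ex_RInt (fun u => w u * cos (s * u)) 0 A).
  { intros; apply ex_RInt_trig; [apply continuous_odd_quotient|exact hcos]. }
  assert (io : forall A, ex_RInt (fun u => odd u * sin (s * u)) 0 A).
  { intros; now apply ex_RInt_trig. }
  assert (hlim := is_lim_minus' _ _ _ _ _ (is_lim_minus' _ _ _ _ _ (hl (s + h)) (hl s))
    (is_lim_scal_l _ (- h) p_infty _ (sin_transform_half s))).
  assert (hlim' := is_lim_Rabs _ _ _ hlim).
  apply (is_lim_le_loc _ (fun _ => 2 * B * (PI / 2) * h ^ 2) p_infty _
    (Finite (2 * B * (PI / 2) * h ^ 2))) in hlim'; [| |apply is_lim_const].
  { simpl in hlim'. simpl. rewrite Ropp_mult_distr_l_reverse in hlim'.
    rewrite <- Ropp_mult_distr_r. exact hlim'. }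
  exists 0. intros A hA.
  set (X1 := fun u => w u * cos ((s + h) * u)). set (X2 := fun u => w u * cos (s * u)).
  set (X3 := fun u => odd u * sin (s * u)).
  assert (i1 : ex_RInt X1 0 A) by apply iw. assert (i2 : ex_RInt X2 0 A) by apply iw.
  assert (i3 : ex_RInt (fun u => - h * X3 u) 0 A) by apply ex_RInt_scal_R, io.
  assert (e : RInt (fun t => X1 t - X2 t - - h * X3 t) 0 A
    = RInt X1 0 A - RInt X2 0 A - - h * RInt X3 0 A).
  { rewrite (RInt_minus_R (fun t => X1 t - X2 t) (fun t => - h * X3 t)), (RInt_minus_R X1 X2),
      (RInt_scal_R X3); auto; (apply io || now apply ex_RInt_minus_R). }
  rewrite <- e.
  replace (2 * B * (PI / 2) * h ^ 2) with (2 * B * h ^ 2 * (PI / 2)) by ring.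
  eapply Rle_trans.
  - apply (RInt_quad_decay _ (2 * B * h ^ 2) 0 A); [lra| |].
    + apply ex_RInt_minus_R; [now apply ex_RInt_minus_R|exact i3].
    + intros t. unfold X1, X2, X3.
      replace (w t * cos ((s + h) * t) - w t * cos (s * t) - - h * (odd t * sin (s * t)))
        with (w t * (cos (s * t + h * t) - cos (s * t) + h * t * sin (s * t))).
      2:{ rewrite <- (odd_quotient_mult t), Rmult_plus_distr_r. ring. }
      rewrite Rabs_mult.
      assert (h1 := cos_taylor (s * t) (h * t)). assert (h2 := quad_decay_mult_odd t). cbv beta in h2.
      rewrite <- (odd_quotient_mult t) in h2.
      replace (t * (w t * t)) with (w t * t ^ 2) in h2 by ring.
      rewrite Rabs_mult, (Rabs_pos_eq (t ^ 2)) in h2 by apply pow2_ge_0.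
      pose proof (pow2_ge_0 t). pose proof (pow2_ge_0 h).
      apply Rle_trans with ((1 + t ^ 2) * (Rabs (w t) * t ^ 2) * h ^ 2).
      * apply Rle_trans with ((1 + t ^ 2) * (Rabs (w t) * (h * t) ^ 2)); [|right; ring].
        apply Rmult_le_compat_l; [lra|]. apply Rmult_le_compat_l; [apply Rabs_pos|exact h1].
      * now apply Rmult_le_compat_r.
  - assert (hB := rapid_nonneg). pose proof (pow2_ge_0 h). rewrite atan_0, Rminus_0_r.
    apply Rmult_le_compat_l; [apply Rmult_le_pos; lra|]. left. apply atan_bound.
Qed.

(** By the previous lemma the integral over [0, T] is W 0 - W T, where W is the
    cosine transform of w.  W T tends to 0 by Dirichlet's test, and W 0 is the
    integral of w. *)
Lemma is_lim_RInt_sin_transform : exists I : R,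
  is_lim (fun T => RInt (trig_transform a sin) 0 T) p_infty I /\
  is_RInt_gen (fun x => (a x - a (- x)) / x) (at_right 0) (Rbar_locally p_infty) I.
Proof.
  assert (hcos : trig cos) by now left. assert (hsin : trig sin) by now right.
  exists (half_transform w cos 0). split.
  - apply (is_lim_ext (fun T => half_transform w cos 0 - half_transform w cos T)).
    + intros T. symmetry. apply is_RInt_unique.
      assert (h : is_RInt (fun s => - - trig_transform a sin s) 0 T
        (- (half_transform w cos T - half_transform w cos 0))).
      { apply (is_RInt_opp (V := R_NormedModule)).
        apply (is_RInt_derive (V := R_CompleteNormedModule) (half_transform w cos)).
        - intros s _. apply is_derive_cos_transform.
        - intros s _. apply (continuous_opp (V := R_NormedModule)).
          now apply continuous_trig_transform with B a1 a2. }
      replace (half_transform w cos 0 - half_transform w cos T)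
        with (- (half_transform w cos T - half_transform w cos 0)) by ring.
      apply (is_RInt_ext (fun s => - - trig_transform a sin s)); [|exact h].
      intros s _. apply Ropp_involutive.
    + replace (Finite (half_transform w cos 0)) with (Finite (half_transform w cos 0 - 0))
        by (f_equal; ring).
      apply is_lim_minus'; [apply is_lim_const|].
      destruct (half_transform_spec w cos vdiff_odd_quotient hcos) as [e [_ he]].
      apply is_lim_p_infty_eps. intros eps. pose proof (cond_pos eps) as hp.
      assert (hq : 0 <= 2 * Rabs (e 0) / eps).
      { apply Rmult_le_pos; [pose proof (Rabs_pos (e 0)); lra|]. left. now apply Rinv_0_lt_compat. }
      exists (2 * Rabs (e 0) / eps). intros s hs.
      destruct (he s ltac:(lra)) as [_ h]. specialize (h 0 ltac:(lra)).
      rewrite RInt_point in h. change zero with 0 in h. eapply Rle_lt_trans; [exact h|].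
      rewrite (Rabs_pos_eq s) by lra. apply Rmult_lt_reg_r with s; [lra|].
      replace (e 0 * (2 / s) * s) with (2 * e 0) by (field; lra).
      apply Rmult_lt_compat_r with (r := eps) in hs; [|exact hp].
      replace (2 * Rabs (e 0) / eps * eps) with (2 * Rabs (e 0)) in hs by (field; lra).
      pose proof (Rle_abs (e 0)). lra.
  - assert (hiw : forall u v, ex_RInt w u v) by (intros; apply ex_RInt_cont, continuous_odd_quotient).
    assert (hB := rapid_nonneg).
    assert (hl : is_lim (fun A => RInt w 0 A) p_infty (half_transform w cos 0)).
    { apply (is_lim_ext (fun A => RInt (fun u => w u * cos (0 * u)) 0 A)).
      - intros A. apply RInt_ext. intros u _. rewrite Rmult_0_l, cos_0. apply Rmult_1_r.
      - apply half_transform_quad_decay with (4 * B); auto.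
        + apply continuous_odd_quotient.
        + apply quad_decay_odd_quotient. }
    apply (is_RInt_gen_ext (V := R_NormedModule) w).
    + exists (fun u => 0 < u) (fun v => 0 < v).
      * exists (mkposreal 1 Rlt_0_1). intros; assumption.
      * now exists 0.
      * intros u v hu hv x hx. simpl in hx.
        assert (0 < Rmin u v) by now apply Rmin_pos.
        apply (divx_neq odd (2 * a1 0)). lra.
    + apply (is_RInt_gen_intro w (at_right 0) (Rbar_locally p_infty)); [exact hiw|].
      intros eps. pose proof (cond_pos eps) as hp.
      destruct (is_lim_p_infty_elim _ _ (eps / 2) hl ltac:(lra)) as [M [_ hM]].
      assert (hd : 0 < eps / 2 / (4 * B + 1)) by (apply Rdiv_lt_0_compat; lra).
      exists (fun u => 0 < u < eps / 2 / (4 * B + 1)) (fun v => M < v); [|now exists M|].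
      * exists (mkposreal _ hd). intros y hy hy0. change (Rabs (y - 0) < eps / 2 / (4 * B + 1)) in hy.
        rewrite Rminus_0_r in hy. apply Rabs_def2 in hy. lra.
      * intros u v hu hv. simpl. rewrite <- (RInt_Chasles_minus w 0 u v hiw).
        specialize (hM v ltac:(lra)).
        assert (h1 : Rabs (RInt w 0 u) <= (u - 0) * (4 * B)).
        { apply abs_RInt_le_const; [lra|apply hiw|].
          intros t _. apply quad_decay_bound, quad_decay_odd_quotient. }
        replace (RInt w 0 v - RInt w 0 u - half_transform w cos 0)
          with ((RInt w 0 v - half_transform w cos 0) + - RInt w 0 u) by ring.
        eapply Rle_lt_trans; [apply Rabs_triang|]. rewrite Rabs_Ropp.
        assert (e : eps / 2 / (4 * B + 1) * (4 * B + 1) = eps / 2) by (field; lra). nra.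
Qed.

End SineTransform.

(** * Schwartz functions and tempered distributions *)

Lemma Cmod_le_sum (x y : R) : Cmod (x, y) <= Rabs x + Rabs y.
Proof.
  pose proof (Rabs_pos x). pose proof (Rabs_pos y).
  unfold Cmod. simpl fst. simpl snd. rewrite <- (sqrt_Rsqr (Rabs x + Rabs y)) by lra.
  apply sqrt_le_1_alt. unfold Rsqr. rewrite <- (pow2_abs x), <- (pow2_abs y). nra.
Qed.

Lemma im_le_Cmod (c : C) : Rabs (Im c) <= Cmod c.
Proof. eapply Rle_trans; [|apply Rmax_Cmod]. apply Rmax_r. Qed.

(** One order bounds powers and derivatives alike, as in [tempered]; the power 3 is
    what the decay of t a(t) like 1/(1 + t^2) requires. *)
Definition seminorm_bound (phi : R -> C) (B : R) : Prop :=
  forall (k n : nat) (x : R), (k <= 3)%nat -> (n <= 3)%nat ->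
    Rabs x ^ k * Cmod (CDerive_n phi n x) <= B.

Lemma uniform_bound (P : nat -> R -> Prop) (N : nat) :
  (forall k B B', P k B -> B <= B' -> P k B') -> (forall k, exists B, P k B) ->
  exists B, forall k, (k <= N)%nat -> P k B.
Proof.
  intros hm h. induction N as [|N [B hB]].
  - destruct (h 0%nat) as [B hB]. exists B. intros k hk. now replace k with 0%nat by lia.
  - destruct (h (S N)) as [B' hB']. exists (Rmax B B'). intros k hk.
    destruct (Nat.eq_dec k (S N)) as [-> | hn].
    + apply hm with B'; [exact hB'|apply Rmax_r].
    + apply hm with B; [apply hB; lia|apply Rmax_l].
Qed.

Lemma schwartz_seminorm_bound phi : schwartz phi -> exists B, seminorm_bound phi B.
Proof.
  intros [_ h].
  destruct (uniform_bound (fun k B => forall n, (n <= 3)%nat -> forall x,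
    Rabs x ^ k * Cmod (CDerive_n phi n x) <= B) 3) as [B hB].
  - intros k B B' hB hBB n hn x. eapply Rle_trans; [now apply hB|exact hBB].
  - intros k. apply (uniform_bound (fun n B => forall x, Rabs x ^ k * Cmod (CDerive_n phi n x) <= B) 3).
    + intros n B B' hB hBB x. eapply Rle_trans; [apply hB|exact hBB].
    + intros n. apply h.
  - exists B. intros k n x hk hn. now apply hB.
Qed.

Lemma rapid_of_derivatives (a : R -> R) (B : R) :
  (forall n x, ex_derive_n a n x) ->
  (forall k n x, (k <= 3)%nat -> (n <= 3)%nat -> Rabs x ^ k * Rabs (Derive_n a n x) <= B) ->
  rapid (2 * B) a (Derive_n a 1) (Derive_n a 2).
Proof.
  intros hd hb.
  assert (hq : forall n, (n <= 3)%nat -> quad_decay (2 * B) (Derive_n a n)).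
  { intros n hn t. assert (h0 := hb 0%nat n t ltac:(lia) hn). assert (h2 := hb 2%nat n t ltac:(lia) hn).
    rewrite pow2_abs in h2. simpl (Rabs t ^ 0) in h0. lra. }
  constructor.
  - intros t. apply (Derive_correct a t), (hd 1%nat t).
  - intros t. apply (Derive_correct (Derive_n a 1) t), (hd 2%nat t).
  - intros t. apply (ex_derive_continuous (V := R_NormedModule)), (hd 3%nat t).
  - apply (hq 0%nat). lia.
  - intros t. assert (h1 := hb 1%nat 0%nat t ltac:(lia) ltac:(lia)).
    assert (h3 := hb 3%nat 0%nat t ltac:(lia) ltac:(lia)). simpl Derive_n in h1, h3.
    rewrite Rabs_mult, <- (pow2_abs t). simpl pow in *. lra.
  - apply (hq 1%nat). lia.
  - apply (hq 2%nat). lia.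
Qed.

Definition rapid_pair (B : R) (phi : R -> C) : Prop :=
  (exists a1 a2, rapid B (fun t => Re (phi t)) a1 a2) /\
  (exists b1 b2, rapid B (fun t => Im (phi t)) b1 b2).

Lemma schwartz_rapid phi B : schwartz phi -> seminorm_bound phi B -> rapid_pair (2 * B) phi.
Proof.
  intros [hs _] hb. split.
  - exists (Derive_n (fun t => Re (phi t)) 1), (Derive_n (fun t => Re (phi t)) 2).
    apply rapid_of_derivatives; [intros n x; apply hs|].
    intros k n x hk hn. eapply Rle_trans; [|apply (hb k n x hk hn)].
    apply Rmult_le_compat_l; [apply pow_le, Rabs_pos|]. apply (re_le_Cmod (CDerive_n phi n x)).
  - exists (Derive_n (fun t => Im (phi t)) 1), (Derive_n (fun t => Im (phi t)) 2).
    apply rapid_of_derivatives; [intros n x; apply hs|].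
    intros k n x hk hn. eapply Rle_trans; [|apply (hb k n x hk hn)].
    apply Rmult_le_compat_l; [apply pow_le, Rabs_pos|]. apply (im_le_Cmod (CDerive_n phi n x)).
Qed.

Definition re_hat (phi : R -> C) (s : R) : R :=
  trig_transform (fun t => Re (phi t)) cos s + trig_transform (fun t => Im (phi t)) sin s.

Definition im_hat (phi : R -> C) (s : R) : R :=
  trig_transform (fun t => Im (phi t)) cos s - trig_transform (fun t => Re (phi t)) sin s.

Section RapidPair.
Variables (B : R) (phi : R -> C).
Hypothesis hphi : rapid_pair B phi.

Lemma is_integral_fourier_rapid s :
  is_integral (fourier_integrand phi s) (re_hat phi s, im_hat phi s).
Proof.
  destruct hphi as [(a1 & a2 & ha) (b1 & b2 & hb)].
  assert (hc := continuous_is_derive _ _ (rapid_d1 _ _ _ _ ha)).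
  assert (hc' := continuous_is_derive _ _ (rapid_d1 _ _ _ _ hb)).
  assert (hcos : trig cos) by now left. assert (hsin : trig sin) by now right.
  destruct (trig_transform_spec _ cos s B hc (rapid_b0 _ _ _ _ ha) hcos) as [h1 _].
  destruct (trig_transform_spec _ sin s B hc (rapid_b0 _ _ _ _ ha) hsin) as [h2 _].
  destruct (trig_transform_spec _ cos s B hc' (rapid_b0 _ _ _ _ hb) hcos) as [h3 _].
  destruct (trig_transform_spec _ sin s B hc' (rapid_b0 _ _ _ _ hb) hsin) as [h4 _].
  apply is_integral_pair.
  - apply Rline_integral_ext with (2 := Rline_integral_plus _ _ _ _ h1 h4). intros t.
    unfold fourier_integrand, expi. simpl. rewrite cos_neg, sin_neg. unfold Re, Im. ring.
  - apply Rline_integral_ext with (2 := Rline_integral_minus _ _ _ _ h3 h2). intros t.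
    unfold fourier_integrand, expi. simpl. rewrite cos_neg, sin_neg. unfold Re, Im. ring.
Qed.

Lemma fourier_rapid s : fourier phi s = (re_hat phi s, im_hat phi s).
Proof. apply is_integral_unique, is_integral_fourier_rapid. Qed.

Lemma fourier_rapid_correct s : is_integral (fourier_integrand phi s) (fourier phi s).
Proof. rewrite fourier_rapid. apply is_integral_fourier_rapid. Qed.

Lemma continuous_re_hat s : continuous (re_hat phi) s.
Proof.
  destruct hphi as [(a1 & a2 & ha) (b1 & b2 & hb)].
  apply (continuous_plus (V := R_NormedModule));
    [apply continuous_trig_transform with (1 := ha); now left
    |apply continuous_trig_transform with (1 := hb); now right].
Qed.

Lemma continuous_im_hat s : continuous (im_hat phi) s.
Proof.
  destruct hphi as [(a1 & a2 & ha) (b1 & b2 & hb)].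
  apply (continuous_minus (V := R_NormedModule));
    [apply continuous_trig_transform with (1 := hb); now left
    |apply continuous_trig_transform with (1 := ha); now right].
Qed.

Lemma quad_decay_hat : quad_decay (4 * B * PI) (re_hat phi) /\ quad_decay (4 * B * PI) (im_hat phi).
Proof.
  destruct hphi as [(a1 & a2 & ha) (b1 & b2 & hb)].
  assert (hcos : trig cos) by now left. assert (hsin : trig sin) by now right.
  split; intros s; pose proof (pow2_ge_0 s).
  - assert (h1 := trig_transform_decay _ _ _ _ cos ha hcos s).
    assert (h2 := trig_transform_decay _ _ _ _ sin hb hsin s).
    assert (h3 := Rabs_triang (trig_transform (fun t => Re (phi t)) cos s)
      (trig_transform (fun t => Im (phi t)) sin s)).
    unfold re_hat. nra.
  - assert (h1 := trig_transform_decay _ _ _ _ cos hb hcos s).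
    assert (h2 := trig_transform_decay _ _ _ _ sin ha hsin s).
    assert (h3 := Rabs_triang (trig_transform (fun t => Im (phi t)) cos s)
      (- trig_transform (fun t => Re (phi t)) sin s)).
    rewrite Rabs_Ropp in h3. unfold im_hat, Rminus. nra.
Qed.

Lemma is_integral_distr f M : bdiff f -> (forall x, Rabs (f x) <= M) -> exists l : C,
  is_integral (fun t => Cmult (RtoC (f t)) (fourier phi t)) l /\ Cmod l <= 8 * B * M * PI ^ 2.
Proof.
  intros hf hM. destruct quad_decay_hat as [hr hi].
  assert (H : forall r, (forall s, continuous r s) -> quad_decay (4 * B * PI) r ->
     exists l, Rline_integral (fun t => f t * r t) l /\ Rabs l <= 4 * B * PI * M * PI).
  { intros r hc hd. apply Rline_integral_quad_decay.
    - intros u v. now apply ex_RInt_bdiff.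
    - intros t. rewrite (Rmult_comm (f t)). now apply (quad_decay_mult r f). }
  destruct (H _ continuous_re_hat hr) as [lr [h1 h2]].
  destruct (H _ continuous_im_hat hi) as [li [h3 h4]].
  exists (lr, li). split.
  - apply is_integral_pair.
    + apply Rline_integral_ext with (2 := h1). intros t. rewrite fourier_rapid. simpl. ring.
    + apply Rline_integral_ext with (2 := h3). intros t. rewrite fourier_rapid. simpl. ring.
  - eapply Rle_trans; [apply Cmod_le_sum|].
    replace (8 * B * M * PI ^ 2) with (4 * B * PI * M * PI + 4 * B * PI * M * PI) by ring. lra.
Qed.

End RapidPair.

Lemma Rline_integral_heaviside (r : R -> R) l : (forall t, continuous r t) ->
  is_lim (fun A => RInt r 0 A) p_infty (Finite l) ->
  Rline_integral (fun t => heaviside t * r t) l.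
Proof.
  intros hc hl.
  assert (hH : bdiff heaviside).
  { apply (bdiff_ext (fun x => 1 - heaviside (- x))).
    - intros x. rewrite heaviside_opp. ring.
    - apply bdiff_minus; [apply bdiff_const|apply bdiff_heaviside]. }
  replace l with (l + 0) by ring.
  apply (is_RInt_gen_split (fun t => heaviside t * r t) 0).
  - intros u v. now apply ex_RInt_bdiff.
  - apply (is_lim_ext_loc (fun A => RInt r 0 A)); [|exact hl].
    exists 0. intros A hA. apply RInt_ext. intros u hu. rewrite Rmin_left in hu by lra.
    rewrite Rplus_0_l. unfold heaviside. destruct Rlt_dec; [|lra]. symmetry. apply Rmult_1_l.
  - apply (is_lim_ext_loc (fun _ => 0)); [|apply is_lim_const].
    exists 0. intros A hA. symmetry. apply is_RInt_unique.
    apply (is_RInt_ext (fun _ => 0)); [|apply is_RInt_zero].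
    intros u hu. rewrite Rmin_left in hu by lra.
    unfold heaviside. repeat destruct Rlt_dec; lra.
Qed.

Lemma Rline_integral_heaviside_opp (r : R -> R) l : (forall t, continuous r t) ->
  is_lim (fun A => RInt (fun t => r (- t)) 0 A) p_infty (Finite l) ->
  Rline_integral (fun t => heaviside (- t) * r t) l.
Proof.
  intros hc hl. replace l with (0 + l) by ring.
  apply (is_RInt_gen_split (fun t => heaviside (- t) * r t) 0).
  - intros u v. apply (ex_RInt_bdiff (fun t => heaviside (- t))); [apply bdiff_heaviside|exact hc].
  - apply (is_lim_ext_loc (fun _ => 0)); [|apply is_lim_const].
    exists 0. intros A hA. symmetry. apply is_RInt_unique.
    apply (is_RInt_ext (fun _ => 0)); [|apply is_RInt_zero].
    intros u hu. rewrite Rmin_left in hu by lra.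
    unfold heaviside. repeat destruct Rlt_dec; lra.
  - apply (is_lim_ext_loc (fun A => RInt (fun t => r (- t)) 0 A)); [|exact hl].
    exists 0. intros A hA. apply RInt_ext. intros u hu. rewrite Rmin_left in hu by lra.
    rewrite Rminus_0_l. unfold heaviside. destruct Rlt_dec; [|lra]. symmetry. apply Rmult_1_l.
Qed.

(** With phi = a + i b, the real part of phi^ is the cosine transform of a plus the
    sine transform of b, and the imaginary part the cosine transform of b minus the
    sine transform of a.  Over s > 0 the cosine transforms contribute PI times the
    value at 0 and the sine transforms contribute 1/s; over s < 0 the latter change sign. *)
Lemma is_integral_heaviside_fourier B phi : rapid_pair B phi ->
  is_integral (fun t => Cmult (RtoC (heaviside t)) (fourier phi t))
    (RtoC PI * dirac phi + / Ci * inv_distr phi)%C /\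
  is_integral (fun t => Cmult (RtoC (heaviside (- t))) (fourier phi t))
    (RtoC PI * dirac phi - / Ci * inv_distr phi)%C.
Proof.
  intros hphi. pose proof hphi as [(a1 & a2 & ha) (b1 & b2 & hb)].
  set (a := fun t => Re (phi t)) in *. set (b := fun t => Im (phi t)) in *.
  assert (hcos : trig cos) by now left. assert (hsin : trig sin) by now right.
  assert (ca := is_lim_RInt_cos_transform _ _ _ _ ha).
  assert (cb := is_lim_RInt_cos_transform _ _ _ _ hb).
  destruct (is_lim_RInt_sin_transform _ _ _ _ ha) as [Ia [sa ia]].
  destruct (is_lim_RInt_sin_transform _ _ _ _ hb) as [Ib [sb ib]].
  assert (hinv : inv_distr phi = (Ia, Ib)).
  { refine (is_RInt_gen_unique (V := C_R_CompleteNormedModule)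
      (Fa := at_right 0) (Fb := Rbar_locally p_infty) _ (Ia, Ib) _).
    assert (hpos : forall F1 F2 : R -> R, (forall x, 0 < x -> F1 x = F2 x) -> forall l,
      is_RInt_gen F1 (at_right 0) (Rbar_locally p_infty) l ->
      is_RInt_gen F2 (at_right 0) (Rbar_locally p_infty) l).
    { intros F1 F2 e l. apply (is_RInt_gen_ext (V := R_NormedModule)).
      exists (fun u => 0 < u) (fun v => 0 < v).
      - exists (mkposreal 1 Rlt_0_1). intros; assumption.
      - now exists 0.
      - intros u v hu hv x hx. simpl in hx.
        assert (0 < Rmin u v) by now apply Rmin_pos. apply e. lra. }
    refine (is_RInt_gen_pair (at_right 0) (Rbar_locally p_infty) _ Ia Ib _ _).
    - apply hpos with (2 := ia). intros x hx.
      unfold a, Re, Cdiv, Cinv, Cminus, Cplus, Cmult, Copp, RtoC. simpl. field. lra.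
    - apply hpos with (2 := ib). intros x hx.
      unfold b, Im, Cdiv, Cinv, Cminus, Cplus, Cmult, Copp, RtoC. simpl. field. lra. }
  assert (cont : forall k, trig k -> (forall s, continuous (trig_transform a k) s) /\
     (forall s, continuous (trig_transform b k) s)).
  { intros k hk. split; intros s; [now apply continuous_trig_transform with (1 := ha)
      |now apply continuous_trig_transform with (1 := hb)]. }
  assert (iT : forall k, trig k -> (forall T, ex_RInt (trig_transform a k) 0 T) /\
     forall T, ex_RInt (trig_transform b k) 0 T).
  { intros k hk. destruct (cont k hk) as [c1 c2]. split; intros T; now apply ex_RInt_cont. }
  destruct (iT cos hcos) as [iac ibc]. destruct (iT sin hsin) as [ias ibs].
  assert (par : forall s, trig_transform a cos (- s) = trig_transform a cos s /\
    trig_transform b cos (- s) = trig_transform b cos s /\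
    trig_transform a sin (- s) = - trig_transform a sin s /\
    trig_transform b sin (- s) = - trig_transform b sin s).
  { intros s.
    assert (pc : forall y, cos (- y) = 1 * cos y) by (intros; rewrite cos_neg; ring).
    assert (ps : forall y, sin (- y) = -1 * sin y) by (intros; rewrite sin_neg; ring).
    assert (xa := continuous_is_derive _ _ (rapid_d1 _ _ _ _ ha)).
    assert (xb := continuous_is_derive _ _ (rapid_d1 _ _ _ _ hb)).
    rewrite (trig_transform_opp B a cos 1), (trig_transform_opp B b cos 1),
      (trig_transform_opp B a sin (-1)), (trig_transform_opp B b sin (-1)); auto;
      try apply ha; try apply hb. repeat split; ring. }
  assert (lim2 : forall (F G H : R -> R) c l1 l2, (forall T, ex_RInt F 0 T) -> (forall T, ex_RInt G 0 T) ->
    (forall s, H s = F s + c * G s) -> is_lim (fun T => RInt F 0 T) p_infty (Finite l1) ->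
    is_lim (fun T => RInt G 0 T) p_infty (Finite l2) ->
    is_lim (fun T => RInt H 0 T) p_infty (Finite (l1 + c * l2))).
  { intros F G H c l1 l2 hF hG hH h1 h2.
    apply (is_lim_ext (fun T => RInt F 0 T + c * RInt G 0 T)).
    - intros T. rewrite <- RInt_scal_R, <- RInt_plus_R by (auto; now apply ex_RInt_scal_R).
      apply RInt_ext. intros s _. symmetry. apply hH.
    - apply is_lim_plus'; [exact h1|]. now apply (is_lim_scal_l _ c p_infty (Finite l2)). }
  assert (cr := continuous_re_hat B phi hphi). assert (ci := continuous_im_hat B phi hphi).
  assert (ea : a 0 = Re (phi 0)) by reflexivity. assert (eb : b 0 = Im (phi 0)) by reflexivity.
  split.
  - replace (RtoC PI * dirac phi + / Ci * inv_distr phi)%C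
      with ((PI * a 0 + 1 * Ib, PI * b 0 + -1 * Ia) : C).
    2:{ rewrite hinv, ea, eb. unfold dirac, Ci, Cinv, Cmult, Cplus, RtoC, Re, Im. simpl.
        destruct (phi 0) as [x y]. apply injective_projections; simpl; field. }
    apply is_integral_pair.
    + apply Rline_integral_ext with (fun t => heaviside t * re_hat phi t).
      * intros t. rewrite (fourier_rapid B) by exact hphi. simpl. ring.
      * apply Rline_integral_heaviside; [exact cr|].
        apply (lim2 _ _ _ _ _ _ iac ibs); [|exact ca|exact sb].
        intros s. unfold re_hat. fold a b. ring.
    + apply Rline_integral_ext with (fun t => heaviside t * im_hat phi t).
      * intros t. rewrite (fourier_rapid B) by exact hphi. simpl. ring.
      * apply Rline_integral_heaviside; [exact ci|].
        apply (lim2 _ _ _ _ _ _ ibc ias); [|exact cb|exact sa].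
        intros s. unfold im_hat. fold a b. ring.
  - replace (RtoC PI * dirac phi - / Ci * inv_distr phi)%C
      with ((PI * a 0 + -1 * Ib, PI * b 0 + 1 * Ia) : C).
    2:{ rewrite hinv, ea, eb. unfold dirac, Ci, Cinv, Cmult, Cplus, Cminus, Copp, RtoC, Re, Im. simpl.
        destruct (phi 0) as [x y]. apply injective_projections; simpl; field. }
    apply is_integral_pair.
    + apply Rline_integral_ext with (fun t => heaviside (- t) * re_hat phi t).
      * intros t. rewrite (fourier_rapid B) by exact hphi. simpl. ring.
      * apply Rline_integral_heaviside_opp; [exact cr|].
        apply (lim2 _ _ _ _ _ _ iac ibs); [|exact ca|exact sb].
        intros s. unfold re_hat. fold a b. destruct (par s) as (-> & _ & _ & ->). ring.
    + apply Rline_integral_ext with (fun t => heaviside (- t) * im_hat phi t).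
      * intros t. rewrite (fourier_rapid B) by exact hphi. simpl. ring.
      * apply Rline_integral_heaviside_opp; [exact ci|].
        apply (lim2 _ _ _ _ _ _ ibc ias); [|exact cb|exact sa].
        intros s. unfold im_hat. fold a b. destruct (par s) as (_ & -> & -> & _). ring.
Qed.

Lemma bdiff_bounded f : bdiff f -> exists M, forall x, Rabs (f x) <= M.
Proof.
  intros (P & Q & M & _ & _ & hM & hf). exists (M + M). intros x. rewrite hf.
  destruct (hM x). eapply Rle_trans; [apply Rabs_triang|]. rewrite Rabs_Ropp. lra.
Qed.

Lemma schwartz_rapid_pair phi : schwartz phi -> exists B, rapid_pair B phi.
Proof.
  intros h. destruct (schwartz_seminorm_bound phi h) as [B hB].
  exists (2 * B). now apply schwartz_rapid.
Qed.

Lemma is_integral_distr_of f phi : bdiff f -> schwartz phi ->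
  is_integral (fun t => Cmult (RtoC (f t)) (fourier phi t)) (fourier_distr (distr_of f) phi).
Proof.
  intros hf h. destruct (schwartz_rapid_pair phi h) as [B hB].
  destruct (bdiff_bounded f hf) as [M hM].
  destruct (is_integral_distr B phi hB f M hf hM) as [l [hl _]].
  unfold fourier_distr, distr_of. now rewrite (is_integral_unique _ _ hl).
Qed.

(** |f| <= M and the decay of phi^ bound the pairing by a multiple of the constant
    that controls phi. *)
Lemma tempered_fourier_distr f : bdiff f -> tempered (fourier_distr (distr_of f)).
Proof.
  intros hf. split.
  - intros a b phi psi hphi hpsi.
    assert (hlin : forall s, fourier (fun x => a * phi x + b * psi x)%C s
      = (a * fourier phi s + b * fourier psi s)%C).
    { intros s. destruct (schwartz_rapid_pair phi hphi) as [B hB].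
      destruct (schwartz_rapid_pair psi hpsi) as [B' hB'].
      apply is_integral_unique.
      apply is_integral_ext with (2 := is_integral_Cplus _ _ _ _
        (is_integral_Cmult a _ _ (fourier_rapid_correct B phi hB s))
        (is_integral_Cmult b _ _ (fourier_rapid_correct B' psi hB' s))).
      intros t. unfold fourier_integrand. ring. }
    apply is_integral_unique.
    apply is_integral_ext with (2 := is_integral_Cplus _ _ _ _
        (is_integral_Cmult a _ _ (is_integral_distr_of f phi hf hphi))
        (is_integral_Cmult b _ _ (is_integral_distr_of f psi hf hpsi))).
    intros t. rewrite hlin. ring.
  - destruct (bdiff_bounded f hf) as [M hM].
    exists 3%nat, (16 * M * PI ^ 2). intros phi B hphi hB.
    destruct (is_integral_distr (2 * B) phi (schwartz_rapid phi B hphi hB) f M hf hM) as [l [hl hl']].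
    unfold fourier_distr, distr_of. rewrite (is_integral_unique _ _ hl). lra.
Qed.

Theorem theorem4p1 (f g : R -> R)
  (hf : bounded_variation_Rbar f)
  (hg : forall x : R,
     g x = (f x - extend f p_infty * heaviside x
                - extend f m_infty * heaviside (- x))%R) :
  (* the limits defining f(+oo) and f(-oo) exist and are finite *)
  is_lim f p_infty (Finite (extend f p_infty)) /\
  is_lim f m_infty (Finite (extend f m_infty)) /\
  bounded_variation_Rbar g /\
  is_lim g p_infty (Finite 0) /\
  is_lim g m_infty (Finite 0) /\
  tempered (fourier_distr (distr_of f)) /\
  tempered (fourier_distr (distr_of g)) /\
  distr_eq (fourier_distr (distr_of f))
    (fun phi : R -> C =>
       (fourier_distr (distr_of g) phi
        + RtoC (extend f p_infty) * (RtoC PI * dirac phi + / Ci * inv_distr phi)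
        + RtoC (extend f m_infty) * (RtoC PI * dirac phi - / Ci * inv_distr phi))%C) /\
  let ghat : R -> C := fourier (fun t : R => RtoC (g t)) in
  (forall s : R, s <> 0%R ->
     is_integral (fourier_integrand (fun t : R => RtoC (g t)) s) (ghat s)) /\
  (forall x : R,
     let h : R -> C := fun s : R => (expi (x * s) * ghat s)%C in
     (forall S T : R, (0 < S)%R -> (S < T)%R -> ex_annulus_integral h S T) /\
     exists (fl fr : R) (L : C),
       filterlim f (at_left x) (locally fl) /\
       filterlim f (at_right x) (locally fr) /\
       filterlim (fun TS : R * R => annulus_integral h (snd TS) (fst TS))
         (filter_prod (Rbar_locally p_infty) (at_right 0)) (locally L) /\
       (RtoC ((fl + fr) / 2) =
        / (RtoC 2 * RtoC PI) * L
        + RtoC (extend f p_infty) * RtoC (heaviside x)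
        + RtoC (extend f m_infty) * RtoC (heaviside (- x)))%C).
Proof.
  apply bounded_variation_bdiff in hf.
  assert (hlp := is_lim_extend_p_infty f hf). assert (hlm := is_lim_extend_m_infty f hf).
  set (p := extend f p_infty) in *. set (m := extend f m_infty) in *.
  (* As H(x) = 1 - H(-x) everywhere, g is f minus a constant and one decreasing jump. *)
  assert (hg' : forall x, g x = f x - p - (m - p) * heaviside (- x)).
  { intros x. rewrite hg, (heaviside_opp x). ring. }
  assert (hgb : bdiff g).
  { apply (bdiff_ext (fun x => f x - p - (m - p) * heaviside (- x))); [intros; now rewrite hg'|].
    apply bdiff_minus; [apply bdiff_minus; [exact hf|apply bdiff_const]|].
    apply bdiff_scal, bdiff_heaviside. }
  assert (hgp : is_lim g p_infty 0).
  { apply (is_lim_ext_loc (fun x => f x - p)).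
    - exists 0. intros x hx. rewrite hg'. unfold heaviside. repeat destruct Rlt_dec; lra.
    - replace (Finite 0) with (Finite (p - p)) by (f_equal; ring).
      apply is_lim_minus'; [exact hlp|apply is_lim_const]. }
  assert (hgm : is_lim g m_infty 0).
  { apply (is_lim_ext_loc (fun x => f x - m)).
    - exists 0. intros x hx. rewrite hg'. unfold heaviside. repeat destruct Rlt_dec; lra.
    - replace (Finite 0) with (Finite (m - m)) by (f_equal; ring).
      apply is_lim_minus'; [exact hlm|apply is_lim_const]. }
  split; [exact hlp|]. split; [exact hlm|]. split; [now apply bdiff_bounded_variation|].
  split; [exact hgp|]. split; [exact hgm|].
  split; [now apply tempered_fourier_distr|]. split; [now apply tempered_fourier_distr|].
  split; [|split].
  - intros phi hphi. destruct (schwartz_rapid_pair phi hphi) as [B hB].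
    destruct (is_integral_heaviside_fourier B phi hB) as [h1 h2].
    apply is_integral_unique.
    apply is_integral_ext with (2 := is_integral_Cplus _ _ _ _
      (is_integral_Cplus _ _ _ _ (is_integral_distr_of g phi hgb hphi) (is_integral_Cmult (RtoC p) _ _ h1))
      (is_integral_Cmult (RtoC m) _ _ h2)).
    intros t. rewrite hg, !RtoC_minus, !RtoC_mult. ring.
  - intros s hs. now apply is_integral_fourier.
  - intros x h. split.
    + intros S T hS hT.
      destruct (is_RInt_annulus g hgb hgp hgm x S T hS hT) as (I & J & _ & h1 & h2).
      split; [now exists (I, - J)|now exists (I, J)].
    + destruct (bdiff_left_limit g x hgb) as [gl hgl].
      destruct (bdiff_right_limit g x hgb) as [gr hgr].
      destruct (heaviside_limits x) as (hl & hr & hhl & hhr & hH).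
      assert (hf' : forall y, g y + ((p - m) * heaviside y + m) = f y).
      { intros y. rewrite hg', heaviside_opp. ring. }
      exists (gl + ((p - m) * hl + m)), (gr + ((p - m) * hr + m)), (RtoC (PI * (gl + gr))).
      split; [|split; [|split]].
      * apply (filterlim_ext _ _ hf').
        apply filterlim_plus_R; [exact hgl|]. apply filterlim_plus_R; [|apply filterlim_const].
        now apply filterlim_scal_R.
      * apply (filterlim_ext _ _ hf').
        apply filterlim_plus_R; [exact hgr|]. apply filterlim_plus_R; [|apply filterlim_const].
        now apply filterlim_scal_R.
      * now apply annulus_integral_lim.
      * pose proof PI_RGT_0. rewrite heaviside_opp.
        assert (e : (/ (RtoC 2 * RtoC PI))%C = RtoC (/ (2 * PI))).
        { rewrite <- RtoC_mult, RtoC_inv by lra. reflexivity. }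
        rewrite e, <- !RtoC_mult, <- !RtoC_plus. f_equal. rewrite <- hH. field. lra.
Qed.
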